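(* Let $d\ge 1$ be an integer and let $\alpha$ be a real number with $1\le \alpha<d/2$. Let $S_0=0$ and $S_k=\xi_1+\dots+\xi_k$ be a random walk on $\mathbb{Z}^d$ with i.i.d. increments $\xi_j$ satisfying $E[\xi_1]=0$ and $E[\exp(\lambda\cdot\xi_1)]<\infty$ for all $\lambda\in\mathbb{R}^d$. Let $\{\eta(x),x\in\mathbb{Z}^d\}$ be i.i.d. symmetric real random variables, independent of the walk, whose common law has a density with respect to Lebesgue measure that is even and decreasing on $\mathbb{R}^+$, and such that for some constant $c_\alpha>0$, $P_\eta(\eta(x)>t)\sim\exp(-c_\alpha t^\alpha)$ for $t$ large. Let $X_n=\sum_{k=0}^n\eta(S_k)$. Then there are constants $c_1,c_2>0$ such that for every $y>0$ and all $n$ large enough, $$\exp\left(-c_1(ny)^{\alpha/(\alpha+1)}\right)\le \mathbb{P}_0\otimes P_\eta\left[X_n\ge ny\right]\le \exp\left(-c_2(ny)^{\alpha/(\alpha+1)}\right).$$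
   Context: $\mathbb{P}_0$ denotes the law of the walk started at $S_0=0$, $P_\eta$ the law of the scenery $\{\eta(x)\}$, and $\mathbb{P}_0\otimes P_\eta$ the product law (walk and scenery independent). The notation $f(t)\sim g(t)$ means $f(t)/g(t)\to1$ as $t\to\infty$.
   Formalization: The walk is also assumed genuinely d-dimensional (no nonzero vector is almost surely orthogonal to its increments); without this the claim is false: if all increments are 0, X_n=(n+1)η(0) and the upper bound fails. *)

(* Defs.v *)
From HB Require Import structures.
From mathcomp Require Import all_boot all_order all_algebra.
From mathcomp Require Import finmap.
From mathcomp Require Import all_classical all_reals all_analysis.

Set Implicit Arguments.
Unset Strict Implicit.
Unset Printing Implicit Defensive.

Import Order.TTheory GRing.Theory Num.Theory.
Import numFieldNormedType.Exports.

Local Open Scope classical_set_scope.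
Local Open Scope ring_scope.

(* Z^d, as an alias of 'rV[int]_d carrying the discrete sigma-algebra *)
Definition zlattice (d : nat) := 'rV[int]_d.

HB.instance Definition _ (d : nat) := GRing.Zmodule.on (zlattice d).
HB.instance Definition _ (d : nat) := isPointed.Build (zlattice d) 0.
HB.instance Definition _ (d : nat) :=
  @isMeasurable.Build default_measure_display (zlattice d)
    discrete_measurable discrete_measurable0
    discrete_measurableC discrete_measurableU.

Definition dotz (R : realType) (d : nat) (l : 'rV[R]_d) (z : zlattice d) : R :=
  \sum_(i < d) l 0 i * (z 0 i)%:~R.

Definition mutually_independent (R : realType) (dW dT : measure_display)
    (W : measurableType dW) (T : measurableType dT) (P : probability W R)
    (I : choiceType) (X : I -> {RV P >-> T}) : Prop :=
  forall (J : {fset I}) (B : I -> set T),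
    (forall i, measurable (B i)) ->
    P (\bigcap_(i in [set` J]) (X i @^-1` B i)) =
    (\prod_(i <- J) P (X i @^-1` B i))%E.

Definition identically_distributed (R : realType) (dW dT : measure_display)
    (W : measurableType dW) (T : measurableType dT) (P : probability W R)
    (I : choiceType) (X : I -> {RV P >-> T}) : Prop :=
  forall (i j : I) (B : set T), measurable B ->
    distribution P (X i) B = distribution P (X j) B.

Definition iid (R : realType) (dW dT : measure_display)
    (W : measurableType dW) (T : measurableType dT) (P : probability W R)
    (I : choiceType) (X : I -> {RV P >-> T}) : Prop :=
  mutually_independent X /\ identically_distributed X.

Definition centered (R : realType) (dW : measure_display)
    (W : measurableType dW) (P : probability W R) (d : nat)
    (X : {RV P >-> zlattice d}) : Prop :=
  forall i : 'I_d, ('E_P[fun w => (X w 0 i)%:~R] = 0)%E.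

Definition exponential_moments (R : realType) (dW : measure_display)
    (W : measurableType dW) (P : probability W R) (d : nat)
    (X : {RV P >-> zlattice d}) : Prop :=
  forall l : 'rV[R]_d, ('E_P[fun w => expR (dotz l (X w))] < +oo)%E.

(* The law of X is not carried by a proper linear subspace of R^d (Spitzer's
   "genuinely d-dimensional"). This is what a random walk "on Z^d" is taken to
   mean: for X = 0 a.s., or a walk confined to a line of Z^3, the upper bound
   of the theorem fails. *)
Definition genuinely_dimensional (R : realType) (dW : measure_display)
    (W : measurableType dW) (P : probability W R) (d : nat)
    (X : {RV P >-> zlattice d}) : Prop :=
  forall l : 'rV[R]_d, l != 0 -> (P [set w | dotz l (X w) = 0%R] < 1)%E.

Definition symmetric_law (R : realType) (dE : measure_display)
    (E : measurableType dE) (P : probability E R) (Y : {RV P >-> R}) : Prop :=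
  forall B : set R, measurable B ->
    distribution P Y (-%R @^-1` B) = distribution P Y B.

Definition has_density (R : realType) (dE : measure_display)
    (E : measurableType dE) (P : probability E R) (Y : {RV P >-> R})
    (f : R -> R) : Prop :=
  [/\ measurable_fun [set: R] f,
      forall x, 0 <= f x &
      forall B : set R, measurable B ->
        distribution P Y B = (\int[lebesgue_measure]_(x in B) (f x)%:E)%E].

(* f(t) ~ g(t) as t -> +oo *)
Definition asymptotic (R : realType) (f g : R -> R) : Prop :=
  f t / g t @[t --> +oo] --> (1 : R).

(* The increment xi_{j+1} of the text is xi j. *)
Definition walk (R : realType) (dW : measure_display) (W : measurableType dW)
    (P : probability W R) (d : nat) (xi : nat -> {RV P >-> zlattice d})
    (k : nat) (w : W) : zlattice d :=
  \sum_(j < k) xi j w.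

Definition scenery_sum (R : realType) (dW dE : measure_display)
    (W : measurableType dW) (E : measurableType dE)
    (P0 : probability W R) (Peta : probability E R) (d : nat)
    (xi : nat -> {RV P0 >-> zlattice d}) (eta : zlattice d -> {RV Peta >-> R})
    (n : nat) (we : W * E) : R :=
  \sum_(k < n.+1) eta (walk xi k we.1) we.2.

(* Main.v *)
(* Write g = alpha / (alpha + 1); then 1 - g / alpha = g and N = (ny)^g,
   v = (ny)^(1/(alpha+1)) satisfy N v = ny and v^alpha = N.

   Lower bound: the increments charge every open half-space, so a deterministic
   walk that always steps against its current position stays bounded, and two
   equal positions give a cycle of charged increments with sum 0. Following this
   cycle N times costs exp(-O(N)) and yields N visits to the origin. Asking
   eta(0) > v costs exp(-O(N)) as well, and by symmetry the remaining sites
   contribute a nonnegative sum with probability at least 1/2.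

   Upper bound: the walk leaves the box B of radius n^2 with negligible
   probability. Split the sum at scenery level K = n^delta and at local time
   L0 = n^(1-g-3 delta).
   - Values above K: outside an event of probability exp(-c N), the function
     f = eta 1_{eta > K} 1_B has l^alpha-mass at most N. Since alpha < d/2, the
     Green operator is bounded from l^alpha to l^infinity, and Khas'minskii's
     lemma bounds the tail of sum_k f(S_k) by 2 exp(-c ny / N^(1/alpha)).
   - Values below K at sites of local time at most L0: a sum of bounded symmetric
     variables, subgaussian with variance of order K^2 L0 n.
   - Sites of local time above L0: there are at most V = O(n / L0) of them, so a
     union over the V-tuples of sites of B, with Khas'minskii's lemma for the
     exponent b between alpha and d/2, suffices. *)

Require Import Defs.
From HB Require Import structures.
From mathcomp Require Import all_boot all_order all_algebra.
From mathcomp Require Import finmap.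
From mathcomp Require Import all_classical all_reals all_analysis measurable_realfun.
From mathcomp Require Import ring lra zify.

Set Implicit Arguments.
Unset Strict Implicit.
Unset Printing Implicit Defensive.

Import Order.TTheory GRing.Theory Num.Theory.
Import numFieldNormedType.Exports.

Local Open Scope classical_set_scope.
Local Open Scope ring_scope.

(** * Independence and exponential Markov bounds *)

(** The heat kernel bound behind the Green operator is obtained without Fourier analysis. Two points
    charged by the increments make a step a fair coin between them with positive probability, and d
    such pairs with independent differences yield the decay k^(-d/2). The k-th iterate of the
    transition operator then maps l^alpha to l^infinity with norm O(k^(-d/(2 alpha))), which is
    summable because alpha < d/2.

    For values above K the exponent alpha leaves no room: with mass N, the ratio ny / N^(1/alpha) is
    itself of order (ny)^g, so no union over sceneries could be paid for, and the scenery is fixed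
    before the walk is integrated. For sites of high local time a union is unavoidable and costs
    n^(g + 3 delta) up to a logarithm, so the gain has to exceed n^g by a power. At exponent alpha
    it would be of order n^g at best; at b > alpha it is about n^(1 - g/b), and 1 - g/b - g =
    g/alpha - g/b > 0. A tenth of this gap is delta. *)

Section finite_image.
Context (R : realType) (d0 d1 : measure_display)
  (O : measurableType d0) (S : measurableType d1).
Variables (nu : {finite_measure set O -> \bar R}) (Z : {mfun O >-> S}).

(** The total mass may be below 1: [independent_off_step] works with [P] restricted to an event. *)
Definition finite_image (A : set S) : \bar R := nu (Z @^-1` A).

Let finite_image0 : finite_image set0 = 0%E.
Proof. by rewrite /finite_image preimage_set0 measure0. Qed.

Let finite_image_ge0 A : (0 <= finite_image A)%E.
Proof. exact: measure_ge0. Qed.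

Let finite_image_sigma_additive : semi_sigma_additive finite_image.
Proof. exact: (@measure_semi_sigma_additive _ _ _ (pushforward nu Z)). Qed.

HB.instance Definition _ := isMeasure.Build _ _ _ finite_image
  finite_image0 finite_image_ge0 finite_image_sigma_additive.

Let finite_image_fin : fin_num_fun finite_image.
Proof. by move=> A mA; apply: fin_num_measure; exact: measurable_funPTI. Qed.

HB.instance Definition _ :=
  Measure_isFinite.Build _ _ _ finite_image finite_image_fin.

End finite_image.

Section independence.
Context (R : realType) (d0 d1 d2 : measure_display)
  (O : measurableType d0) (S : measurableType d1) (T : measurableType d2).
Local Open Scope ereal_scope.

(** Factorization on rectangles identifies the joint law of [Z] and [X] under [nu] with a product
    measure, and Tonelli applies. [nu] may differ from [P] so that it can be [P] restricted to an
    event about further variables. *)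
Lemma ge0_integral_indep_pair (P : probability O R)
    (nu : {finite_measure set O -> \bar R}) (Z : O -> S) (X : O -> T)
    (F : S * T -> \bar R) :
  measurable_fun setT Z -> measurable_fun setT X ->
  (forall C D, measurable C -> measurable D ->
    nu (Z @^-1` C `&` X @^-1` D) = nu (Z @^-1` C) * P (X @^-1` D)) ->
  measurable_fun setT F -> (forall z, 0 <= F z) ->
  \int[nu]_w F (Z w, X w) = \int[nu]_w \int[P]_w' F (Z w, X w').
Proof.
move=> mZ mX nuE mF F0.
pose Zp : {mfun O >-> S} := HB.pack Z (isMeasurableFun.Build _ _ _ _ Z mZ).
pose Xp : {mfun O >-> T} := HB.pack X (isMeasurableFun.Build _ _ _ _ X mX).
pose m1f : {finite_measure set S -> \bar R} := finite_image nu Zp.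
pose m2 := distribution P Xp.
have mZX : measurable_fun setT (fun w => (Z w, X w)).
  exact/measurable_fun_pair.
pose ZX : {mfun O >-> (S * T)%type} :=
  HB.pack (fun w => (Z w, X w)) (isMeasurableFun.Build _ _ _ _ _ mZX).
have mE : forall A, measurable A -> (m1f \x m2) A = pushforward nu ZX A.
  by apply: product_measure_unique => A B mA mB; exact: nuE.
transitivity (\int[pushforward nu ZX]_z F z).
  by rewrite ge0_integral_pushforward.
transitivity (\int[m1f \x m2]_z F z).
  by apply: eq_measure_integral => A mA _; exact/esym/mE.
rewrite fubini_tonelli1// /fubini_F /=.
under eq_integral.
  move=> x _; rewrite ge0_integral_distribution//; last exact: measurableT_comp.
  over.
rewrite ge0_integral_pushforward//; last first.
  by move=> z _; apply: integral_ge0 => t _; exact: F0.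
rewrite (_ : (fun _ => _) = fubini_F P (fun z => F (z.1, X z.2))) //.
apply: measurable_fun_fubini_tonelli_F => //.
apply: measurableT_comp => //; apply/measurable_fun_pair => //=.
exact: measurableT_comp.
Qed.

End independence.

Section independent_of.
Context (R : realType) (dO dT : measure_display)
  (O : measurableType dO) (T : measurableType dT) (P : probability O R)
  (I : choiceType) (X : I -> {RV P >-> T}).
Local Open Scope ereal_scope.

(** Meant for [Z] computed from the [X i] with [i] in [L]. Independence is asked jointly from the
    remaining variables, which lets them be absorbed into [Z] one at a time without generated
    sigma-algebras. *)
Definition independent_off (d : measure_display) (S : measurableType d)
    (Z : O -> S) (L : {pred I}) : Prop :=
  [/\ measurable_fun setT Z &
  forall (C : set S) (J : {fset I}) (B : I -> set T),
    measurable C -> (forall i, measurable (B i)) ->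
    (forall i, i \in J -> i \notin L) ->
    P (Z @^-1` C `&` \bigcap_(i in [set` J]) (X i @^-1` B i)) =
    P (Z @^-1` C) * \prod_(i <- J) P (X i @^-1` B i)].

Hypothesis indepX : mutually_independent X.

Lemma measurable_fset_bigcap (J : {fset I}) (B : I -> set T) :
  (forall i, measurable (B i)) ->
  measurable (\bigcap_(i in [set` J]) (X i @^-1` B i)).
Proof.
move=> mB; apply: fin_bigcap_measurable => [|i _]; first exact: finite_fset.
exact: measurable_funPTI.
Qed.

Lemma independent_off_cst (d : measure_display) (S : measurableType d)
  (s : S) (L : {pred I}) : independent_off (fun=> s) L.
Proof.
split => // C J B mC mB _.
rewrite preimage_cst; case: ifPn => _.
  by rewrite setTI probability_setT mul1e indepX.
by rewrite set0I measure0 mul0e.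
Qed.

Lemma independent_off_pair (d : measure_display) (S : measurableType d)
    (Z : O -> S) (L : {pred I}) (i : I) (C : set S) (J : {fset I})
    (B : I -> set T) (D : set T) :
  independent_off Z L -> i \notin L -> i \notin J -> measurable C ->
  measurable D -> (forall i, measurable (B i)) ->
  (forall i, i \in J -> i \notin L) ->
  P (Z @^-1` C `&` X i @^-1` D `&` \bigcap_(i in [set` J]) (X i @^-1` B i)) =
  P (Z @^-1` C) * P (X i @^-1` D) * \prod_(i <- J) P (X i @^-1` B i).
Proof.
move=> [mZ indZ] iL iJ mC mD mB JL.
(* The event on [X i] becomes one more member of the family [B], so that the hypothesis on [Z]
   applies to the enlarged index set. *)
pose B' j := if j == i then D else B j.
have B'J : \bigcap_(j in [set` J]) (X j @^-1` B' j) =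
           \bigcap_(j in [set` J]) (X j @^-1` B j).
  apply: eq_bigcapr => j /= jJ; rewrite /B'; case: eqP => // ji.
  by rewrite -ji jJ in iJ.
have := indZ C (i |` J)%fset B' mC.
have -> : [set` (i |` J)%fset] = [set i] `|` [set` J].
  apply/seteqP; split => j /=; rewrite !inE.
    by case/orP => [/eqP|]; [left|right].
  by case=> [->|jJ]; rewrite ?eqxx// jJ orbT.
rewrite bigcap_setU bigcap_set1 B'J /B' eqxx setIA => ->.
- rewrite big_fsetU1//= eqxx muleA; congr (_ * _).
  rewrite big_seq [RHS]big_seq; apply: eq_bigr => j jJ.
  by case: eqP => // ji; rewrite -ji jJ in iJ.
- by move=> j; case: ifP.
- by move=> j; rewrite !inE => /orP[/eqP->//|]; exact: JL.
Qed.

Lemma independent_off2 (d : measure_display) (S : measurableType d)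
    (Z : O -> S) (L : {pred I}) (i : I) (C : set S) (D : set T) :
  independent_off Z L -> i \notin L -> measurable C -> measurable D ->
  P (Z @^-1` C `&` X i @^-1` D) = P (Z @^-1` C) * P (X i @^-1` D).
Proof.
move=> indZ iL mC mD.
have := @independent_off_pair _ _ _ _ _ _ fset0 (fun=> setT) _ indZ iL
  (negbT (in_fset0 i)) mC mD (fun=> measurableT).
rewrite big_seq_fset0 mule1 (_ : [set` fset0] = set0) ?bigcap_set0 ?setIT.
  by apply.
by apply/seteqP; split.
Qed.

(** Let [E] be an event about indices other than [i] and outside [L]. Under [nu], the restriction of
    [P] to [E], the variables [Z] and [X i] still factor, with [X i] keeping its law under [P].
    Computing the law of [phi] by Tonelli under [nu] and under [P] gives integrands that differ by
    the constant [P E]. *)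
Lemma independent_off_step (d d' : measure_display) (S : measurableType d)
    (S' : measurableType d') (Z : O -> S) (L : {pred I}) (i : I)
    (phi : S * T -> S') :
  independent_off Z L -> i \notin L -> measurable_fun setT phi ->
  independent_off (fun w => phi (Z w, X i w)) [predU1 i & L].
Proof.
move=> indZ iL mphi; have [mZ _] := indZ.
have mZX : measurable_fun setT (fun w => (Z w, X i w)).
  exact/measurable_fun_pair.
split=> [|C J B mC mB JL]; first exact: measurableT_comp.
have iJ : i \notin J by apply/negP => /JL; rewrite inE eqxx.
have JL' j : j \in J -> j \notin L.
  by move/JL; rewrite !inE negb_or => /andP[].
pose A := phi @^-1` C.
have mA : measurable A by rewrite -[A]setTI; exact: mphi.
have mE := measurable_fset_bigcap J mB.
set E := bigcap _ _ in mE *.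
pose nu : {finite_measure set O -> \bar R} := mrestr P mE.
have PE : P E = \prod_(j <- J) P (X j @^-1` B j) by rewrite indepX.
have key (mu : {finite_measure set O -> \bar R}) :
  (forall C D, measurable C -> measurable D ->
    mu (Z @^-1` C `&` X i @^-1` D) = mu (Z @^-1` C) * P (X i @^-1` D)) ->
  mu ((fun w => phi (Z w, X i w)) @^-1` C) =
  \int[P]_w' mu (Z @^-1` (ysection A (X i w'))).
  move=> muE.
  have m1A : measurable_fun setT (fun z => (\1_A z)%:E : \bar R).
    exact/measurable_EFinP/measurable_indic.
  have -> : mu ((fun w => phi (Z w, X i w)) @^-1` C) =
      \int[mu]_w (\1_A (Z w, X i w))%:E.
    rewrite -[in LHS](setIT (_ @^-1` C)) -integral_indic//.
    by rewrite -[_ @^-1` _]setTI; exact: (measurableT_comp mphi mZX).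
  rewrite (@ge0_integral_indep_pair _ _ _ _ _ _ _ _ _ _ _
    (fun z => (\1_A z)%:E) _ _ muE)//.
  rewrite (fubini_tonelli (fun z => (\1_A (Z z.1, X i z.2))%:E))//; last first.
    apply: (measurableT_comp m1A); apply/measurable_fun_pair => //=.
    - exact: measurableT_comp.
    - exact: measurableT_comp.
  apply: eq_integral => w' _ /=.
  rewrite -[in RHS](setIT (_ @^-1` ysection _ _)) -integral_indic//.
    by apply: eq_integral => w _; rewrite !indicE -mem_ysection.
  by rewrite -[_ @^-1` _]setTI; apply: mZ => //; exact: measurable_ysection.
transitivity (nu ((fun w => phi (Z w, X i w)) @^-1` C)); first by [].
have nuZ C' : measurable C' -> nu (Z @^-1` C') = P E * P (Z @^-1` C').
  move=> mC'; rewrite PE muleC; have [_] := indZ; exact.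
rewrite !key//; last 2 first.
- by move=> C' D mC' mD; exact: (independent_off2 indZ iL).
- move=> C' D mC' mD; rewrite nuZ// PE /nu /= /mrestr /E (independent_off_pair indZ iL iJ)//.
  by rewrite muleC muleA.
under eq_integral.
  move=> w' _; rewrite nuZ; last exact: measurable_ysection.
  over.
rewrite ge0_integralZl//.
- by rewrite PE muleC.
- pose Zp : {mfun O >-> S} := HB.pack Z (isMeasurableFun.Build _ _ _ _ Z mZ).
  have := measurable_fun_ysection (finite_image P Zp) mA.
  by move/measurableT_comp; apply.
Qed.

Lemma integral_independent_off (d : measure_display) (S : measurableType d)
    (Z : O -> S) (L : {pred I}) (i : I) (F : S * T -> \bar R) :
  independent_off Z L -> i \notin L ->
  measurable_fun setT F -> (forall z, 0 <= F z) ->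
  \int[P]_w F (Z w, X i w) = \int[P]_w \int[P]_w' F (Z w, X i w').
Proof.
move=> indZ iL mF F0.
have [mZ _] := indZ.
apply: ge0_integral_indep_pair => // C D mC mD.
exact: (independent_off2 indZ iL).
Qed.

Lemma independent_off_prod (h : I -> T -> R) (s : seq I) :
  (forall i, measurable_fun setT (h i)) -> (forall i t, (0 <= h i t)%R) ->
  uniq s ->
  independent_off (fun w => \prod_(i <- s) h i (X i w))%R [in s] /\
  (\int[P]_w (\prod_(i <- s) h i (X i w))%:E =
   \prod_(i <- s) \int[P]_w (h i (X i w))%:E)%E.
Proof.
move=> mh h0; elim: s => [|i s IH] /=.
  split; first by under eq_fun do rewrite big_nil; exact: independent_off_cst.
  under eq_integral do rewrite big_nil.
  rewrite big_nil integral_cst// mul1e.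
  exact: probability_setT.
case/andP=> iS uS; have {IH} [indZ IH] := IH uS.
have mphi : measurable_fun setT (fun z : R * T => z.1 * h i z.2)%R.
  apply: measurable_funM; first exact: measurable_fst.
  by apply: measurableT_comp.
have EqZ : (fun w => \prod_(j <- i :: s) h j (X j w))%R =
    (fun w => (\prod_(j <- s) h j (X j w)) * h i (X i w))%R.
  by apply/funext => w; rewrite big_cons mulrC.
split.
  rewrite EqZ (_ : [in i :: s] = [predU1 i & [in s]])//.
  exact: (independent_off_step indZ iS mphi).
have g0 w : (0 <= \prod_(j <- s) h j (X j w))%R by apply: prodr_ge0.
(* [F] has to be nonnegative on all of [R * T]; the absolute value changes nothing at the
   products. *)
pose F (z : R * T) : \bar R := (`|z.1| * h i z.2)%:E.
transitivity (\int[P]_w F ((\prod_(j <- s) h j (X j w))%R, X i w)).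
  by apply: eq_integral => w _; rewrite (congr1 (@^~ w) EqZ) /F /= ger0_norm.
rewrite (integral_independent_off indZ iS); last 2 first.
- apply/measurable_EFinP/measurable_funM.
    by apply: measurableT_comp => //; exact: measurable_fst.
  by apply: measurableT_comp.
- by move=> z; rewrite lee_fin mulr_ge0.
rewrite big_cons -IH muleC -ge0_integralZr//.
- apply: eq_integral => w _; rewrite -ge0_integralZl//.
  + by apply: eq_integral => w' _; rewrite /F /= ger0_norm// EFinM.
  + by apply/measurable_EFinP; apply: measurableT_comp.
  + by move=> w' _; rewrite lee_fin.
  + by rewrite lee_fin.
- by apply/measurable_EFinP; case: indZ.
- by move=> w _; rewrite lee_fin.
- by apply: integral_ge0 => w _; rewrite lee_fin.
Qed.

End independent_of.

Section exponential_markov.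
Context (R : realType) (dO : measure_display) (O : measurableType dO)
  (P : probability O R).
Local Open Scope ereal_scope.

Lemma integral_prob_cst (c : \bar R) : \int[P]_w c = c.
Proof.
rewrite integral_cst//; transitivity (c * 1); last exact: mule1.
by congr (_ * _); exact: probability_setT.
Qed.

Lemma measurable_superlevel (Y : O -> R) (t : R) : measurable_fun setT Y ->
  measurable [set w | (t <= Y w)%R].
Proof.
move=> mY; have -> : [set w | (t <= Y w)%R] = setT `&` Y @^-1` `[t, +oo[.
  by rewrite setTI; apply/seteqP; split => w /=; rewrite in_itv/= andbT.
exact: mY.
Qed.

Lemma exp_markov (Y : O -> R) (c t : R) : measurable_fun setT Y -> (0 <= c)%R ->
  P [set w | (t <= Y w)%R] <=
    (expR (- (c * t)))%:E * \int[P]_w (expR (c * Y w))%:E.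
Proof.
move=> mY c0; have mE := measurable_superlevel t mY.
have mexp : measurable_fun setT (fun w => (expR (c * Y w))%:E).
  by apply/measurable_EFinP; apply: measurableT_comp => //; exact: measurable_funM.
set E := [set w | _] in mE *.
rewrite -[E]setIT -integral_indic// -ge0_integralZl ?lee_fin ?expR_ge0//.
apply: ge0_le_integral => //.
- exact/measurable_EFinP/measurable_indic.
- by apply: emeasurable_funM => //; exact: measurable_cst.
- move=> w _; rewrite indicE -EFinM lee_fin -expRD.
  case: (boolP (w \in E)) => [/set_mem Ew|_]; last exact: expR_ge0.
  rewrite -[leLHS]expR0 ler_expR addrC -mulrBr mulr_ge0 ?subr_ge0//.
Qed.

End exponential_markov.

(** * The transition operator of the walk *)

Section lattice_measurability.
Context (d : nat).

Lemma measurable_fun_zlattice (d' : measure_display) (S : measurableType d')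
  (g : zlattice d -> S) : measurable_fun setT g.
Proof. by []. Qed.

Lemma measurable_bigcup_countable (T : countType) (d' : measure_display)
    (S : measurableType d') (F : T -> set S) :
  (forall t, measurable (F t)) -> measurable (\bigcup_t F t).
Proof.
move=> mF.
have -> : \bigcup_t F t = \bigcup_n oapp F set0 (choice.unpickle n : option T).
  apply/seteqP; split => s [t _ /= Ft].
    by exists (choice.pickle t) => //=; rewrite choice.pickleK.
  by move: Ft; case: choice.unpickle => //= t' Ft'; exists t'.
by apply: bigcupT_measurable => n; case: choice.unpickle => //=.
Qed.

(** The second factor is countable and discrete, so a preimage is a countable union of slices. *)
Lemma measurable_fun_prod_zlattice (d1 d2 : measure_display)
    (S : measurableType d1) (S' : measurableType d2)
    (F : S * zlattice d -> S') :
  (forall z, measurable_fun setT (fun s => F (s, z))) -> measurable_fun setT F.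
Proof.
move=> mF _ B mB; rewrite setTI.
have -> : F @^-1` B =
    \bigcup_(z : 'rV[int]_d) ((fun s => F (s, z)) @^-1` B `*` [set (z : zlattice d)]).
  apply/seteqP; split => [[s z] /= Fsz|[s z] [z' _ [/= Fsz ->]]]//.
  by exists z.
apply: measurable_bigcup_countable => z; apply: measurableX => //.
by rewrite -[_ @^-1` _]setTI; exact: mF.
Qed.

End lattice_measurability.

Section walk_operator.
Context (R : realType) (d : nat) (dW : measure_display) (W : measurableType dW)
  (P0 : probability W R) (xi : nat -> {RV P0 >-> zlattice d}).
Hypothesis iid_xi : iid xi.
Local Open Scope ereal_scope.

Definition walk_op (g : zlattice d -> \bar R) (x : zlattice d) : \bar R :=
  \int[P0]_w g (x + xi 0%N w)%R.

Lemma measurable_step (d' : measure_display) (S : measurableType d')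
  (g : zlattice d -> S) k : measurable_fun setT (fun w => g (xi k w)).
Proof. by apply: measurableT_comp => //. Qed.

Lemma walk_op_ge0 g : (forall x, 0 <= g x) -> forall x, 0 <= walk_op g x.
Proof. by move=> g0 x; apply: integral_ge0 => w _. Qed.

Lemma integral_step k (g : zlattice d -> \bar R) : (forall x, 0 <= g x) ->
  \int[P0]_w g (xi k w) = \int[P0]_w g (xi 0%N w).
Proof.
move=> g0; rewrite -!(ge0_integral_distribution _ (f := g))//.
by apply: eq_measure_integral => A mA _; case: iid_xi => _; apply.
Qed.

Lemma walkS k w : walk xi k.+1 w = (walk xi k w + xi k w)%R.
Proof. by rewrite /walk big_ord_recr. Qed.

(** The position is carried next to the product because the next factor is evaluated there; the pair
    is a function of the first k increments and is updated by [phi]. *)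
Lemma feynman_kac_independent (e : zlattice d -> R) x k :
  independent_off xi
    (fun w => (\prod_(j < k) e (x + walk xi j w), x + walk xi k w)%R)
    [pred i | (i < k)%N].
Proof.
elim: k => [|k IH].
  rewrite (_ : (fun w => (\prod_(j < 0) e (x + walk xi j w), x + walk xi 0 w)%R)
    = fun=> (1%R, x)); first exact: (independent_off_cst iid_xi.1).
  by apply/funext => w; rewrite big_ord0 /walk big_ord0 addr0.
pose phi (u : (R * zlattice d) * zlattice d) : R * zlattice d :=
  (u.1.1 * e u.1.2, u.1.2 + u.2)%R.
have mphi : measurable_fun setT phi.
  apply: measurable_fun_prod_zlattice => z.
  apply: measurable_fun_prod_zlattice => y.
  apply/measurable_fun_pair => //=.
  exact: measurable_funM.
have := independent_off_step iid_xi.1 IH (i := k) _ mphi.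
rewrite inE ltnn => /(_ isT).
rewrite (_ : (fun w => phi _) = fun w => (\prod_(j < k.+1) e (x + walk xi j w), x + walk xi k.+1 w)%R); last first.
  by apply/funext => w; rewrite /phi /= big_ord_recr walkS addrA.
case=> mZ ind; split => // C J B mC mB JL; apply: ind => // i /JL.
by rewrite !inE ltnS leq_eqVlt.
Qed.

Lemma measurable_walk k : measurable_fun setT (walk xi k).
Proof.
have [mZ _] := feynman_kac_independent (fun=> 1%R) 0%R k.
have := measurableT_comp measurable_snd mZ.
by rewrite (_ : _ \o _ = walk xi k)//; apply/funext => w /=; rewrite add0r.
Qed.

Lemma feynman_kac (e : zlattice d -> R) (g : zlattice d -> \bar R) k x :
  (forall x, 0 <= e x)%R -> (forall x, 0 <= g x) ->
  \int[P0]_w ((\prod_(j < k) e (x + walk xi j w))%:E * g (x + walk xi k w)%R) =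
  iter k (fun h y => (e y)%:E * walk_op h y) g x.
Proof.
move=> e0; elim: k g => [|k IH] g g0.
  under eq_integral => w _ do rewrite big_ord0 mul1e /walk big_ord0 addr0.
  by rewrite integral_cst//= probability_setT mule1.
(* The last increment is integrated out first: this replaces [g] by [e] times [walk_op g] and leaves
   k factors. *)
rewrite iterSr -IH; last by move=> y; rewrite mule_ge0 ?lee_fin// walk_op_ge0.
pose F (u : (R * zlattice d) * zlattice d) : \bar R :=
  (`|u.1.1| * e u.1.2)%:E * g (u.1.2 + u.2)%R.
have mF : measurable_fun setT F.
  apply: measurable_fun_prod_zlattice => z.
  apply: measurable_fun_prod_zlattice => y.
  apply: emeasurable_funM => /=; last exact: measurable_cst.
  by apply/measurable_EFinP/measurable_funM; [exact: normr_measurable|].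
have F0 u : 0 <= F u by rewrite mule_ge0// lee_fin mulr_ge0.
have p0 j w : (0 <= \prod_(i < j) e (x + walk xi i w))%R by apply: prodr_ge0.
have := integral_independent_off (feynman_kac_independent e x k) (i := k) _ mF F0.
rewrite inE ltnn => /(_ isT).
rewrite /F /= => E; transitivity (\int[P0]_w
  ((`|\prod_(j < k) e (x + walk xi j w)| * e (x + walk xi k w))%:E *
  g (x + walk xi k w + xi k w)%R)).
  by apply: eq_integral => w _; rewrite big_ord_recr walkS addrA (ger0_norm (p0 _ _)).
rewrite E; apply: eq_integral => w _.
rewrite (ger0_norm (p0 _ _)).
have mg : measurable_fun setT (fun w' => g (x + walk xi k w + xi k w')%R).
  exact: (measurable_step (fun z => g (x + walk xi k w + z)%R)).
rewrite ge0_integralZl//; last by rewrite lee_fin; exact: (mulr_ge0 (p0 _ _) (e0 _)).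
rewrite EFinM -muleA /walk_op.
by rewrite (integral_step k (g := fun z => g (x + walk xi k w + z)%R)).
Qed.

End walk_operator.

(** * Heat kernel bound by coin splitting *)

Section numeric_bounds.

(** By symmetry m >= l. If m > l, lowering m by one changes the ratio of the two sides by k (k + 1)
    / (4 m^2) <= 1, where k = m + l. At m = l this factor slightly exceeds 1, so both arguments are
    lowered together there. *)
Lemma bin_sqr_le m l : ('C(m + l, m) ^ 2 * (m + l).+1 <= 4 ^ (m + l))%N.
Proof.
have [n le_n] := ubnP (m + l)%N; elim: n => // n IH in m l le_n *.
have lt_case m' l' : (l' < m')%N -> (m' + l' < n.+1)%N ->
    ('C(m' + l', m') ^ 2 * (m' + l').+1 <= 4 ^ (m' + l'))%N.
  case: m' => // m'; rewrite ltnS => lm' le_n'.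
  have {IH} IH := IH m' l' ltac:(by rewrite -ltnS -addSn).
  have E := mul_bin_diag (m' + l').+1 m'.
  rewrite addSn (expnS 4) -(@leq_pmul2l (m'.+1 ^ 2)) ?expn_gt0//.
  rewrite mulnA -expnMn -E/= expnMn.
  set c := 'C(_, _) in IH *; set f := (4 ^ _)%N in IH *.
  set k := (m' + l').+1 in IH *.
  have hk : (k * k.+1 <= 4 * m'.+1 ^ 2)%N.
    apply: (@leq_trans ((2 * m').+1 * (2 * m').+2)); first by rewrite leq_mul// /k; lia.
    lia.
  have h1 : (c ^ 2 * k * (k * k.+1) <= f * (k * k.+1))%N by rewrite leq_mul2r IH orbT.
  have h2 : (f * (k * k.+1) <= f * (4 * m'.+1 ^ 2))%N by rewrite leq_mul2l hk orbT.
  apply: leq_trans (leq_trans h1 (leq_trans h2 _)).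
    by rewrite -!mulnn; set k1 := k.+1; apply: eq_leq; ring.
  set k1 := (m'.+1 ^ 2)%N; apply: eq_leq; ring.
have [lm|ml|ml] := ltngtP l m; first exact: lt_case.
  have -> : 'C(m + l, m) = 'C(l + m, l).
    by rewrite -[LHS]bin_sub ?leq_addr// addKn addnC.
  by rewrite (addnC m l) in le_n *; exact: lt_case.
subst l; case: m => // m in le_n *.
have E1 := mul_bin_diag (m + m).+2 m.
have E2 := mul_bin_diag (m + m).+1 m.
have E3 : 'C((m + m).+1, m) = 'C((m + m).+1, m.+1).
  rewrite -[LHS]bin_sub; last by lia.
  by congr 'C(_, _); lia.
rewrite /= in E1 E2.
have IHm := IH m m ltac:(lia).
rewrite addSn addnS 2!(expnS 4).
set f := (4 ^ _)%N in IHm *.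
set c := 'C((m + m).+2, m.+1) in E1 *.
set b := 'C(m + m, m) in E2 IHm.
have E4 : (m.+1 * c = 2 * (m + m).+1 * b)%N by move: E1; rewrite E3; nia.
rewrite -(@leq_pmul2l (m.+1 ^ 2)) ?expn_gt0// mulnA -expnMn E4.
have : (b ^ 2 * (m + m).+1 * (4 * (m + m).+1 * (m + m).+3) <=
  f * (4 * (m + m).+1 * (m + m).+3))%N by rewrite leq_mul2r IHm orbT.
have : (f * (4 * (m + m).+1 * (m + m).+3) <= f * (m.+1 ^ 2 * 16))%N.
  by rewrite leq_mul2l; apply/orP; right; lia.
move=> h2 h1; apply: leq_trans (leq_trans h1 (leq_trans h2 _)).
  by rewrite -!mulnn; set k1 := (m + m).+1; set k2 := (m + m).+3; apply: eq_leq; ring.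
by apply: eq_leq; set k1 := (m.+1 ^ 2)%N; ring.
Qed.

(** With a, b, c the square roots at x, x + 1, x + e/4, clearing denominators leaves (c - a) b <= e
    (b - a) c. The left side is at most 3e/16 and the right side at least 2e/5; the increment e/4 is
    small enough for this. *)
Lemma sqrt_inv_mean (R : realType) (e x : R) : 0 < e -> e <= 1 -> 1 <= x ->
  e * (Num.sqrt (x + 1))^-1 + (1 - e) * (Num.sqrt x)^-1
   <= (Num.sqrt (x + e / 4))^-1.
Proof.
move=> e0 e1 x1.
have [a0 b0 c0] : [/\ 0 < Num.sqrt x, 0 < Num.sqrt (x + 1) & 0 < Num.sqrt (x + e / 4)].
  by split; rewrite sqrtr_gt0; lra.
have aa : Num.sqrt x ^+ 2 = x by rewrite sqr_sqrtr//; lra.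
have bb : Num.sqrt (x + 1) ^+ 2 = x + 1 by rewrite sqr_sqrtr//; lra.
have cc : Num.sqrt (x + e / 4) ^+ 2 = x + e / 4 by rewrite sqr_sqrtr//; lra.
set a := Num.sqrt x in a0 aa *; set b := Num.sqrt (x + 1) in b0 bb *.
set c := Num.sqrt (x + e / 4) in c0 cc *.
have ba : b <= a * (3 / 2) by rewrite -ler_sqr ?nnegrE; nra.
have ca : a <= c by rewrite -ler_sqr ?nnegrE; nra.
have h1 : (c - a) * b <= 3 / 16 * e by nra.
have ab : a <= b by rewrite -ler_sqr ?nnegrE; nra.
have h2 : 2 / 5 <= (b - a) * a.
  have : 0 <= (b - a) * (a * (3 / 2) - b) by rewrite mulr_ge0// subr_ge0.
  nra.
have h3 : (c - a) * b <= e * (b - a) * c.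
  have : 0 <= e * (b - a) * (c - a) by rewrite !mulr_ge0// ?subr_ge0// ltW.
  nra.
have -> : e * b^-1 + (1 - e) * a^-1 =
    c^-1 + ((c - a) * b - e * (b - a) * c) * (a * b * c)^-1.
  by field; rewrite !gt_eqF.
rewrite gerDl mulr_le0_ge0 ?subr_le0// invr_ge0.
by rewrite !mulr_ge0// ltW.
Qed.

(** Cauchy condensation: the 2^m terms with base from 2^m to 2^(m+1) - 1 contribute at most q^m,
    with q = 2^(1-p) < 1. *)
Lemma sum_riemannR_le (R : realType) (p : R) : 1 < p ->
  exists2 C : R, 0 < C & forall n, \sum_(k < n) (k.+1%:R `^ (- p)) <= C.
Proof.
move=> p1; pose q : R := 2 `^ (1 - p).
have q0 : 0 < q by rewrite powR_gt0.
have q1 : q < 1.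
  have p10 : 0 < p - 1 by rewrite subr_gt0.
  rewrite /q -opprB powRN invf_lt1 ?powR_gt0//.
  by rewrite -[X in X < _](congr1 (@^~ (p - 1)) (powR1 R)) gt0_ltr_powR// ?nnegrE ?ltr1n.
have S m : \sum_(0 <= k < 2 ^ m - 1) (k.+1%:R `^ (- p)) <= \sum_(i < m) q ^+ i.
  elim: m => [|m IH]; first by rewrite expn0 subnn big_geq// big_ord0.
  have le2 : (2 ^ m - 1 <= 2 ^ m.+1 - 1)%N by rewrite leq_sub2r// leq_exp2l.
  rewrite (@big_cat_nat _ _ _ (2 ^ m - 1))//= big_ord_recr/= lerD//.
  apply: (@le_trans _ _ (\sum_(2 ^ m - 1 <= i < 2 ^ m.+1 - 1) (2 ^ m)%:R `^ (- p))).
    apply: ler_sum_nat => i /andP[mi _].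
    rewrite !powRN lef_pV2 ?posrE ?powR_gt0 ?ltr0n ?expn_gt0//.
    apply: ge0_ler_powR; rewrite ?nnegrE ?ler0n//; first lra.
    by rewrite ler_nat; lia.
  rewrite sumr_const_nat (_ : (2 ^ m.+1 - 1 - (2 ^ m - 1) = 2 ^ m)%N); last first.
    by rewrite expnS; have := expn_gt0 2 m; lia.
  rewrite -[leLHS]mulr_natl (_ : _ * _ = (2 ^ m)%:R `^ (1 - p)); last first.
    rewrite powRD ?powRr1//; last by apply/implyP => _; rewrite pnatr_eq0 expn_eq0.
  by rewrite /q natrX -!powR_mulrn ?powR_ge0// -!powRrM mulrC.
exists (1 - q)^-1; first by rewrite invr_gt0 subr_gt0.
move=> n; rewrite -(big_mkord predT (fun k => k.+1%:R `^ (- p))).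
apply: (@le_trans _ _ (\sum_(0 <= k < 2 ^ n - 1) (k.+1%:R `^ (- p)))).
  have ln : (n <= 2 ^ n - 1)%N by have := ltn_expl n (isT : (1 < 2)%N); lia.
  rewrite (@big_cat_nat _ _ _ n _ (2 ^ n - 1))//= lerDl.
  by apply: sumr_ge0 => i _; exact: powR_ge0.
apply: le_trans (S n) _.
rewrite -[leRHS]mul1r ler_pdivlMr ?subr_gt0//.
have := subrX1 q n; have : 0 <= q ^+ n by rewrite exprn_ge0// ltW.
set s := \sum_(i < n) _; lra.
Qed.

End numeric_bounds.

(** * Averaging operators and repeated coins *)

Section averaging_operators.
Context (R : realType) (d : nat).
Local Open Scope ereal_scope.
Implicit Types (f g : zlattice d -> \bar R) (Q : (zlattice d -> \bar R) -> zlattice d -> \bar R).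

(** Models convolution with a positive measure, so that the walk operator, its iterates and the
    remainder after removing a coin are treated alike. [avg_shift] is what makes them commute with
    [coin_avg] and [line_sum]. *)
Record averaging Q : Prop := Averaging {
  avg_ge0 : forall g, (forall x, 0 <= g x) -> forall x, 0 <= Q g x ;
  avg_le : forall f g, (forall x, 0 <= f x) -> (forall x, f x <= g x) ->
    forall x, Q f x <= Q g x ;
  avgD : forall f g, (forall x, 0 <= f x) -> (forall x, 0 <= g x) ->
    forall x, Q (fun y => f y + g y) x = Q f x + Q g x ;
  avgZ : forall (c : R) g, (0 <= c)%R -> (forall x, 0 <= g x) ->
    forall x, Q (fun y => c%:E * g y) x = c%:E * Q g x ;
  avg_shift : forall g v x, Q (fun y => g (y + v)%R) x = Q g (x + v)%R }.

Lemma averaging_iter Q k : averaging Q -> averaging (iter k Q).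
Proof.
move=> aQ; elim: k => [|k [h0 hle hD hZ hs]]; first by split.
split=> [g g0 x|f g f0 fg x|f g f0 g0 x|c g c0 g0 x|g v x] /=.
- by apply: avg_ge0 => // y; exact: h0.
- by apply: (avg_le aQ) => y; [exact: h0|exact: hle].
- rewrite -(avgD aQ); [|exact: h0..].
  by congr (Q _ x); apply/funext => y; exact: hD.
- rewrite -(avgZ aQ)//; last exact: h0.
  by congr (Q _ x); apply/funext => y; exact: hZ.
- rewrite -(avg_shift aQ); congr (Q _ x); apply/funext => y; exact: hs.
Qed.

Lemma avg_sum Q (I : Type) (r : seq I) (F : I -> zlattice d -> \bar R) :
  averaging Q -> (forall i x, 0 <= F i x) ->
  forall x, Q (fun y => \sum_(i <- r) F i y) x = \sum_(i <- r) Q (F i) x.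
Proof.
move=> aQ F0 x; elim: r => [|i r IH].
  rewrite big_nil (_ : (fun _ => _) = fun y => 0%:E * 0).
    by rewrite (avgZ aQ)// mul0e.
  by apply/funext => y; rewrite big_nil mul0e.
rewrite big_cons -IH -(avgD aQ)//; last first.
  by move=> y; apply: sume_ge0 => j _.
by congr (Q _ x); apply/funext => y; rewrite big_cons.
Qed.

(** Plays the role of an l^1 norm in direction [v]: averaging over coins with difference [v] is
    controlled by the mass of [g] on a segment. *)
Definition line_sum (K : nat) (v : zlattice d) g (x : zlattice d) : \bar R :=
  \sum_(m < K.+1) g (x + v *+ m)%R.

Lemma line_sum_ge0 K v g : (forall x, 0 <= g x) -> forall x, 0 <= line_sum K v g x.
Proof. by move=> g0 x; apply: sume_ge0. Qed.

Lemma avg_line_sum Q K v g : averaging Q -> (forall x, 0 <= g x) ->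
  forall x, Q (line_sum K v g) x = line_sum K v (Q g) x.
Proof.
move=> aQ g0 x; rewrite (avg_sum _ (F := fun (m : 'I_K.+1) y => g (y + v *+ m)%R))//.
by apply: eq_bigr => i _; rewrite (avg_shift aQ).
Qed.

Fixpoint coin_avg (a b : zlattice d) (j : nat) g (x : zlattice d) : \bar R :=
  if j is j'.+1 then (2^-1)%:E * (coin_avg a b j' g (x + a)%R + coin_avg a b j' g (x + b)%R)
  else g x.

Lemma coin_avg_ge0 a b j g : (forall x, 0 <= g x) -> forall x, 0 <= coin_avg a b j g x.
Proof.
move=> g0; elim: j => //= j IH x.
by apply: mule_ge0; [rewrite lee_fin invr_ge0|exact: adde_ge0].
Qed.

Lemma avg_coin_avg Q a b j g : averaging Q -> (forall x, 0 <= g x) ->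
  forall x, Q (coin_avg a b j g) x = coin_avg a b j (Q g) x.
Proof.
move=> aQ g0; elim: j => //= j IH x.
have B0 := coin_avg_ge0 a b j g0.
rewrite (avgZ aQ) ?invr_ge0//; last first.
  by move=> y; apply: adde_ge0; exact: B0.
by rewrite (avgD aQ); [rewrite !(avg_shift aQ) !IH|move=> y; exact: B0..].
Qed.

Lemma coin_avgE a b j g : (forall x, 0 <= g x) -> forall x,
  coin_avg a b j g x =
  \sum_(m < j.+1) ('C(j, m)%:R / 2 ^+ j)%:E * g (x + b *+ j + (a - b) *+ m)%R.
Proof.
move=> g0; elim: j => [|j IH] x /=.
  by rewrite big_ord1 bin0 expr0 divr1 mul1e !mulr0n !addr0.
rewrite !IH.
pose G m := g (x + b *+ j.+1 + (a - b) *+ m)%R.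
have G0 m : 0 <= G m by exact: g0.
have c0 (i l : nat) : (0 <= i%:R / 2 ^+ l :> R)%R by rewrite divr_ge0// exprn_ge0.
rewrite (eq_bigr (fun m : 'I_j.+1 => ('C(j, m)%:R / 2 ^+ j)%:E * G m.+1)); last first.
  move=> m _; congr (_ * g _).
  by rewrite [in RHS]mulrS [in RHS](mulrS _ m); apply/matrixP => r s; rewrite !mxE; ring.
rewrite [X in _ + X](eq_bigr (fun m : 'I_j.+1 => ('C(j, m)%:R / 2 ^+ j)%:E * G m)); last first.
  by move=> m _; congr (_ * g _); rewrite [in RHS]mulrS -!addrA.
have -> : \sum_(m < j.+1) ('C(j, m)%:R / 2 ^+ j)%:E * G m =
    ('C(j, 0)%:R / 2 ^+ j)%:E * G 0%N +
    \sum_(m < j.+1) ('C(j, m.+1)%:R / 2 ^+ j)%:E * G m.+1.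
  transitivity (\sum_(m < j.+2) ('C(j, m)%:R / 2 ^+ j)%:E * G m).
    by rewrite [RHS]big_ord_recr /= bin_small// !mul0r mul0e adde0.
  by rewrite big_ord_recl.
have S0 (f : nat -> \bar R) n : (forall i, 0 <= f i) -> 0 <= \sum_(m < n) f m.
  by move=> f0; apply: sume_ge0.
have T0 (i l m : nat) : 0 <= (i%:R / 2 ^+ l : R)%:E * G m by rewrite mule_ge0 ?lee_fin.
rewrite addeCA -big_split/= [RHS]big_ord_recl/= -/(G 0%N).
rewrite ge0_muleDr//; last first.
  by apply: sume_ge0 => i _; apply: adde_ge0.
congr (_ + _).
  by rewrite muleA -EFinM !bin0; congr (_%:E * _); rewrite exprS; field; rewrite expf_neq0.
rewrite ge0_sume_distrr; last by move=> i _; apply: adde_ge0.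
apply: eq_bigr => m _.
rewrite -ge0_muleDl ?lee_fin// muleA -EFinD -EFinM -/(G m.+1).
congr (_%:E * _); rewrite binS natrD exprS; field; rewrite expf_neq0//.
Qed.

Lemma avg_cst_le Q f (M : R) : averaging Q -> (forall x, Q (fun=> 1) x <= 1) ->
  (0 <= M)%R -> (forall x, 0 <= f x) -> (forall x, f x <= M%:E) ->
  forall k x, iter k Q f x <= M%:E.
Proof.
move=> aQ Q1 M0 f0 fM; elim=> //= k IH x.
apply: (@le_trans _ _ (Q (fun y => M%:E * 1) x)).
  apply: (avg_le aQ) => y; first exact: (avg_ge0 (averaging_iter k aQ)).
  by rewrite mule1.
rewrite (avgZ aQ)// -[leRHS]mule1; apply: lee_pmul => //.
exact: (avg_ge0 aQ).
Qed.

(* With probability eta a step is a fair choice between a and b. *)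
Definition coin_split (eta : R) (P : (zlattice d -> \bar R) -> zlattice d -> \bar R)
    (a b : zlattice d) : Prop :=
  exists2 Q, averaging Q & (forall x, Q (fun=> 1) x <= (1 - eta)%:E) /\
    (forall g, (forall x, 0 <= g x) -> forall x,
       P g x = eta%:E * coin_avg a b 1 g x + Q g x).

(* j counts the coins tossed so far. The induction carries them along unevaluated;
   in the end 'C(j, m) / 2^j <= (j + 1)^(-1/2) and the mass of g on a line
   bound their contribution, and sqrt_inv_mean propagates this through a step. *)
Lemma iter_coin_avg_le P (eta : R) a b K : averaging P -> (0 < eta <= 1)%R ->
  coin_split eta P a b ->
  forall k j g (M : R), (0 <= M)%R -> (forall x, 0 <= g x) ->
  (forall x, line_sum K (a - b)%R g x <= M%:E) -> (k + j <= K)%N ->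
  forall x, iter k P (coin_avg a b j g) x <=
    ((Num.sqrt (j.+1%:R + k%:R * (eta / 4)))^-1 * M)%:E.
Proof.
move=> aP /andP[eta0 eta1] [Q aQ [Q1 PE]]; elim=> [|k IH] j g M M0 g0 gM kjK x.
  rewrite /= mul0r addr0 coin_avgE//.
  apply: (@le_trans _ _ (\sum_(m < j.+1) ((Num.sqrt j.+1%:R)^-1)%:E * g (x + b *+ j + (a - b) *+ m)%R)).
    apply: lee_sum => m _; apply: lee_wpmul2r => //; rewrite lee_fin.
    have j0 : (0 < Num.sqrt j.+1%:R :> R)%R by rewrite sqrtr_gt0 ltr0n.
    rewrite ler_pdivrMr ?exprn_gt0// mulrC ler_pdivlMr// -ler_sqr; last 2 first.
    - by rewrite nnegrE mulr_ge0// ltW.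
    - by rewrite nnegrE exprn_ge0.
    rewrite exprMn sqr_sqrtr ?ler0n// -exprM mulnC exprM -!natrX -natrM ler_nat.
    have mj : (m <= j)%N by rewrite -ltnS.
    by have := bin_sqr_le m (j - m); rewrite subnKC.
  rewrite -ge0_sume_distrr; last by move=> i _; exact: g0.
  rewrite EFinM lee_wpmul2l ?lee_fin ?invr_ge0 ?sqrtr_ge0//.
  apply: le_trans (gM (x + b *+ j)%R); rewrite /line_sum.
  (* The bound on k + j caps the number of tosses, so the j + 1 points reached lie among the K + 1
     points of [line_sum]. *)
  have jK : (j.+1 <= K.+1)%N by rewrite ltnS -(add0n j).
  rewrite (big_ord_widen K.+1 (fun m => g (x + b *+ j + (a - b) *+ m)%R))//.
  by rewrite big_mkcond; apply: lee_sum => i _; case: ifP.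
rewrite iterSr.
have B0 i f : (forall x, 0 <= f x) -> forall x, 0 <= coin_avg a b i f x.
  exact: coin_avg_ge0.
have Qg0 := avg_ge0 aQ g0.
(* One step either tosses a coin, raising j, or applies [Q], which is moved past the coins onto [g]
   and shrinks its line sums by the factor 1 - [eta]. *)
rewrite (_ : P _ = fun y => eta%:E * coin_avg a b j.+1 g y + coin_avg a b j (Q g) y); last first.
  apply/funext => y; rewrite PE; last exact: (B0 j g g0).
  by rewrite (avg_coin_avg _ _ _ aQ g0).
have aPk := averaging_iter k aP.
rewrite (avgD aPk); last 2 first.
- by move=> y; apply: mule_ge0; [rewrite lee_fin ltW|exact: B0].
- exact: B0.
rewrite (avgZ aPk); [|exact: ltW|exact: B0].
apply: (@le_trans _ _ (eta%:E * ((Num.sqrt (j.+2%:R + k%:R * (eta / 4)))^-1 * M)%:E +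
    ((Num.sqrt (j.+1%:R + k%:R * (eta / 4)))^-1 * ((1 - eta) * M))%:E)%E).
  apply: leeD.
    by apply: lee_wpmul2l; [rewrite lee_fin ltW|apply: IH => //; rewrite addnS -addSn].
  apply: IH => //; [by rewrite mulr_ge0// subr_ge0| |by rewrite ltnW].
  move=> y; rewrite -avg_line_sum//.
  apply: (@le_trans _ _ (Q (fun=> M%:E * 1) y)).
    by apply: (avg_le aQ) => z; [exact: line_sum_ge0|rewrite mule1].
  by rewrite (avgZ aQ)// mulrC EFinM lee_wpmul2l.
rewrite -EFinM -EFinD lee_fin.
set t := (j.+1%:R + k%:R * (eta / 4))%R.
have -> : (j.+2%:R + k%:R * (eta / 4) = t + 1)%R by rewrite /t -natr1; ring.
have -> : (j.+1%:R + k.+1%:R * (eta / 4) = t + eta / 4)%R by rewrite /t -natr1; ring.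
rewrite mulrA mulrCA (mulrA _ _ M) -mulrDl ler_wpM2r//.
have t1 : (1 <= t)%R.
  by rewrite /t ler_wpDr// ?ler1n// mulr_ge0// divr_ge0// ltW.
exact: sqrt_inv_mean.
Qed.

(** Each block of K steps serves one pair: it gains a factor (1 + K eta / 4)^(-1/2) and trades the
    sum along that direction for a supremum. *)
Lemma iter_multi_line_le P (eta : R) K (vs : seq (zlattice d * zlattice d)) :
  averaging P -> (0 < eta <= 1)%R ->
  (forall p, p \in vs -> coin_split eta P p.1 p.2) ->
  forall g (M : R), (0 <= M)%R -> (forall x, 0 <= g x) ->
  (forall x, foldr (fun p h => line_sum K (p.1 - p.2)%R h) g vs x <= M%:E) ->
  forall x, iter (K * size vs) P g x <=
    ((Num.sqrt (1 + K%:R * (eta / 4)))^-1 ^+ size vs * M)%:E.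
Proof.
move=> aP eta01; elim: vs => [|p vs IH] Pvs g M M0 g0 gM x.
  by rewrite /= muln0 expr0 mul1r; exact: gM.
rewrite /= mulnS addnC iterD exprS.
set h := (Num.sqrt _)^-1%R.
have h0 : (0 <= h)%R by rewrite invr_ge0 sqrtr_ge0.
rewrite mulrAC (mulrC _ (_ ^+ _)%R).
have fold0 f ws : (forall x, 0 <= f x) -> forall x : zlattice d,
    0 <= foldr (fun p h => line_sum K (p.1 - p.2)%R h) f ws x.
  move=> f0; elim: ws => //= q ws IHws; exact: line_sum_ge0.
have aK := averaging_iter K aP.
apply: IH => [q qvs|||y]; first by apply: Pvs; rewrite inE qvs orbT.
- by rewrite mulr_ge0.
- exact: (avg_ge0 aK).
have -> : foldr (fun p h => line_sum K (p.1 - p.2)%R h) (iter K P g) vs =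
    iter K P (foldr (fun p h => line_sum K (p.1 - p.2)%R h) g vs).
  elim: vs {Pvs gM} => //= q ws ->.
  by apply/funext => z; rewrite -(avg_line_sum _ _ aK)//; exact: fold0.
have := @iter_coin_avg_le P eta p.1 p.2 K aP eta01 (Pvs _ (mem_head _ _)) K 0%N _ _ M0
  (fold0 g vs g0) gM _ y.
by rewrite addn0 /=; apply.
Qed.

(* The differences p.1 - p.2 are linearly independent, in a form that makes the
   sums over their multiples visit distinct points. *)
Fixpoint triangular (vs : seq (zlattice d * zlattice d)) : Prop :=
  if vs is p :: vs' then
    (exists2 l : 'rV[R]_d, dotz l (p.1 - p.2)%R <> 0%R &
       forall q, q \in vs' -> dotz l (q.1 - q.2)%R = 0%R) /\ triangular vs'
  else True.

Definition point_mass (y x : zlattice d) : \bar R := if x == y then 1 else 0.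

Lemma dotzD (l : 'rV[R]_d) (x y : zlattice d) :
  dotz l (x + y)%R = (dotz l x + dotz l y)%R.
Proof.
by rewrite /dotz -big_split; apply: eq_bigr => i _; rewrite mxE intrD mulrDr.
Qed.

Lemma dotzMn (l : 'rV[R]_d) (x : zlattice d) n : dotz l (x *+ n)%R = (dotz l x *+ n)%R.
Proof.
elim: n => [|n IH]; last by rewrite !mulrS dotzD IH.
by rewrite !mulr0n /dotz big1// => i _; rewrite mxE mulr0.
Qed.

Lemma multi_line_support K vs (l : 'rV[R]_d) y z :
  (forall q, q \in vs -> dotz l (q.1 - q.2)%R = 0%R) ->
  foldr (fun p h => line_sum K (p.1 - p.2)%R h) (point_mass y) vs z <> 0 ->
  dotz l z = dotz l y.
Proof.
elim: vs z => [|p vs IH] z lvs /=.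
  by rewrite /point_mass; case: eqP => [->|].
move=> sum0; have [m Fm] : exists m : 'I_K.+1,
    foldr (fun p h => line_sum K (p.1 - p.2)%R h) (point_mass y) vs
      (z + (p.1 - p.2) *+ m)%R <> 0.
  apply/not_existsP => all0; apply: sum0.
  by rewrite /line_sum big1// => m _; apply: contrapT; exact: all0.
have <- := IH _ _ Fm; last by move=> q qvs; apply: lvs; rewrite inE qvs orbT.
by rewrite dotzD dotzMn lvs ?mem_head// mul0rn addr0.
Qed.

(** A linear form that vanishes on the later differences but not on the first one separates the
    terms of the outer sum, so at most one of them is nonzero: the iterated sum visits [y] at most
    once. *)
Lemma multi_line_le1 K vs y z : triangular vs ->
  foldr (fun p h => line_sum K (p.1 - p.2)%R h) (point_mass y) vs z <= 1.
Proof.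
elim: vs z => [|p vs IH] z /=.
  by rewrite /point_mass; case: eqP.
case=> -[l lp lvs] tvs; rewrite /line_sum.
set F := foldr _ _ _ in IH *.
have [[m Fm]|all0] := pselect (exists m : 'I_K.+1, F (z + (p.1 - p.2) *+ m)%R <> 0).
  rewrite (bigD1 m)//= big1 ?adde0; first exact: IH.
  move=> i im; apply: contrapT => Fi.
  have := multi_line_support lvs Fm; rewrite -(multi_line_support lvs Fi).
  rewrite (dotzD l z) (dotzD l z) => /addrI.
  rewrite (dotzMn l _ i) (dotzMn l _ m) => /eqP.
  rewrite -subr_eq0 -2!(mulr_natr (dotz l _)) -mulrBr.
  rewrite mulf_eq0 subr_eq0 eqr_nat => /orP[/eqP//|/eqP/val_inj mi].
  by rewrite mi eqxx in im.
rewrite big1// => m _; apply: contrapT => Fm; apply: all0; by exists m.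
Qed.

Lemma iter_point_mass_le P (eta : R) (vs : seq (zlattice d * zlattice d)) :
  averaging P -> (forall x, P (fun=> 1) x <= 1) -> (0 < eta <= 1)%R ->
  (forall p, p \in vs -> coin_split eta P p.1 p.2) -> triangular vs ->
  (0 < size vs)%N ->
  forall k x y, iter k P (point_mass y) x <=
    ((eta / (4 * (size vs)%:R) * k.+1%:R) `^ (- ((size vs)%:R / 2)))%:E.
Proof.
move=> aP P1 eta01 Pvs tvs vs0 k x y.
have /andP[eta0 eta1] := eta01.
set r := size vs in vs0 *.
rewrite {1}(divn_eq k r) addnC iterD.
set K := (k %/ r)%N.
have p0 z : 0 <= point_mass y z by rewrite /point_mass; case: ifP.
(* The k mod r leftover steps do not increase the supremum. *)
apply: (@le_trans _ _ ((Num.sqrt (1 + K%:R * (eta / 4)))^-1 ^+ r * 1)%:E).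
  apply: avg_cst_le => //.
  - exact: (avg_ge0 (averaging_iter _ aP)).
  move=> z; apply: iter_multi_line_le => // {}z; exact: multi_line_le1.
rewrite mulr1 lee_fin.
have r0 : (0 < r%:R :> R)%R by rewrite ltr0n.
have B0 : (0 < eta / (4 * r%:R) * k.+1%:R :> R)%R.
  by rewrite mulr_gt0 ?ltr0n// divr_gt0// mulr_gt0.
(* k + 1 <= (K + 1) r turns blocks back into steps, and eta / 4 <= 1 absorbs the last block. *)
have BA : (eta / (4 * r%:R) * k.+1%:R <= 1 + K%:R * (eta / 4) :> R)%R.
  have kK : (k.+1%:R <= K.+1%:R * r%:R :> R)%R.
    by rewrite -natrM ler_nat; exact: ltn_ceil.
  apply: (@le_trans _ _ (eta / (4 * r%:R) * (K.+1%:R * r%:R)))%R.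
    by rewrite ler_wpM2l// ltW// divr_gt0// mulr_gt0.
  rewrite (_ : eta / (4 * r%:R) * (K.+1%:R * r%:R) = K.+1%:R * (eta / 4))%R.
    by rewrite -natr1 mulrDl mul1r addrC lerD2r; lra.
  by field; rewrite gt_eqF.
set A := (1 + _)%R in BA *.
have A0 : (0 < A)%R := lt_le_trans B0 BA.
have -> : ((Num.sqrt A)^-1 ^+ r = A `^ (- (r%:R / 2)))%R.
  rewrite powRN mulrC powRrM powR12_sqrt ?ltW// powR_mulrn ?sqrtr_ge0//.
  by rewrite exprVn.
rewrite !powRN lef_pV2 ?posrE ?powR_gt0//.
by apply: ge0_ler_powR; rewrite ?nnegrE ?divr_ge0// ltW.
Qed.

End averaging_operators.

(** * Splitting a coin off the walk *)

Section walk_kernel.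
Context (R : realType) (d : nat) (dW : measure_display) (W : measurableType dW)
  (P0 : probability W R) (xi : nat -> {RV P0 >-> zlattice d}).
Local Open Scope ereal_scope.

Local Notation mass a := (P0 (xi 0%N @^-1` [set a])).

(** The law of the increment thinned by the weight [q]: with [q] below 1 at two points, it describes
    what is left after a coin has been removed. *)
Definition step_op (q : zlattice d -> R) (g : zlattice d -> \bar R)
  (x : zlattice d) : \bar R := \int[P0]_w ((q (xi 0%N w))%:E * g (x + xi 0%N w)%R).

Lemma measurable_step_op (q : zlattice d -> R) (g : zlattice d -> \bar R) x :
  measurable_fun setT (fun w => (q (xi 0%N w))%:E * g (x + xi 0%N w)%R).
Proof. exact: (measurable_step _ (fun z => (q z)%:E * g (x + z)%R)). Qed.

Lemma averaging_step_op q : (forall z, 0 <= q z)%R -> averaging (step_op q).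
Proof.
move=> q0; split=> [g g0 x|f g f0 fg x|f g f0 g0 x|c g c0 g0 x|g v x].
- by apply: integral_ge0 => w _; rewrite mule_ge0 ?lee_fin.
- apply: ge0_le_integral => //; try exact: measurable_step_op.
  + by move=> w _; rewrite mule_ge0 ?lee_fin.
  + by move=> w _; apply: lee_wpmul2l; rewrite ?lee_fin.
- rewrite /step_op -ge0_integralD//; try exact: measurable_step_op.
  + by apply: eq_integral => w _; rewrite ge0_muleDr.
  + by move=> w _; rewrite mule_ge0 ?lee_fin.
  + by move=> w _; rewrite mule_ge0 ?lee_fin.
- rewrite /step_op -ge0_integralZl//; try exact: measurable_step_op.
  + by apply: eq_integral => w _; rewrite muleCA.
  + by move=> w _; rewrite mule_ge0 ?lee_fin.
- by apply: eq_integral => w _; rewrite addrAC.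
Qed.

Lemma walk_opE : walk_op xi = step_op (fun=> 1%R).
Proof.
apply/funext => g; apply/funext => x.
by apply: eq_integral => w _; rewrite mul1e.
Qed.

Lemma averaging_walk_op : averaging (walk_op xi).
Proof. by rewrite walk_opE; exact: averaging_step_op. Qed.

Lemma walk_op1 x : walk_op xi (fun=> 1) x = 1.
Proof. by rewrite /walk_op integral_cst// mul1e; exact: probability_setT. Qed.

Lemma coin_split_walk_op (e : R) (a b : zlattice d) : (0 < e)%R -> a != b ->
  e%:E <= mass a -> e%:E <= mass b -> coin_split (2 * e) (walk_op xi) a b.
Proof.
move=> e0 ab ea eb.
have mm z : measurable (xi 0%N @^-1` [set z]) by exact: measurable_funPTI.
have massE z : mass z = (fine (mass z))%:E by rewrite fineK// fin_num_measure.
have {}ea : (e <= fine (mass a))%R by rewrite -lee_fin -massE.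
have {}eb : (e <= fine (mass b))%R by rewrite -lee_fin -massE.
have r01 c : (e <= fine (mass c))%R -> (0 <= e / fine (mass c) <= 1)%R.
  move=> ec; have c0 := lt_le_trans e0 ec.
  by apply/andP; split; [apply: divr_ge0; exact: ltW|rewrite ler_pdivrMr// mul1r].
have /andP[ra0 ra1] := r01 a ea; have /andP[rb0 rb1] := r01 b eb.
(* Mass [e] is removed from each of [a] and [b]; the two removed parts, of total mass 2 e, form the
   fair coin. *)
pose q z : R := if z == a then (1 - e / fine (mass a))%R else
  if z == b then (1 - e / fine (mass b))%R else 1%R.
have q0 z : (0 <= q z)%R.
  rewrite /q; case: ifP => _; [|case: ifP => _ //];
  by rewrite subr_ge0 ler_pdivrMr ?mul1r// (lt_le_trans e0).
have PE g : (forall x, 0 <= g x) -> forall x,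
    walk_op xi g x = (2 * e)%:E * coin_avg a b 1 g x + step_op q g x.
  move=> g0 x.
  pose h (c : zlattice d) w := (e / fine (mass c))%:E * g (x + c)%R * (\1_(xi 0%N @^-1` [set c]) w)%:E.
  have h0 c w : (e <= fine (mass c))%R -> 0 <= h c w.
    move=> ec; rewrite /h mule_ge0 ?lee_fin//.
    by apply: mule_ge0 => //; rewrite lee_fin divr_ge0 ?(le_trans _ ec)// ltW.
  have mh c : measurable_fun setT (h c).
    apply: emeasurable_funM; first exact: measurable_cst.
    exact/measurable_EFinP/measurable_indic.
  have hE c : (e <= fine (mass c))%R -> \int[P0]_w h c w = e%:E * g (x + c)%R.
    move=> ec; rewrite ge0_integralZl//; last 2 first.
    - exact/measurable_EFinP/measurable_indic.
    - by apply: mule_ge0 => //; rewrite lee_fin divr_ge0 ?(le_trans _ ec)// ltW.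
    rewrite integral_indic// setIT; have Ec := massE c.
    set f := fine _ in Ec ec *.
    transitivity ((e / f)%:E * g (x + c)%R * f%:E); first by congr (_ * _); exact: Ec.
    rewrite muleAC -EFinM divfK//.
    by rewrite gt_eqF// (lt_le_trans e0).
  have -> : (2 * e)%:E * coin_avg a b 1 g x = \int[P0]_w h a w + \int[P0]_w h b w.
    rewrite /= !hE// muleA -EFinM mulrAC mulfV// mul1r ge0_muleDr//.
  rewrite -ge0_integralD//; [|by move=> w _; exact: h0..].
  rewrite /step_op -ge0_integralD//; last 4 first.
  - by move=> w _; rewrite adde_ge0// h0.
  - exact: emeasurable_funD.
  - by move=> w _; rewrite mule_ge0// lee_fin.
  - exact: measurable_step_op.
  apply: eq_integral => w _; rewrite /h !indicE /q.
  have inE c : (w \in xi 0%N @^-1` [set c]) = (xi 0%N w == c).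
    by apply/idP/eqP => [/set_mem|wc] //; apply/mem_set.
  rewrite !inE; case: eqVneq => [->|wa].
    rewrite (negbTE ab) mule1 mule0 adde0 -ge0_muleDl ?lee_fin ?subr_ge0//.
    by rewrite -EFinD addrCA subrr addr0 mul1e.
  case: eqVneq => [->|wb].
    rewrite mule1 mule0 add0e -ge0_muleDl ?lee_fin ?subr_ge0//.
    by rewrite -EFinD addrCA subrr addr0 mul1e.
  by rewrite !mule0 !add0e mul1e.
exists (step_op q); first exact: averaging_step_op.
split=> // x.
(* The mass of the remainder is read off the decomposition applied to the constant 1. *)
have := PE (fun=> 1) (fun=> lee01) x.
rewrite walk_op1 /= => E.
have : step_op q (fun=> 1) x = (1 - 2 * e)%:E.
  have s0 := avg_ge0 (averaging_step_op q0) (fun=> lee01) x.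
  move: E; case: (step_op q (fun=> 1) x) s0 => [r||] // _.
  move=> E; have [E'] : 1%:E = (2 * e * (2^-1 * (1 + 1)) + r)%:E := E.
  by congr _%:E; rewrite {1}E'; lra.
by move=> ->.
Qed.

End walk_kernel.

Lemma seq_positive_lower_bound (R : realType) (T : eqType) (F : T -> \bar R) (s : seq T) :
  (forall a, F a \is a fin_num) -> (forall a, a \in s -> (0 < F a)%E) ->
  exists2 mu : R, 0 < mu <= 1 & forall a, a \in s -> (mu%:E <= F a)%E.
Proof.
move=> finF; elim: s => [_|a s IH Fs]; first by exists 1 => //; rewrite ltr01 lexx.
have [mu /andP[mu0 mu1] muF] := IH (fun b bs => Fs b (mem_behead (s := a :: s) bs)).
have Fa0 : 0 < fine (F a) by rewrite fine_gt0// Fs ?mem_head// ltey_eq finF.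
exists (Num.min mu (fine (F a))); first by rewrite lt_min mu0 Fa0 ge_min mu1.
move=> b; rewrite inE => /orP[/eqP ->|/muF]; last first.
  by apply: le_trans; rewrite lee_fin ge_min lexx.
by rewrite -[leRHS](fineK (finF a)) lee_fin ge_min lexx orbT.
Qed.

(** * Support of the increments *)

Section support.
Context (R : realType) (d : nat) (dW : measure_display) (W : measurableType dW)
  (P0 : probability W R) (X : {RV P0 >-> zlattice d}).
Hypotheses (cX : centered X) (eX : exponential_moments X)
  (gX : genuinely_dimensional X).
Local Open Scope ereal_scope.

Let mX (d' : measure_display) (S : measurableType d') (g : zlattice d -> S) :
  measurable_fun setT (fun w => g (X w)).
Proof. by apply: measurableT_comp. Qed.

Definition coord_vec (s : R) (i : 'I_d) : 'rV[R]_d := (s *: delta_mx 0 i)%R.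

Lemma dotz_coord_vec s i (z : zlattice d) :
  dotz (coord_vec s i) z = (s * (z 0 i)%:~R)%R.
Proof.
rewrite /dotz (bigD1 i)//= big1 ?addr0; last first.
  by move=> j ji; rewrite !mxE eqxx (negbTE ji) mulr0 mul0r.
by rewrite !mxE !eqxx mulr1.
Qed.

Lemma exp_coord_integral_lty s i : \int[P0]_w (expR (s * (X w 0 i)%:~R))%:E < +oo.
Proof.
have := eX (coord_vec s i); rewrite unlock.
by under eq_integral do rewrite dotz_coord_vec.
Qed.

(** Domination by |t| <= e^t + e^(-t). Integrability is what lets the zero mean pass to linear
    combinations of coordinates. *)
Lemma coord_integrable i : P0.-integrable setT (fun w => ((X w 0 i)%:~R : R)%:E).
Proof.
have ie s : P0.-integrable setT (fun w => (expR (s * (X w 0 i)%:~R))%:E).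
  apply/integrableP; split.
    exact: (mX (fun z : zlattice d => (expR (s * (z 0%R i)%:~R))%:E : \bar R)).
  under eq_integral do rewrite gee0_abs ?lee_fin ?expR_ge0//.
  exact: exp_coord_integral_lty.
apply: le_integrable (integrableD _ (ie 1%R) (ie (-1)%R)) => //.
  exact: (mX (fun z : zlattice d => ((z 0%R i)%:~R)%:E : \bar R)).
move=> w _; rewrite -EFinD !abse_EFin lee_fin mul1r mulN1r.
set t : R := (X w 0 i)%:~R.
rewrite [leRHS]ger0_norm ?addr_ge0 ?expR_ge0//.
have h1 := expR_ge1Dx t; have h2 := expR_ge1Dx (- t).
have h3 := expR_ge0 t; have h4 := expR_ge0 (- t).
by rewrite ler_norml; apply/andP; split; lra.
Qed.

Lemma dotz_integral0 (l : 'rV[R]_d) :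
  P0.-integrable setT (fun w => (dotz l (X w))%:E) /\
  \int[P0]_w (dotz l (X w))%:E = 0.
Proof.
pose h (i : 'I_d) w : \bar R := (l 0%R i)%:E * ((X w 0 i)%:~R : R)%:E.
have hi i : P0.-integrable setT (h i) by apply: integrableZl => //; exact: coord_integrable.
have -> : (fun w => (dotz l (X w))%:E) = (fun w => \sum_(i < d) h i w).
  by apply/funext => w; rewrite /dotz -sumEFin.
split; first by apply: integrable_sum => // i _; exact: hi.
rewrite integral_sum// big1// => i _.
rewrite integralZl//; last exact: coord_integrable.
by have := cX i; rewrite unlock => ->; rewrite mule0.
Qed.

(** Otherwise [dotz l X] is nonnegative almost surely with mean 0, hence 0 almost surely, against
    [gX]. *)
Lemma support_neg (l : 'rV[R]_d) : l != 0%R ->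
  exists2 a : zlattice d, 0 < P0 (X @^-1` [set a]) & (dotz l a < 0)%R.
Proof.
move=> l0; apply: contrapT => noa.
have pos (a : zlattice d) : (dotz l a < 0)%R -> P0 (X @^-1` [set a]) = 0.
  move=> la; apply/eqP; rewrite eq_le measure_ge0 andbT leNgt; apply/negP => Pa.
  by apply: noa; exists a.
have [il i0] := dotz_integral0 l.
pose N := \bigcup_n oapp (fun z : 'rV[int]_d => if (dotz l z < 0)%R then X @^-1` [set (z : zlattice d)] else set0) set0 (choice.unpickle n).
have mf : measurable_fun setT (fun w => (dotz l (X w))%:E).
  exact: (mX (fun z => (dotz l z)%:E)).
have aeN : ae_eq P0 setT (fun w => `|(dotz l (X w))%:E|) (fun w => (dotz l (X w))%:E).
  apply: (@negligibleS _ _ _ _ N).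
    move=> w /= /not_implyP [_ lw].
    have lX : (dotz l (X w) < 0)%R.
      by rewrite ltNge; apply/negP => lX; apply: lw; rewrite ger0_norm.
    by exists (choice.pickle (X w : 'rV[int]_d)) => //; rewrite choice.pickleK /= lX.
  apply: negligible_bigcup => n; case: choice.unpickle => [z|] /=; last exact: negligible_set0.
  case: ifPn => [lz|_]; last exact: negligible_set0.
  apply/negligibleP; first exact: measurable_funPTI.
  exact: pos.
have abs0 : \int[P0]_w `|(dotz l (X w))%:E| = 0.
  by rewrite -[RHS]i0; apply: ae_eq_integral => //; exact: measurableT_comp.
have /(ae_eq_integral_abs _ measurableT mf) ae0 := abs0.
have := gX l0; rewrite (_ : P0 _ = 1) ?ltxx//.
have mE : measurable [set w | dotz l (X w) = 0%R].
  have -> : [set w | dotz l (X w) = 0%R] = X @^-1` [set z | dotz l z = 0%R] by [].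
  exact: measurable_funPTI.
have nE : P0 (~` [set w | dotz l (X w) = 0%R]) = 0.
  apply/negligibleP; first exact: measurableC.
  apply: negligibleS ae0 => w /= lw /(_ I) [].
  by move=> /eqP lX; apply: lw; apply/eqP.
have := probability_setC P0 (measurableC mE).
by rewrite setCK nE sube0.
Qed.

Lemma support_pair (l : 'rV[R]_d) : l != 0%R ->
  exists a b : zlattice d, [/\ 0 < P0 (X @^-1` [set a]), 0 < P0 (X @^-1` [set b])
    & dotz l (a - b)%R <> 0%R].
Proof.
move=> l0; have [a Pa la] := support_neg l0.
have [b Pb lb] : exists2 b : zlattice d, 0 < P0 (X @^-1` [set b]) & (dotz (- l) b < 0)%R.
  by apply: support_neg; rewrite oppr_eq0.
exists a, b; split => //.
have lb' : (0 < dotz l b)%R.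
  move: lb; rewrite /dotz (eq_bigr (fun i => - (l 0%R i * (b 0%R i)%:~R)))%R.
    by rewrite sumrN oppr_lt0.
  by move=> i _; rewrite mxE mulNr.
have := @dotzD _ _ l (a - b)%R b; rewrite subrK => E.
by move=> E0; move: la; rewrite E E0 add0r ltNge (ltW lb').
Qed.

Lemma orthogonal_vector (vs : seq (zlattice d)) : (size vs < d)%N ->
  exists2 l : 'rV[R]_d, l != 0%R & forall v, v \in vs -> dotz l v = 0%R.
Proof.
move=> sd; pose M : 'M[R]_(d, size vs) := \matrix_(i, j) ((nth 0%R vs j : zlattice d) 0%R i)%:~R.
have : kermx M != 0%R.
  rewrite kermx_eq0; apply/negP => /eqP rM.
  by have := rank_leq_col M; rewrite rM leqNgt sd.
case/rowV0Pn => l /sub_kermxP lM l0; exists l => // v /(nthP 0%R) [j js <-].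
have := congr1 (fun A : 'rV_(size vs) => A 0%R (Ordinal js)) lM.
rewrite !mxE => <-; apply: eq_bigr => i _; rewrite !mxE//.
Qed.

(** Greedy choice: while fewer than d differences have been found, some nonzero form is orthogonal
    to all of them, and the increments charge two points that it separates. *)
Lemma triangular_support k : (k <= d)%N ->
  exists2 vs : seq (zlattice d * zlattice d), size vs = k &
    triangular R vs /\ forall p, p \in vs ->
      0 < P0 (X @^-1` [set p.1]) /\ 0 < P0 (X @^-1` [set p.2]).
Proof.
elim: k => [_|k IH kd]; first by exists [::].
have [vs svs [tvs Pvs]] := IH (ltnW kd).
have [|l l0 lvs] := @orthogonal_vector [seq (p.1 - p.2)%R | p <- vs].
  by rewrite size_map svs.
have [a [b [Pa Pb lab]]] := support_pair l0.
exists ((a, b) :: vs); first by rewrite /= svs.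
split=> [|p].
  split=> //; exists l => // q qvs; apply: lvs; exact: (map_f (fun p => p.1 - p.2)%R).
by rewrite inE => /orP[/eqP -> //|]; exact: Pvs.
Qed.

End support.

(** * Zero-sum cycles of charged increments *)

Section zero_cycle.
Context (R : realType) (d : nat) (S : zlattice d -> Prop).
Hypothesis S_neg : forall l : 'rV[R]_d, l != 0 ->
  exists2 a : zlattice d, S a & dotz l a < 0.

Lemma dotzZ (c : R) (l : 'rV[R]_d) (a : zlattice d) : dotz (c *: l) a = c * dotz l a.
Proof. by rewrite /dotz mulr_sumr; apply: eq_bigr => i _; rewrite mxE mulrA. Qed.

Lemma continuous_dotz (a : zlattice d) :
  continuous (fun l : 'rV[R]_d => dotz l a).
Proof.
apply: continuous_big => [|i _ l]; first exact: add_continuous.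
have Fl : Filter (nbhs l) by exact: nbhs_filter.
by apply: cvgMr_tmp; exact: (@coord_continuous R 1 d 0 i l).
Qed.

(** Compactness of the unit sphere makes the strict inequality of [S_neg] uniform, with finitely
    many steps. *)
Lemma uniform_negative_step : exists A : seq (zlattice d), exists2 delta : R,
  0 < delta & (forall a, a \in A -> S a) /\
  forall l : 'rV[R]_d, l != 0 -> exists2 a, a \in A & dotz l a <= - delta * `|l|.
Proof.
pose K := [set l : 'rV[R]_d | `|l| = 1].
have K_compact : compact K.
  apply: bounded_closed_compact.
    by exists 1; split => // x x1 l /= ->; exact: ltW.
  rewrite (_ : K = (fun l : 'rV[R]_d => `|l|) @^-1` [set 1]); last by [].
  apply: closed_comp => [l _|]; first exact: norm_continuous.
  exact: closed_eq.
(* Each step comes with a level -1/(m+1), so that a finite subcover keeps all levels away from 0. *)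
pose U (p : zlattice d * nat) := [set l : 'rV[R]_d | dotz l p.1 < - (p.2.+1%:R)^-1].
have := K_compact; rewrite compact_cover.
move=> /(_ _ [set p | S p.1] U) [].
- move=> [a m] _; rewrite /U /=.
  rewrite (_ : [set _ | _] = (fun l : 'rV[R]_d => dotz l a) @^-1` [set x | x < - m.+1%:R^-1]); last by [].
  apply: open_comp => [l _|]; first exact: continuous_dotz.
  exact: open_lt.
- move=> l Kl; have l0 : l != 0.
    by apply/eqP => l0; move: Kl; rewrite /K /= l0 normr0 => /esym/eqP; rewrite oner_eq0.
  have [a Sa la] := S_neg l0.
  pose m := Num.truncn (- dotz l a)^-1.
  exists (a, m) => //; rewrite /U /= ltrNr -ltf_pV2 ?posrE ?invr_gt0 ?ltr0n ?oppr_gt0// invrK.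
  by rewrite truncnS_gt// invr_ge0 ltW// oppr_gt0.
move=> D DS KD.
pose M := (\max_(p <- enum_fset D) p.2)%N.
exists [seq p.1 | p <- enum_fset D], (M.+1%:R)^-1; first by rewrite invr_gt0 ltr0n.
split=> [a /mapP[p pD ->]|l l0].
  by have := DS p pD; rewrite inE.
have nl0 : 0 < `|l| by rewrite normr_gt0.
have [|p pD /= lp] := KD (`|l|^-1 *: l).
  by rewrite /K /= normrZ normfV normr_id mulVf// gt_eqF.
exists p.1; first exact: map_f.
move: lp; rewrite /U/= dotzZ => /ltW; rewrite -ler_pdivlMl ?invr_gt0// invrK => lp.
rewrite mulNr mulrC -mulrN; apply: le_trans lp _; rewrite ler_pM2l// lerN2.
rewrite lef_pV2 ?posrE ?ltr0n// ler_nat ltnS.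
exact: (@leq_bigmax_seq _ _ xpredT snd).
Qed.

Definition sqnorm (x : zlattice d) : R := \sum_(i < d) ((x 0 i)%:~R) ^+ 2.
Definition real_vec (x : zlattice d) : 'rV[R]_d := \row_i (x 0 i)%:~R.

Lemma sqnormD x a : sqnorm (x + a) = sqnorm x + 2 * dotz (real_vec x) a + sqnorm a.
Proof.
rewrite /sqnorm /dotz mulr_sumr -!big_split; apply: eq_bigr => i _ /=.
by rewrite !mxE intrD; ring.
Qed.

Lemma sqnorm_le x : sqnorm x <= d%:R * `|real_vec x| ^+ 2.
Proof.
have -> : d%:R * `|real_vec x| ^+ 2 = \sum_(i < d) `|real_vec x| ^+ 2.
  by rewrite sumr_const card_ord mulr_natl.
apply: ler_sum => i _; rewrite -real_normK ?num_real// ler_sqr ?nnegrE//.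
have -> : (x 0 i)%:~R = real_vec x 0 i by rewrite mxE.
rewrite [leRHS]/Num.norm /= mx_normrE; apply/bigmax_geP; right => /=.
by exists (0, i).
Qed.

(** Let M bound the squared norms of the steps. A step with inner product at most -delta |x| cannot
    increase the squared norm once |x| exceeds M / (2 delta); closer to 0 it adds at most M. *)
Lemma greedy_bounded : (0 < d)%N -> exists s : zlattice d -> zlattice d,
  exists2 B : R, (forall x, S (s x)) &
    forall k, sqnorm (iter k (fun x => x + s x) 0) <= B.
Proof.
move=> d0; have [A [delta delta0 [AS Aneg]]] := uniform_negative_step.
(* At the origin no direction is singled out, and any charged step serves. *)
have [a0 a0A] : exists a, a \in A.
  have [|a aA _] := Aneg (const_mx 1); last by exists a.
  apply/eqP => /matrixP /(_ 0 (Ordinal d0)); rewrite !mxE => /eqP.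
  by rewrite oner_eq0.
have ex x : exists a, a \in A /\
    dotz (real_vec x) a <= - delta * `|real_vec x|.
  have [->|x0] := eqVneq (real_vec x) 0.
    exists a0; split => //; rewrite normr0 mulr0 /dotz big1// => i _.
    by rewrite mxE mul0r.
  by have [a aA xa] := Aneg _ x0; exists a.
pose s x := sval (cid (ex x)).
have sP x : s x \in A /\ dotz (real_vec x) (s x) <= - delta * `|real_vec x|.
  exact: svalP (cid (ex x)).
pose M := \sum_(a <- A) sqnorm a.
have sq0 x : 0 <= sqnorm x by apply: sumr_ge0 => i _; exact: sqr_ge0.
have sM x : sqnorm (s x) <= M.
  rewrite /M (big_rem _ (sP x).1) /= lerDl; exact: sumr_ge0.
have M0 : 0 <= M by exact: sumr_ge0.
(* The factor d compares the Euclidean norm with the supremum norm of ['rV[R]_d]. *)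
pose B0 := d%:R * (M / (2 * delta)) ^+ 2.
exists s, (B0 + M) => [x|k]; first by apply: AS; exact: (sP x).1.
elim: k => [|k IH] /=.
  rewrite /sqnorm big1; last by move=> i _; rewrite mxE expr0n.
  by apply: addr_ge0 => //; apply: mulr_ge0 => //; exact: sqr_ge0.
set x := iter k _ 0 in IH *.
rewrite sqnormD.
have [_ xs] := sP x; have sMx := sM x.
have [small|large] := leP `|real_vec x| (M / (2 * delta)).
  have : sqnorm x <= B0.
    apply: le_trans (sqnorm_le x) _; rewrite ler_wpM2l// ler_sqr ?nnegrE//.
    by apply: divr_ge0 => //; apply: mulr_ge0 => //; exact: ltW.
  have : - delta * `|real_vec x| <= 0 by rewrite mulNr oppr_le0; apply: mulr_ge0 => //; exact: ltW.
  lra.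
have : M <= 2 * (delta * `|real_vec x|).
  by move: large => /ltW; rewrite ler_pdivrMr ?mulr_gt0// => h; rewrite mulrA mulrC.
lra.
Qed.

Lemma sqnorm_coord_le (x : zlattice d) i : `|(x 0 i)%:~R : R| ^+ 2 <= sqnorm x.
Proof.
rewrite real_normK ?num_real// /sqnorm (bigD1 i)//= lerDl.
by apply: sumr_ge0 => j _; exact: sqr_ge0.
Qed.

Lemma repeated_value (T : finType) (f : nat -> T) :
  exists i j, (i < j)%N /\ f i = f j.
Proof.
have : ~~ injectiveb (fun i : 'I_#|T|.+1 => f i).
  by apply/injectiveP => /leq_card; rewrite card_ord ltnn.
case/injectivePn => i [j ij fij].
have [lij|lji|/val_inj e] := ltngtP i j; last by rewrite e eqxx in ij.
- by exists i, j.
- by exists j, i.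
Qed.

Lemma zero_cycle : (0 < d)%N -> exists s : seq (zlattice d),
  [/\ (0 < size s)%N, forall a, a \in s -> S a & \sum_(a <- s) a = 0].
Proof.
move=> d0; have [s [B sS sB]] := greedy_bounded d0.
pose x k : zlattice d := iter k (fun x => x + s x) (0 : zlattice d).
(* N >= max(1, B) gives B <= N^2, hence a bound N on the coordinates. *)
pose N := (Num.truncn (Num.max 1 B)).+1.
have xN k i : (`|x k 0%R i| <= N)%N.
  have NB : B <= N%:R ^+ 2.
    have h : Num.max 1 B <= N%:R by apply/ltW/truncnS_gt; rewrite le_max ler01.
    have [h1 h2] : 1 <= N%:R :> R /\ B <= N%:R by move: h; rewrite ge_max => /andP.
    by nra.
  have := le_trans (le_trans (sqnorm_coord_le (x k) i) (sB k)) NB.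
  rewrite ler_sqr ?nnegrE// -intr_norm -[N%:R]/(N%:Z%:~R) ler_int -lez_nat.
  by rewrite abszE.
(* Shifting by N encodes the positions injectively in a finite type, for the pigeonhole
   principle. *)
pose f k : {ffun 'I_d -> 'I_(2 * N).+1} := [ffun i => inord (absz (x k 0 i + N%:Z))].
have [i [j [ij fij]]] := repeated_value f.
have xij : x i = x j.
  apply/rowP => c; have := congr1 (fun g : {ffun 'I_d -> _} => val (g c)) fij.
  rewrite /f !ffunE /= !inordK.
  - by have := xN i c; have := xN j c; lia.
  - by have := xN j c; lia.
  - by have := xN i c; lia.
exists [seq s (x k) | k <- index_iota i j]; split.
- by rewrite size_map size_iota subn_gt0.
- by move=> a /mapP[k _ ->].
- rewrite big_map (telescope_sumr_eq x _ (ltnW ij)) ?xij ?subrr//.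
  by move=> k _; rewrite /x /= addrC addKr.
Qed.

End zero_cycle.

(** * Green function and additive functionals *)

Section green_function.
Context (R : realType) (d : nat) (dW : measure_display) (W : measurableType dW)
  (P0 : probability W R) (xi : nat -> {RV P0 >-> zlattice d}).
Hypotheses (iid_xi : iid xi) (cX : centered (xi 0%N))
  (eX : exponential_moments (xi 0%N)) (gX : genuinely_dimensional (xi 0%N))
  (d0 : (0 < d)%N).
Local Open Scope ereal_scope.

Local Notation P := (walk_op xi).
Let aP : averaging P := averaging_walk_op xi.

Lemma iter_walk_op_le1 (f : zlattice d -> \bar R) : (forall x, 0 <= f x) ->
  (forall x, f x <= 1) -> forall k x, iter k P f x <= 1.
Proof.
by move=> f0 f1 k x; apply: avg_cst_le => // y; rewrite walk_op1.
Qed.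

(** A triangular family of d pairs, with one lower bound [mu] on the masses of all its points, gives
    the exponent d/2. *)
Lemma heat_kernel : exists2 kappa : R, (0 < kappa)%R &
  forall k x y, iter k P (point_mass R y) x <=
    ((kappa * k.+1%:R) `^ (- (d%:R / 2)))%:E.
Proof.
have [vs svs [tvs Pvs]] := triangular_support cX eX gX (leqnn d).
pose mass a := P0 (xi 0%N @^-1` [set a]).
have mass_fin a : mass a \is a fin_num by rewrite fin_num_measure//; exact: measurable_funPTI.
have mass_gt0 a : a \in [seq p.1 | p <- vs] ++ [seq p.2 | p <- vs] -> 0 < mass a.
  by rewrite mem_cat => /orP[] /mapP[p /Pvs[p1 p2] ->].
have [mu /andP[mu0 mu1] muP] := seq_positive_lower_bound mass_fin mass_gt0.
(* Halving keeps the coin probability 2 e at most 1. *)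
pose e : R := (mu / 2)%R.
have e0 : (0 < e)%R by rewrite divr_gt0.
have e12 : (2 * e <= 1)%R by rewrite /e mulrC divfK.
have emass p : p \in vs -> e%:E <= mass p.1 /\ e%:E <= mass p.2.
  have emu : e%:E <= mu%:E by rewrite lee_fin /e; lra.
  move=> pvs; split; apply: (le_trans emu); apply: muP; rewrite mem_cat.
    by rewrite map_f.
  by apply/orP; right; exact: (map_f snd).
have eta01 : (0 < 2 * e <= 1)%R by rewrite mulr_gt0.
have split_vs p : p \in vs -> coin_split (2 * e) P p.1 p.2.
  move=> pvs; have [p1 p2] := emass p pvs.
  apply: coin_split_walk_op => //.
  have : forall ws, triangular R ws -> p \in ws -> p.1 != p.2.
    elim=> //= q ws IH [[l lq lws] tws]; rewrite inE => /orP[/eqP ->|]; last exact: IH.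
    apply/eqP => q12; apply: lq; rewrite q12 subrr.
    by rewrite /dotz big1// => i _; rewrite mxE mulr0.
  by move/(_ vs tvs pvs).
exists (2 * e / (4 * d%:R))%R; first by rewrite !(divr_gt0, mulr_gt0, ltr0n).
move=> k x y.
have := @iter_point_mass_le _ _ P (2 * e)%R vs aP _ eta01 split_vs tvs _ k x y.
by rewrite svs; apply => // z; rewrite walk_op1.
Qed.

Lemma iter_walk_op_finsupp (f : zlattice d -> R) (B : seq (zlattice d)) k x :
  uniq B -> (forall z, 0 <= f z)%R -> (forall z, z \notin B -> f z = 0%R) ->
  iter k P (fun z => (f z)%:E) x =
  \sum_(y <- B) (f y)%:E * iter k P (point_mass R y) x.
Proof.
move=> uB f0 fB.
have p0 y z : 0 <= point_mass R y z by rewrite /point_mass; case: ifP.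
have -> : (fun z => (f z)%:E) = fun z => \sum_(y <- B) (f y)%:E * point_mass R y z.
  apply/funext => z; have [zB|zB] := boolP (z \in B).
    rewrite (bigD1_seq z)//= /point_mass eqxx mule1 big1 ?adde0// => y yz.
    by rewrite eq_sym (negbTE yz) mule0.
  rewrite fB// big_seq big1// => y yB; rewrite /point_mass.
  by case: eqP => [zy|]; [rewrite -zy (negbTE zB) in yB|rewrite mule0].
have aPk := averaging_iter k aP.
rewrite (avg_sum _ aPk) => [|y z]; last by rewrite mule_ge0 ?lee_fin.
by apply: eq_bigr => y _; rewrite (avgZ aPk).
Qed.

(** Interpolates between a supremum bound below the level v and an l^b bound above it. *)
Lemma le_young_powR (b u v : R) : (1 <= b)%R -> (0 <= u)%R -> (0 < v)%R ->
  (u <= v + v `^ (1 - b) * u `^ b)%R.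
Proof.
move=> b1 u0 v0; have [uv|vu] := leP u v.
  by apply: (le_trans uv); rewrite lerDl mulr_ge0// powR_ge0.
have u1 := lt_trans v0 vu.
apply: (@le_trans _ _ (v `^ (1 - b) * u `^ b)%R); last by rewrite lerDr ltW.
have E : u = (u `^ (1 - b) * u `^ b)%R.
  by rewrite -powRD subrK ?oner_eq0// powRr1.
rewrite {1}E ler_wpM2r ?powR_ge0//.
have -> : (1 - b = - (b - 1))%R by rewrite opprB.
rewrite !powRN lef_pV2 ?posrE ?powR_gt0//.
by apply: ge0_ler_powR; rewrite ?nnegrE ?subr_ge0// ltW.
Qed.

(** The k-th iterate is at most 2 (s F)^(1/b) with s of order k^(-d/2). The resulting exponent d /
    (2 b) exceeds 1, so the sum over k is bounded uniformly in n. *)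
Lemma green_bound (b : R) : (1 <= b)%R -> (b < d%:R / 2)%R ->
  exists2 C : R, (0 < C)%R & forall n x (f : zlattice d -> R) (B : seq (zlattice d)),
    uniq B -> (forall z, 0 <= f z)%R -> (forall z, z \notin B -> f z = 0%R) ->
    \sum_(k < n) iter k P (fun z => (f z)%:E) x <=
      (C * (\sum_(z <- B) f z `^ b) `^ b^-1)%:E.
Proof.
move=> b1 bd; have [kappa kappa0 hk] := heat_kernel.
have b0 : (0 < b)%R by apply: lt_le_trans b1.
have p1 : (1 < d%:R / 2 / b)%R by rewrite ltr_pdivlMr// mul1r.
have [C C0 sumC] := sum_riemannR_le p1.
pose D : R := (kappa `^ (- (d%:R / 2 / b)))%R.
have D0 : (0 < D)%R by rewrite powR_gt0.
exists (2 * D * C)%R; first by rewrite !mulr_gt0.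
move=> n x f B uB f0 fB.
set F := (\sum_(z <- B) _)%R.
have F0 : (0 <= F)%R by apply: sumr_ge0 => z _; exact: powR_ge0.
have step k : iter k P (fun z => (f z)%:E) x <=
    (2 * D * F `^ b^-1 * k.+1%:R `^ (- (d%:R / 2 / b)))%:E.
  set s : R := ((kappa * k.+1%:R) `^ (- (d%:R / 2)))%R.
  have s0 : (0 < s)%R by rewrite powR_gt0// mulr_gt0.
  have fb0 z : (0 <= f z `^ b)%R by exact: powR_ge0.
  (* The level v chosen below must be positive, so the case f = 0 is treated apart. *)
  have [F0'|Fpos] := eqVneq F 0%R.
    rewrite (iter_walk_op_finsupp _ _ uB)// big_seq big1 ?lee_fin.
      by rewrite !mulr_ge0 ?powR_ge0// ltW.
    move=> z zB; suff -> : f z = 0%R by rewrite mul0e.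
    apply/eqP; move: F0' => /eqP; rewrite psumr_eq0 => [|y _]; last exact: powR_ge0.
    by move=> /allP /(_ z zB) /=; rewrite powR_eq0 => /andP[].
  have {Fpos}Fpos : (0 < F)%R by rewrite lt_neqAle eq_sym Fpos.
  (* Splitting f at the level v balances the mass bound v with the heat kernel
     bound v^(1-b) s F for the part of f above v. *)
  pose v := ((s * F) `^ b^-1)%R.
  have v0 : (0 < v)%R by rewrite powR_gt0// mulr_gt0.
  have aPk := averaging_iter k aP.
  have -> : (2 * D * F `^ b^-1 * k.+1%:R `^ (- (d%:R / 2 / b)))%:E = (2 * v)%:E.
    congr _%:E; rewrite /v powRM ?ltW// /s powRM ?ltW// (powRM _ (powR_ge0 _ _) (powR_ge0 _ _)).
    rewrite -!powRrM mulNr /D; ring.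
  apply: (@le_trans _ _ (iter k P (fun z => (v%:E * 1) + (v `^ (1 - b))%:E * (f z `^ b)%:E) x)).
    apply: (avg_le aPk) => z; first by rewrite lee_fin.
    by rewrite mule1 -EFinM -EFinD lee_fin; exact: le_young_powR.
  have vE0 : (0 <= v)%R by exact: ltW.
  rewrite (avgD aPk); last 2 first.
  - by move=> z; rewrite mule1 lee_fin.
  - by move=> z; rewrite -EFinM lee_fin mulr_ge0// powR_ge0.
  rewrite (avgZ aPk)// (avgZ aPk) ?powR_ge0//.
  apply: (@le_trans _ _ (v%:E * 1 + (v `^ (1 - b))%:E * (s * F)%:E)).
    apply: leeD; apply: lee_wpmul2l; rewrite ?lee_fin ?powR_ge0//.
      exact: iter_walk_op_le1.
    rewrite (iter_walk_op_finsupp _ _ uB) => [||z zB]; last first.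
    - by rewrite fB// powR0// gt_eqF.
    - by [].
    rewrite mulrC /F mulr_suml -sumEFin; apply: lee_sum => z _.
    by rewrite EFinM; apply: lee_wpmul2l; rewrite ?lee_fin.
  rewrite mule1 -EFinM -EFinD lee_fin mulr_natl mulr2n lerD2l.
  have -> : (s * F = v `^ b)%R.
    by rewrite /v -powRrM mulVf ?gt_eqF// powRr1// mulr_ge0// ltW.
  by rewrite -powRD ?subrK ?powRr1 ?oner_eq0// ltW.
apply: (@le_trans _ _ (\sum_(k < n) (2 * D * F `^ b^-1 * k.+1%:R `^ (- (d%:R / 2 / b)))%:E)).
  by apply: lee_sum => k _; exact: step.
rewrite sumEFin lee_fin -mulr_sumr [leRHS]mulrAC ler_wpM2l//.
by rewrite !mulr_ge0 ?powR_ge0// ltW.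
Qed.

(** By [feynman_kac] the exponential moment is an iterate of e^f P. A constant bound would not
    survive the iteration; 1 plus twice the expected sum over the j steps to come does. *)
Lemma khasminskii n (f : zlattice d -> R) : (forall z, 0 <= f z)%R ->
  (forall x, \sum_(k < n) iter k P (fun z => (f z)%:E) x <= (2^-1)%:E) ->
  \int[P0]_w (expR (\sum_(k < n) f (walk xi k w)))%:E <= 2%:E.
Proof.
move=> f0 fn.
pose T (h : zlattice d -> \bar R) y := (expR (f y))%:E * P h y.
pose u k x := iter k P (fun z => (f z)%:E) x.
have u0 k x : 0 <= u k x.
  by apply: (avg_ge0 (averaging_iter k aP)) => z; rewrite lee_fin.
(* Preserved because exp(a) (1 + 2 r) <= 1 + 2 (a + r) whenever a + r <= 1/2. *)
have main j : (j <= n)%N -> forall x, iter j T (fun=> 1) x <=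
    1 + 2%:E * \sum_(k < j) u k x.
  elim: j => [_ x|j IH jn x]; first by rewrite big_ord0 mule0 adde0.
  have S0 y : 0 <= \sum_(k < j) u k y by apply: sume_ge0.
  have T0 i y : 0 <= iter i T (fun=> 1) y.
    elim: i y => //= i IHi y; apply: mule_ge0; first by rewrite lee_fin expR_ge0.
    exact: (avg_ge0 aP).
  have : P (iter j T (fun=> 1)) x <= 1 + 2%:E * \sum_(k < j) u k.+1 x.
    apply: le_trans (avg_le aP (T0 j) (IH (ltnW jn)) x) _.
    rewrite (avgD aP)//; last by move=> y; rewrite mule_ge0.
    by rewrite walk_op1 (avgZ aP)// (avg_sum _ aP).
  have sum_le : u 0%N x + \sum_(k < j) u k.+1 x <= (2^-1)%:E.
    have -> : u 0%N x + \sum_(k < j) u k.+1 x = \sum_(k < j.+1) u k x.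
      by rewrite big_ord_recl.
    apply: le_trans (fn x).
    rewrite (big_ord_widen n (fun k => u k x))// big_mkcond.
    by apply: lee_sum => i _; case: ifP => // _; exact: u0.
  have -> : \sum_(k < j.+1) u k x = (f x)%:E + \sum_(k < j) u k.+1 x.
    by rewrite big_ord_recl.
  have : 0 <= \sum_(k < j) u k.+1 x by apply: sume_ge0 => k _; exact: u0.
  rewrite iterS {1}/T; move: sum_le; have -> : u 0%N x = (f x)%:E by [].
  case: (\sum_(k < j) u k.+1 x) => [r||] //.
  rewrite -EFinD lee_fin => sle; rewrite lee_fin => r0 Ple.
  apply: le_trans (lee_wpmul2l _ Ple) _; first by rewrite lee_fin expR_ge0.
  change ((expR (f x) * (1 + 2 * r))%:E <= (1 + 2 * (f x + r))%:E).
  rewrite lee_fin.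
  have a0 := f0 x; set a := f x in a0 sle *.
    have a1 : (0 < 1 - a)%R by lra.
    (* The rest is (1 - a) (1 + 2 (a + r)) = 1 + 2 r + a (1 - 2 (a + r)), with a last term that is
       nonnegative. *)
    have ea : (expR a <= (1 - a)^-1)%R.
      rewrite -[a in expR a]opprK expRN lef_pV2 ?posrE ?expR_gt0//.
      exact: expR_ge1Dx.
    have r2 : (0 <= 1 + 2 * r)%R by lra.
    apply: le_trans (ler_wpM2r r2 ea) _.
    rewrite mulrC ler_pdivrMr//; nra.
have := main n (leqnn n) 0%R.
have <- : \int[P0]_w (expR (\sum_(k < n) f (walk xi k w)))%:E = iter n T (fun=> 1) 0%R.
  rewrite /T -(feynman_kac iid_xi (e := fun y => expR (f y)) (g := fun=> 1))//.
    apply: eq_integral => w _; rewrite mule1 expR_sum; congr _%:E.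
    by apply: eq_bigr => k _; rewrite add0r.
move=> /le_trans; apply.
have := fn 0%R; rewrite -/(u _ _) => h.
apply: (@le_trans _ _ (1 + 2%:E * (2^-1)%:E)).
  by apply: leeD2l; apply: lee_wpmul2l.
by rewrite -EFinM mulfV.
Qed.

Lemma walk_functional_tail n (f : zlattice d -> R) (M t : R) :
  (0 < M)%R -> (forall z, 0 <= f z)%R ->
  (forall x, \sum_(k < n) iter k P (fun z => (f z)%:E) x <= M%:E) ->
  P0 [set w | (t <= \sum_(k < n) f (walk xi k w))%R] <=
    (2 * expR (- (t / (2 * M))))%:E.
Proof.
move=> M0 f0 fM.
(* The scale at which the expected sums are at most 1/2, as [khasminskii] requires. *)
pose c : R := ((2 * M)^-1)%R.
have c0 : (0 < c)%R by rewrite invr_gt0 mulr_gt0.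
have h0 z : (0 <= c * f z)%R by rewrite mulr_ge0// ltW.
have fE0 z : 0 <= (f z)%:E by rewrite lee_fin.
have kh := khasminskii h0 (n := n).
have mS : measurable_fun setT (fun w => \sum_(k < n) f (walk xi k w))%R.
  apply: measurable_sum => k.
  exact: (measurableT_comp (measurable_fun_zlattice f) (measurable_walk iid_xi k)).
have {}kh : \int[P0]_w (expR (c * \sum_(k < n) f (walk xi k w)))%:E <= 2%:E.
  apply: le_trans (kh _) => [|x].
    by under [leRHS]eq_integral do rewrite -mulr_sumr.
  rewrite (eq_bigr (fun k : 'I_n => c%:E * iter k P (fun z => (f z)%:E) x)).
    rewrite -ge0_sume_distrr; last first.
      by move=> k _; exact: (avg_ge0 (averaging_iter k aP)).
    apply: le_trans (lee_wpmul2l _ (fM x)) _; first by rewrite lee_fin ltW.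
    by rewrite -EFinM lee_fin /c invfM divfK ?gt_eqF.
  by move=> k _; rewrite -(avgZ (averaging_iter k aP) (ltW c0)).
apply: le_trans (exp_markov P0 t mS (ltW c0)) _.
apply: le_trans (lee_wpmul2l _ kh) _; first by rewrite lee_fin expR_ge0.
by rewrite -EFinM lee_fin mulrC /c (mulrC _ t).
Qed.

Lemma walk_power_tail (b : R) : (1 <= b)%R -> (b < d%:R / 2)%R ->
  exists2 c : R, (0 < c)%R &
  forall n (f : zlattice d -> R) (B : seq (zlattice d)) (F t : R),
    uniq B -> (forall z, 0 <= f z)%R -> (forall z, z \notin B -> f z = 0%R) ->
    (0 < F)%R -> (\sum_(z <- B) f z `^ b <= F)%R -> (0 <= t)%R ->
  P0 [set w | (t <= \sum_(k < n) f (walk xi k w))%R] <=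
    (2 * expR (- (c * t / F `^ b^-1)))%:E.
Proof.
move=> b1 bd; have [C C0 green] := green_bound b1 bd.
exists (2 * C)^-1%R; first by rewrite invr_gt0 mulr_gt0.
move=> n f B F t uB f0 fB F0 fF t0.
have FC0 : (0 < C * F `^ b^-1)%R by rewrite mulr_gt0// powR_gt0.
have -> : ((2 * C)^-1 * t / F `^ b^-1 = t / (2 * (C * F `^ b^-1)))%R.
  by field; rewrite !gt_eqF// powR_gt0.
apply: walk_functional_tail => // x.
apply: le_trans (green n x f B uB f0 fB) _.
rewrite lee_fin ler_pM2l//; apply: ge0_ler_powR; rewrite ?nnegrE//.
- by rewrite invr_ge0; apply: le_trans b1.
- by apply: sumr_ge0 => z _; exact: powR_ge0.
- exact: ltW.
Qed.

End green_function.

(** * Union bound, path events and exit from the box *)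

Lemma union_bound (R : realType) (dO : measure_display) (O : measurableType dO)
    (P : probability O R) (T : finType) (A : T -> set O) (E : set O) :
  (forall t, measurable (A t)) -> measurable E ->
  (forall w, E w -> exists t, A t w) ->
  (P E <= \sum_(t : T) P (A t))%E.
Proof.
move=> mA mE EA; rewrite -big_enum /= fsbig_seq ?enum_uniq//.
apply: content_sub_fsum => // w /EA [t At].
by exists t => //=; rewrite mem_enum.
Qed.

Section walk_path.
Context (R : realType) (d : nat) (dW : measure_display) (W : measurableType dW)
  (P0 : probability W R) (xi : nat -> {RV P0 >-> zlattice d}).
Hypothesis iid_xi : iid xi.

Definition walk_path (n : nat) (w : W) : seq (zlattice d) :=
  [seq walk xi k w | k <- iota 0 n.+1].

Lemma size_walk_path n w : size (walk_path n w) = n.+1.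
Proof. by rewrite size_map size_iota. Qed.

Lemma measurable_walk_path_eq n (s : seq (zlattice d)) :
  measurable [set w | walk_path n w = s].
Proof.
rewrite /walk_path; elim: (iota _ _) s => [|k ks IH] [|x s] /=.
- by rewrite (_ : [set _ | _] = setT)//; apply/seteqP; split.
- by rewrite (_ : [set _ | _] = set0)//; apply/seteqP; split.
- by rewrite (_ : [set _ | _] = set0)//; apply/seteqP; split.
- rewrite (_ : [set _ | _] = (setT `&` walk xi k @^-1` [set x]) `&`
    [set w | [seq walk xi k w | k <- ks] = s]).
    apply: measurableI => //; exact: measurable_walk.
  apply/seteqP; split => w /= [].
    by move=> -> ->.
  by move=> [_ ->] ->.
Qed.

(** The path takes countably many values, so an event about path and scenery is a countable union of
    rectangles. This is how sums of the scenery along the walk are seen to be measurable. *)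
Lemma measurable_walk_path_prod n (dE : measure_display) (E : measurableType dE)
    (Q : seq (zlattice d) -> set E) : (forall s, measurable (Q s)) ->
  measurable [set we : W * E | Q (walk_path n we.1) we.2].
Proof.
move=> mQ; rewrite (_ : [set _ | _] = \bigcup_(s : seq 'rV[int]_d)
    ([set w | walk_path n w = s] `*` Q s)).
  apply: measurable_bigcup_countable => s; apply: measurableX => //.
  exact: measurable_walk_path_eq.
apply/seteqP; split => [[w e] /= Qwe|[w e] [s _ [/= -> //]]].
by exists (walk_path n w).
Qed.

Lemma measurable_walk_path n (Q : seq (zlattice d) -> Prop) :
  measurable [set w | Q (walk_path n w)].
Proof.
rewrite (_ : [set _ | _] = \bigcup_(s : seq 'rV[int]_d)
    (if pselect (Q s) then [set w | walk_path n w = s] else set0)).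
  apply: measurable_bigcup_countable => s; case: pselect => Qs; last exact: measurable0.
  exact: measurable_walk_path_eq.
apply/seteqP; split => [w /= Qw|w [s _]].
  by exists (walk_path n w) => //; case: pselect.
by case: pselect => // Qs /= ->.
Qed.

End walk_path.

Section box_exit.
Context (R : realType) (d : nat) (dW : measure_display) (W : measurableType dW)
  (P0 : probability W R) (xi : nat -> {RV P0 >-> zlattice d}).
Hypotheses (iid_xi : iid xi) (eX : exponential_moments (xi 0%N)).
Local Open Scope ereal_scope.

Lemma lattice_box (N : nat) : exists B : seq (zlattice d),
  [/\ uniq B, (size B <= (2 * N).+1 ^ d)%N &
      forall z : zlattice d, (forall i, (`|z 0%R i| <= N)%N) -> z \in B].
Proof.
pose F (f : {ffun 'I_d -> 'I_(2 * N).+1}) : zlattice d :=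
  (\row_i ((f i : nat)%:Z - N%:Z))%R.
exists (undup [seq F f | f : {ffun 'I_d -> 'I_(2 * N).+1}]); split.
- exact: undup_uniq.
- apply: leq_trans (size_undup _) _.
  by rewrite size_map -cardE card_ffun !card_ord.
- move=> z zN; rewrite mem_undup; apply/mapP.
  exists [ffun i => inord (absz (z 0%R i + N%:Z)%R)]; first by rewrite mem_enum.
  apply/rowP => i; rewrite !mxE ffunE inordK; have := zN i; lia.
Qed.

Lemma step_coord_tail : exists2 C : R, (0 < C)%R & forall j (n : nat) (i : 'I_d),
  P0 [set w | (n < `|xi j w 0%R i|)%N] <= (C * expR (- n%:R))%:E.
Proof.
pose m s i := \int[P0]_w (expR (s * (xi 0%N w 0%R i)%:~R))%:E.
have mfin s i : m s i \is a fin_num.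
  rewrite ge0_fin_numE; last by apply: integral_ge0 => w _; rewrite lee_fin expR_ge0.
  exact: exp_coord_integral_lty.
have m0 s i : (0 <= fine (m s i))%R.
  by apply: fine_ge0; apply: integral_ge0 => w _; rewrite lee_fin expR_ge0.
pose C : R := (1 + \sum_(i < d) (fine (m 1 i) + fine (m (-1) i)))%R.
have C0 : (0 < C)%R.
  by rewrite /C ltr_pwDl// sumr_ge0// => i _; rewrite addr_ge0.
exists C => // j n i.
have mS : measurable [set w | (n < `|xi j w 0%R i|)%N].
  have -> : [set w | (n < `|xi j w 0%R i|)%N] =
     xi j @^-1` [set z | (n < `|z 0%R i|)%N] by [].
  exact: measurable_funPTI.
have -> : P0 [set w | (n < `|xi j w 0%R i|)%N] = P0 [set w | (n < `|xi 0%N w 0%R i|)%N].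
  by have := iid_xi.2 j 0%N [set z | (n < `|z 0%R i|)%N]; apply.
set S := [set w | _].
have mS0 : measurable S.
  have -> : S = xi 0%N @^-1` [set z | (n < `|z 0%R i|)%N] by [].
  exact: measurable_funPTI.
rewrite -[S]setIT -integral_indic//.
have me s : measurable_fun setT (fun w => (expR (s * (xi 0%N w 0%R i)%:~R))%:E : \bar R).
  exact: (measurable_step xi (fun z : zlattice d => (expR (s * (z 0%R i)%:~R))%:E : \bar R)).
apply: (@le_trans _ _ (\int[P0]_w ((expR (- n%:R))%:E *
   ((expR (1 * (xi 0%N w 0%R i)%:~R))%:E + (expR (-1 * (xi 0%N w 0%R i)%:~R))%:E)))).
  apply: ge0_le_integral => //.
  - exact/measurable_EFinP/measurable_indic.
  - by apply: emeasurable_funM; [exact: measurable_cst|exact: emeasurable_funD].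
  move=> w _; rewrite indicE -EFinD -EFinM lee_fin.
  case: (boolP (w \in S)) => [/set_mem|_]; last by rewrite mulr_ge0 ?addr_ge0 ?expR_ge0.
  rewrite /S /= => Sw; rewrite mulrDr -!expRD mul1r mulN1r.
  set z := xi 0%N w 0%R i in Sw *.
  have [z0|z0] := leP 0%R z.
    have : (0 <= - n%:R + z%:~R :> R)%R.
      by rewrite addrC subr_ge0 -[n%:R]/(n%:Z%:~R) ler_int; lia.
    rewrite -ler_expR expR0 => h; apply: (le_trans h); rewrite lerDl; exact: expR_ge0.
  have : (0 <= - n%:R - z%:~R :> R)%R.
    by rewrite addrC subr_ge0 -[n%:R]/(n%:Z%:~R) -mulrNz ler_int; lia.
  rewrite -ler_expR expR0 => h; apply: (le_trans h); rewrite lerDr; exact: expR_ge0.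
rewrite ge0_integralZl ?lee_fin ?expR_ge0//; last 2 first.
- exact: (emeasurable_funD (me 1%R) (me (-1)%R)).
- by move=> w _; rewrite adde_ge0// lee_fin expR_ge0.
rewrite ge0_integralD//; try by move=> w _; rewrite lee_fin expR_ge0.
rewrite -/(m 1%R i) -/(m (-1)%R i) -(fineK (mfin _ _)) -(fineK (mfin (-1)%R i)).
rewrite -EFinD -EFinM lee_fin mulrC ler_wpM2r ?expR_ge0//.
rewrite /C (bigD1 i)//= addrCA lerDl addr_ge0//.
by rewrite sumr_ge0// => k _; rewrite addr_ge0.
Qed.

(** If no coordinate of the first n increments exceeds n in absolute value, the walk stays within
    n^2. Each of the n d exceptions has probability O(e^(-n)). *)
Lemma walk_box_exit : exists2 C : R, (0 < C)%R & forall n (B : seq (zlattice d)),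
  (forall z : zlattice d, (forall i, (`|z 0%R i| <= n * n)%N) -> z \in B) ->
  P0 [set w | ~~ all [in B] (walk_path xi n w)] <= (C * n%:R * expR (- n%:R))%:E.
Proof.
have [C C0 tail] := step_coord_tail.
exists (C * d%:R + 1)%R.
  by rewrite ltr_wpDl// mulr_ge0// ltW.
move=> n B BP.
pose A (j : 'I_n) (i : 'I_d) := [set w | (n < `|xi j w 0%R i|)%N].
have mA j i : measurable (A j i).
  have -> : A j i = xi j @^-1` [set z | (n < `|z 0%R i|)%N] by [].
  exact: measurable_funPTI.
apply: (@le_trans _ _ (\sum_(p : 'I_n * 'I_d) P0 (A p.1 p.2))).
  apply: union_bound; [by move=> p; exact: mA|exact: (measurable_walk_path iid_xi n (fun s => ~~ all [in B] s))|].
  move=> w Ew; have /allPn [z /mapP[k]] : ~~ all [in B] (walk_path xi n w) := Ew.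
  rewrite mem_iota add0n => /andP[_ kn] -> zB.
  apply: contrapT => nA; suff h : walk xi k w \in B by move: zB; rewrite /= h.
  apply: BP => i.
  have step j : (j < n)%N -> (`|xi j w 0%R i| <= n)%N.
    move=> jn; rewrite leqNgt; apply/negP => lt_n; apply: nA.
    by exists (Ordinal jn, i).
  have : forall j, (j <= n)%N -> (`|walk xi j w 0%R i| <= j * n)%N.
    elim=> [_|j IH jn]; first by rewrite /walk big_ord0 mxE.
    have := IH (ltnW jn); have := step j jn; rewrite walkS mxE mulSn.
    move: (walk xi j w 0%R i) (xi j w 0%R i) (j * n)%N => a b c; lia.
  by move=> /(_ k kn) h; apply: (leq_trans h); rewrite leq_mul2r -ltnS kn orbT.
apply: (@le_trans _ _ (\sum_(p : 'I_n * 'I_d) (C * expR (- n%:R))%:E)).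
  by apply: lee_sum => p _; exact: tail.
rewrite sumEFin lee_fin sumr_const card_prod !card_ord -[leLHS]mulr_natl natrM.
rewrite mulrA ler_wpM2r ?expR_ge0//.
have -> : (n%:R * d%:R * C = (C * d%:R) * n%:R :> R)%R by ring.
by rewrite ler_wpM2r// lerDl.
Qed.

End box_exit.

(** * Exponential bounds for the scenery *)

Section scenery_tails.
Context (R : realType) (dE : measure_display) (E : measurableType dE)
  (P : probability E R) (I : choiceType) (eta : I -> {RV P >-> R}) (i0 : I).
Hypotheses (iid_eta : iid eta) (sym_eta : symmetric_law (eta i0)).
Local Open Scope ereal_scope.

Lemma integral_identical i (g : R -> \bar R) : measurable_fun setT g ->
  (forall x, 0 <= g x) -> \int[P]_w g (eta i w) = \int[P]_w g (eta i0 w).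
Proof.
move=> mg g0; rewrite -!(ge0_integral_distribution _ (f := g))//.
by apply: eq_measure_integral => A mA _; case: iid_eta => _; apply.
Qed.

Lemma integral_symmetric i (g : R -> \bar R) : measurable_fun setT g ->
  (forall x, 0 <= g x) -> \int[P]_w g (eta i w) = \int[P]_w g (- eta i w)%R.
Proof.
move=> mg g0; have mgN : measurable_fun setT (g \o -%R) by exact: measurableT_comp.
rewrite (integral_identical i)// (integral_identical i mgN (fun x => g0 (- x)%R)).
have mN : measurable_fun setT (fun w => - eta i0 w)%R by exact: measurableT_comp.
pose N : {mfun E >-> R} := HB.pack (fun w => - eta i0 w)%R
  (isMeasurableFun.Build _ _ _ _ _ mN).
rewrite -(ge0_integral_distribution (eta i0) (f := g))//.
transitivity (\int[distribution P N]_y g y).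
  by apply: eq_measure_integral => A mA _; exact/esym/sym_eta.
exact: ge0_integral_distribution.
Qed.

Definition trunc_val (K v : R) : R := if (`|v| <= K)%R then v else 0%R.

Lemma measurable_trunc_val K : measurable_fun setT (trunc_val K).
Proof.
rewrite /trunc_val; apply: measurable_fun_ifT => //.
by apply: measurable_fun_ler => //; exact: normr_measurable.
Qed.

Lemma expR_sym_le (x : R) : (expR x + expR (- x) <= 2 * expR (2 * x ^+ 2))%R.
Proof.
wlog x0 : x / (0 <= x)%R.
  move=> h; have [/h //|/ltW x0] := leP 0%R x.
  by have := h (- x)%R; rewrite sqrrN opprK addrC oppr_ge0; apply.
have [xs|xl] := leP (x ^+ 2)%R (2^-1)%R; last first.
  have h : (x <= 2 * x ^+ 2)%R by nra.
  have h1 : (expR x <= expR (2 * x ^+ 2))%R by rewrite ler_expR.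
  have h2 : (expR (- x) <= expR (2 * x ^+ 2))%R by rewrite ler_expR; lra.
  by lra.
have x1 : (0 < 1 - x)%R by nra.
have e1 : (expR x <= (1 - x)^-1)%R.
  by rewrite -[x in (expR x <= _)%R]opprK expRN lef_pV2 ?posrE ?expR_gt0// expR_ge1Dx.
have e2 : (expR (- x) <= (1 + x)^-1)%R.
  rewrite expRN lef_pV2 ?posrE ?expR_gt0//; first exact: expR_ge1Dx.
  by lra.
have e3 := expR_ge1Dx (2 * x ^+ 2)%R.
apply: le_trans (lerD e1 e2) _.
apply: (@le_trans _ _ (2 * (1 + 2 * x ^+ 2))%R); last by rewrite ler_pM2l.
have -> : ((1 - x)^-1 + (1 + x)^-1 = 2 / (1 - x ^+ 2))%R.
  by field; apply/and3P; split; apply/eqP; nra.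
by rewrite ler_pdivrMr; nra.
Qed.

(** Truncation at a symmetric level keeps the law symmetric, so the integral is an average over the
    two signs, to which [expR_sym_le] applies pointwise. *)
Lemma mgf_trunc_le i (u K : R) :
  \int[P]_w (expR (u * trunc_val K (eta i w)))%:E <=
    (expR (2 * (u * K) ^+ 2))%:E.
Proof.
pose g v := (expR (u * trunc_val K v))%:E : \bar R.
have mT := measurable_trunc_val K.
have mg : measurable_fun setT g.
  by apply/measurable_EFinP; apply: measurableT_comp => //; exact: measurable_funM.
have g0 v : 0 <= g v by rewrite lee_fin expR_ge0.
have mge : measurable_fun setT (fun w => g (eta i w)) by exact: measurableT_comp.
have mgN : measurable_fun setT (fun w => g (- eta i w)%R).
  by apply: (measurableT_comp mg); exact: measurableT_comp.
have : \int[P]_w g (eta i w) + \int[P]_w g (eta i w) <= 2%:E * (expR (2 * (u * K) ^+ 2))%:E.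
  rewrite {2}(integral_symmetric i mg g0) -ge0_integralD//.
  apply: (@le_trans _ _ (\int[P]_w (2%:E * (expR (2 * (u * K) ^+ 2))%:E))).
    apply: ge0_le_integral => //.
    - by move=> w _; exact: adde_ge0.
    - exact: emeasurable_funD.
    move=> w _; rewrite -EFinD -EFinM lee_fin.
    rewrite /trunc_val normrN; case: ifPn => vK; last first.
      have := expR_sym_le 0%R; rewrite expr0n/= !mulr0 oppr0 => h.
      apply: le_trans h _; rewrite ler_pM2l// ler_expR.
      by rewrite mulr_ge0// sqr_ge0.
    rewrite mulrN; apply: le_trans (expR_sym_le _) _.
    rewrite ler_pM2l// ler_expR ler_pM2l// !exprMn ler_wpM2l ?sqr_ge0//.
    by rewrite -[leLHS]real_normK ?num_real// lerXn2r ?nnegrE// (le_trans _ vK).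
  by rewrite (integral_prob_cst P (2%:E * (expR (2 * (u * K) ^+ 2))%:E)).
case: (\int[P]_w g (eta i w)) => [r||]//; last by move=> _; rewrite leNye.
by rewrite -EFinD -EFinM !lee_fin; lra.
Qed.

(** Chernoff bound with [theta] left free: its best value depends on the local times and is fixed in
    [gaussian_term_le]. *)
Lemma trunc_sum_tail (K theta t : R) (a : I -> R) (B : seq I) : uniq B ->
  (0 <= theta)%R ->
  P [set w | (t <= \sum_(z <- B) a z * trunc_val K (eta z w))%R] <=
    (expR (- (theta * t) + 2 * (theta * K) ^+ 2 * \sum_(z <- B) a z ^+ 2))%:E.
Proof.
move=> uB theta0; have mT := measurable_trunc_val K.
have mY : measurable_fun setT (fun w => \sum_(z <- B) a z * trunc_val K (eta z w))%R.
  by apply: measurable_sum => z; apply: measurable_funM => //; exact: measurableT_comp.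
apply: le_trans (exp_markov P t mY theta0) _.
rewrite expRD EFinM; apply: lee_wpmul2l; first by rewrite lee_fin expR_ge0.
pose h z v := expR (theta * a z * trunc_val K v).
have mh z : measurable_fun setT (h z).
  by apply: measurableT_comp => //; exact: measurable_funM.
have [_ hE] := @independent_off_prod _ _ _ _ _ _ _ eta iid_eta.1 h B mh
  (fun z t => expR_ge0 _) uB.
rewrite (_ : \int[P]_w _ = \int[P]_w (\prod_(z <- B) h z (eta z w))%:E); last first.
  apply: eq_integral => w _; congr _%:E; rewrite mulr_sumr expR_sum.
  by apply: eq_bigr => z _; rewrite mulrA.
rewrite hE mulr_sumr expR_sum -prodEFin.
suff /andP[] : 0 <= \prod_(z <- B) \int[P]_w (h z (eta z w))%:E <=
  \prod_(z <- B) (expR (2 * (theta * K) ^+ 2 * a z ^+ 2))%:E by [].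
elim/big_ind2 : _ => [|x1 x2 y1 y2 /andP[x10 x12] /andP[y10 y12]|z _].
- by rewrite lee01 lexx.
- by rewrite mule_ge0// lee_pmul.
apply/andP; split; first by apply: integral_ge0 => w _; rewrite lee_fin expR_ge0.
apply: le_trans (mgf_trunc_le _ _ _) _.
by rewrite lee_fin ler_expR mulrAC !exprMn !mulrA.
Qed.

Context (alpha c : R).
Hypotheses (alpha1 : (1 <= alpha)%R) (c0 : (0 < c)%R)
  (tail_eta : asymptotic (fun t => fine (P [set w | (t < eta i0 w)%R]))
                         (fun t => expR (- (c * t `^ alpha)))).

Let ratio t := (fine (P [set w | (t < eta i0 w)%R]) / expR (- (c * t `^ alpha)))%R.

Lemma tail_two_sided : exists2 t0 : R, (0 < t0)%R & forall t, (t0 <= t)%R ->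
  ((2^-1 * expR (- (c * t `^ alpha)))%:E <= P [set w | (t < eta i0 w)%R]
   <= (2 * expR (- (c * t `^ alpha)))%:E).
Proof.
have : \forall t \near +oo%R, (`|1 - ratio t| < 2^-1)%R.
  have /cvgrPdist_lt := tail_eta; apply.
  by rewrite invr_gt0.
case=> M [_ HM]; exists (`|M| + 1)%R; first by rewrite ltr_wpDl.
move=> t tM.
have Mt : (M < t)%R.
  by apply: lt_le_trans tM; rewrite (le_lt_trans (ler_norm M))// ltrDl.
have := HM _ Mt; rewrite /= /ratio distrC ltr_distl => /andP[h1 h2].
have mS : measurable [set w | (t < eta i0 w)%R].
  have -> : [set w | (t < eta i0 w)%R] = eta i0 @^-1` `]t, +oo[.
    by apply/seteqP; split => w /=; rewrite in_itv/= andbT.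
  exact: measurable_funPTI.
rewrite -(fineK (fin_num_measure P _ mS)) !lee_fin.
rewrite -ler_pdivlMr ?expR_gt0// -[X in _ && X]ler_pdivrMr ?expR_gt0//.
by apply/andP; split; lra.
Qed.

Definition big_power (K v : R) : R := (if K < v then v `^ alpha else 0)%R.

Lemma measurable_big_power K : measurable_fun setT (big_power K).
Proof.
by apply: measurable_fun_ifT => //; exact: measurable_fun_ltr.
Qed.

(** The alpha-th power of the positive part has a tail of order e^(-cu), so its exponential moments
    below c are finite; c/2 leaves room. The integrand is dominated by a sum over unit layers of
    that power. *)
Lemma exp_power_moment : exists2 L : R, (0 < L)%R &
  \int[P]_w (expR (c / 2 * (Num.max (eta i0 w) 0) `^ alpha))%:E <= L%:E.
Proof.
have [t0 t00 tails] := tail_two_sided.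
(* The second summand extends the tail bound to all t >= 0: below [t0] it makes the right side at
   least 1. *)
pose C : R := (2 + expR (c * t0 `^ alpha))%R.
have mS t : measurable [set w | (t < eta i0 w)%R].
  have -> : [set w | (t < eta i0 w)%R] = eta i0 @^-1` `]t, +oo[.
    by apply/seteqP; split => w /=; rewrite in_itv/= andbT.
  exact: measurable_funPTI.
have C0 : (0 < C)%R by rewrite /C ltr_pwDl// expR_ge0.
have tailC t : (0 <= t)%R -> P [set w | (t < eta i0 w)%R] <= (C * expR (- (c * t `^ alpha)))%:E.
  move=> t0'; have [tt|tt] := leP t0 t.
    have /andP[_ h] := tails t tt; apply: le_trans h _.
    by rewrite lee_fin ler_wpM2r ?expR_ge0// lerDl expR_ge0.
  apply: le_trans (probability_le1 P (mS t)) _; rewrite lee_fin.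
  rewrite expRN ler_pdivlMr ?expR_gt0// mul1r.
  apply: (@le_trans _ _ (expR (c * t0 `^ alpha))); last by rewrite lerDr.
  rewrite ler_expR ler_pM2l//; apply: ge0_ler_powR; rewrite ?nnegrE//; try exact: ltW.
  exact: le_trans alpha1.
pose q : R := expR (- (c / 2)).
have q0 : (0 < q)%R by exact: expR_gt0.
have q1 : (q < 1)%R by rewrite /q expR_lt1 oppr_lt0 divr_gt0.
(* From e^(c (j+2) / 2) e^(-cj) = e^c q^j. *)
pose a : R := (expR c * C)%R.
have a0 : (0 < a)%R by rewrite mulr_gt0 ?expR_gt0.
pose term (j : nat) w : \bar R :=
  (expR (c / 2 * j.+2%:R))%:E * (\1_[set w | (j%:R `^ alpha^-1 < eta i0 w)%R] w)%:E.
have alpha0 : (0 < alpha)%R by exact: lt_le_trans alpha1.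
have term0 j w : 0 <= term j w by rewrite mule_ge0// lee_fin ?expR_ge0.
have mterm j : measurable_fun setT (term j).
  apply: emeasurable_funM; first exact: measurable_cst.
  exact/measurable_EFinP/measurable_indic.
exists (expR (c / 2) + a * (1 - q)^-1)%R.
  by rewrite addr_gt0 ?expR_gt0// mulr_gt0// invr_gt0 subr_gt0.
apply: (@le_trans _ _ (\int[P]_w ((expR (c / 2))%:E + \sum_(0 <= j <oo) term j w))).
  apply: ge0_le_integral => //.
  - apply/measurable_EFinP; apply: measurableT_comp => //; apply: measurable_funM => //.
    apply: (measurableT_comp (measurable_powR _)); exact: measurable_maxr.
  - apply: emeasurable_funD => //; exact: ge0_emeasurable_sum.
  move=> w _.
  set y := (Num.max (eta i0 w) 0 `^ alpha)%R.
  have y0 : (0 <= y)%R by exact: powR_ge0.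
  have S0 : 0 <= \sum_(0 <= j <oo) term j w by apply: nneseries_ge0.
  have [y1|y1] := leP y 1%R.
    apply: (@le_trans _ _ (expR (c / 2))%:E); last by rewrite leeDl.
    by rewrite lee_fin ler_expR -[leRHS]mulr1 ler_pM2l// divr_gt0.
  have eta0 : (0 < eta i0 w)%R.
    rewrite ltNge; apply/negP => e0; move: y1.
    by rewrite /y max_r// powR0 ?gt_eqF// ltNge ler01.
  have yE : y = (eta i0 w `^ alpha)%R by rewrite /y max_l// ltW.
  (* One below the integer part: the event in [term j] is strict, and j < y < j + 2 also holds for
     integer y. *)
  pose j := (Num.truncn y).-1.
  have jS : j.+1 = Num.truncn y by rewrite prednK// truncn_gt0 ltW.
  have /andP[jy yj] := truncn_itv y0.
  have termj : term j w = (expR (c / 2 * j.+2%:R))%:E.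
    rewrite /term indicE (_ : _ \in _) ?mule1//; apply/mem_set => /=.
    have -> : eta i0 w = (y `^ alpha^-1)%R.
      by rewrite yE -powRrM mulfV ?gt_eqF// powRr1// ltW.
    apply: gt0_ltr_powR; rewrite ?nnegrE ?invr_gt0//.
    by apply: lt_le_trans jy; rewrite ltr_nat -jS.
  apply: (@le_trans _ _ (term j w)).
    rewrite termj lee_fin ler_expR ler_pM2l ?divr_gt0//.
    by rewrite -/y ltW// jS.
  apply: (@le_trans _ _ (\sum_(0 <= k <oo) term k w)); last by rewrite leeDr// lee_fin expR_ge0.
  apply: le_trans (nneseries_lim_ge j.+1 _) => [|//].
  by rewrite big_nat_recr//= leeDr// sume_ge0.
have mS' : measurable_fun setT (fun w => \sum_(0 <= j <oo) term j w).
  exact: ge0_emeasurable_sum.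
rewrite ge0_integralD//; try by move=> w _; exact: nneseries_ge0.
rewrite (integral_prob_cst P) EFinD leeD2l// integral_nneseries//.
have termE j : \int[P]_w term j w <= (a * q ^+ j)%:E.
  rewrite ge0_integralZl ?lee_fin ?expR_ge0//; last first.
    exact/measurable_EFinP/measurable_indic.
  rewrite integral_indic// setIT.
  apply: le_trans (lee_wpmul2l _ (tailC _ (powR_ge0 _ _))) _; first by rewrite lee_fin expR_ge0.
  rewrite -powRrM mulVf ?gt_eqF// powRr1// -EFinM lee_fin.
  have -> : (a * q ^+ j = C * expR (c - c / 2 * j%:R))%R.
    by rewrite expRD /a /q -expRM_natr mulNr mulrAC mulrC.
  rewrite mulrCA -expRD ler_wpM2l ?(ltW C0)// ler_expR.
  have -> : (j.+2%:R = j%:R + 2 :> R)%R by rewrite -!natr1; lra.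
  by lra.
apply: (@le_trans _ _ (\sum_(0 <= j <oo) (a * q ^+ j)%:E)).
  by apply: lee_nneseries => [j _ _|j _]; [apply: integral_ge0|exact: termE].
apply: lime_le.
  by apply: is_cvg_nneseries => n _ _; rewrite lee_fin mulr_ge0// ?exprn_ge0// ltW.
apply: nearW => n.
rewrite sumEFin lee_fin -mulr_sumr ler_wpM2l ?(ltW a0)//.
rewrite -[leRHS]mul1r ler_pdivlMr ?subr_gt0// big_mkord.
have := subrX1 q n; have : (0 <= q ^+ n)%R by rewrite exprn_ge0// ltW.
by set s := (\sum_(i < n) _)%R; lra.
Qed.

End scenery_tails.

(** * Sums of the scenery over many sites *)

Section scenery_sums.
Context (R : realType) (dE : measure_display) (E : measurableType dE)
  (P : probability E R) (I : choiceType) (eta : I -> {RV P >-> R}) (i0 : I).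
Hypotheses (iid_eta : iid eta) (sym_eta : symmetric_law (eta i0)).
Local Open Scope ereal_scope.

(** Where eta > K, the exponential at c/4 is at most e^(-c K^alpha / 4) times the one at c/2, so a
    site contributes only a factor 1 + L e^(-c K^alpha / 4). The number of sites then does no harm
    once K is a power of n. *)
Lemma big_power_sum_tail (alpha c : R) : (1 <= alpha)%R -> (0 < c)%R ->
  asymptotic (fun t => fine (P [set w | (t < eta i0 w)%R]))
             (fun t => expR (- (c * t `^ alpha))) ->
  exists2 L : R, (0 < L)%R & forall (K u : R) (B : seq I), (0 <= K)%R -> uniq B ->
  P [set w | (u <= \sum_(z <- B) big_power alpha K (eta z w))%R] <=
    (expR (- (c / 4 * u) + (size B)%:R * (L * expR (- (c / 4 * K `^ alpha)))))%:E.
Proof.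
move=> alpha1 c0 tail_eta.
have [L L0 hL] := exp_power_moment alpha1 c0 tail_eta.
exists L => // K u B K0 uB.
have mb := measurable_big_power alpha K.
have c4 : (0 <= c / 4)%R by rewrite divr_ge0// ltW.
have mY : measurable_fun setT (fun w => \sum_(z <- B) big_power alpha K (eta z w))%R.
  by apply: measurable_sum => z; exact: measurableT_comp.
apply: le_trans (exp_markov P u mY c4) _.
rewrite expRD EFinM; apply: lee_wpmul2l; first by rewrite lee_fin expR_ge0.
pose h (z : I) v := expR (c / 4 * big_power alpha K v).
have mh z : measurable_fun setT (h z).
  by apply: measurableT_comp => //; exact: measurable_funM.
have [_ hE] := @independent_off_prod _ _ _ _ _ _ _ eta iid_eta.1 h B mh
  (fun z t => expR_ge0 _) uB.
rewrite (_ : \int[P]_w _ = \int[P]_w (\prod_(z <- B) h z (eta z w))%:E); last first.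
  by apply: eq_integral => w _; congr _%:E; rewrite mulr_sumr expR_sum.
rewrite hE mulr_natl -(count_predT B) -iter_addr_0 -big_const_seq expR_sum -prodEFin.
suff /andP[] : 0 <= \prod_(z <- B) \int[P]_w (h z (eta z w))%:E <=
  \prod_(z <- B) (expR (L * expR (- (c / 4 * K `^ alpha))))%:E by [].
elim/big_ind2 : _ => [|x1 x2 y1 y2 /andP[x10 x12] /andP[y10 y12]|z _].
- by rewrite lee01 lexx.
- by rewrite mule_ge0// lee_pmul.
apply/andP; split; first by apply: integral_ge0 => w _; rewrite lee_fin expR_ge0.
have mhE : measurable_fun setT (fun v => (h z v)%:E : \bar R) by apply/measurable_EFinP.
rewrite (integral_identical i0 iid_eta z mhE); last by move=> v; rewrite lee_fin expR_ge0.
pose g w := expR (c / 2 * (Num.max (eta i0 w) 0) `^ alpha)%R.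
have mg : measurable_fun setT (fun w => (g w)%:E : \bar R).
  apply/measurable_EFinP; apply: measurableT_comp => //; apply: measurable_funM => //.
  apply: (measurableT_comp (measurable_powR _)); exact: measurable_maxr.
pose q := expR (- (c / 4 * K `^ alpha)).
have q0 : (0 <= q)%R by exact: expR_ge0.
apply: (@le_trans _ _ (\int[P]_w (1 + q%:E * (g w)%:E))).
  apply: ge0_le_integral => //.
  - by move=> w _; rewrite lee_fin expR_ge0.
  - exact: (measurableT_comp mhE).
  - by apply: emeasurable_funD => //; apply: emeasurable_funM.
  move=> w _; rewrite -EFinM -EFinD lee_fin /h /big_power.
  have qg0 : (0 <= q * g w)%R by rewrite mulr_ge0// expR_ge0.
  case: ifPn => [Kw|_]; last by rewrite mulr0 expR0 lerDl.
  apply: (@le_trans _ _ (q * g w)%R); last by rewrite lerDr.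
  rewrite /q /g -expRD ler_expR max_l; last by rewrite ltW// (le_lt_trans K0).
  have : (K `^ alpha <= eta i0 w `^ alpha)%R.
    apply: ge0_ler_powR; rewrite ?nnegrE//; try exact: ltW.
    - exact: le_trans alpha1.
    - by rewrite ltW// (le_lt_trans K0).
  by move=> h1; have := ler_wpM2l c4 h1; lra.
rewrite ge0_integralD//; last 2 first.
- by move=> w _; rewrite -EFinM lee_fin mulr_ge0// expR_ge0.
- exact: emeasurable_funM.
rewrite (integral_prob_cst P) ge0_integralZl//; last by move=> w _; rewrite lee_fin expR_ge0.
apply: (@le_trans _ _ (1 + q%:E * L%:E)).
  by rewrite leeD2l//; apply: lee_wpmul2l; rewrite ?lee_fin.
by rewrite -EFinM -EFinD lee_fin mulrC; exact: expR_ge1Dx.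
Qed.

Definition scenery_lin (a : I -> R) (B : seq I) (w : E) : R := (\sum_(z <- B) a z * eta z w)%R.

Lemma scenery_lin_symmetric (a : I -> R) (B : seq I) : uniq B ->
  independent_off eta (scenery_lin a B) [in B] /\
  forall C, measurable C ->
    P (scenery_lin a B @^-1` C) = P ((fun w => - scenery_lin a B w)%R @^-1` C).
Proof.
elim: B => [|i B IH] /=.
  move=> _; split; first by rewrite (_ : scenery_lin _ _ = fun=> 0%R);
    [exact: (independent_off_cst iid_eta.1)|apply/funext => w; rewrite /scenery_lin big_nil].
  move=> C mC; congr (P _); apply/seteqP.
  by split => w /=; rewrite /scenery_lin big_nil oppr0.
case/andP=> iB uB; have {IH} [indY symY] := IH uB.
pose phi (u : R * R) := (u.1 + a i * u.2)%R.
have mphi : measurable_fun setT phi.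
  apply: measurable_funD; first exact: measurable_fst.
  by apply: measurable_funM => //; exact: measurable_snd.
have EY : scenery_lin a (i :: B) = fun w => phi (scenery_lin a B w, eta i w).
  by apply/funext => w; rewrite /scenery_lin big_cons addrC.
split; first by rewrite EY; exact: (independent_off_step iid_eta.1 indY iB mphi).
move=> C mC.
have [mY _] := indY.
have mYN : measurable_fun setT (fun w => - scenery_lin a B w)%R by exact: measurableT_comp.
have mZ : measurable_fun setT (fun w => (scenery_lin a B w, eta i w)) by exact/measurable_fun_pair.
have mZN : measurable_fun setT (fun w => (- scenery_lin a B w, - eta i w)%R).
  by apply/measurable_fun_pair => //=; exact: measurableT_comp.
pose Y : {mfun E >-> R} := HB.pack (scenery_lin a B) (isMeasurableFun.Build _ _ _ _ _ mY).
pose Z : {mfun E >-> (R * R)%type} :=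
  HB.pack (fun w => (scenery_lin a B w, eta i w)) (isMeasurableFun.Build _ _ _ _ _ mZ).
pose ZN : {mfun E >-> (R * R)%type} :=
  HB.pack (fun w => (- scenery_lin a B w, - eta i w)%R) (isMeasurableFun.Build _ _ _ _ _ mZN).
have symi (D : set R) : measurable D -> P (eta i @^-1` (-%R @^-1` D)) = P (eta i @^-1` D).
  move=> mD; have mND : measurable (-%R @^-1` D : set R).
    by rewrite -[_ @^-1` _]setTI; exact: oppr_measurable.
  have := iid_eta.2 i i0 _ mND; rewrite /distribution /pushforward => ->.
  by have := iid_eta.2 i i0 _ mD; rewrite /distribution /pushforward => ->; exact: sym_eta.
have h1 := @product_measure_unique _ _ _ _ _ (distribution P Y) (distribution P (eta i)) (distribution P Z).
have h2 := @product_measure_unique _ _ _ _ _ (distribution P Y) (distribution P (eta i)) (distribution P ZN).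
pose A := phi @^-1` C.
have mA : measurable A by rewrite -[A]setTI; exact: mphi.
have -> : P (scenery_lin a (i :: B) @^-1` C) = distribution P Z A.
  by rewrite EY.
have -> : P ((fun w => - scenery_lin a (i :: B) w)%R @^-1` C) = distribution P ZN A.
  congr (P _); apply/seteqP; split => w /=; rewrite /A /phi /= EY /phi /=;
  by rewrite mulrN opprD.
transitivity ((distribution P Y \x distribution P (eta i)) A).
  apply/esym/h1 => // D F mD mF; exact: (independent_off2 indY iB).
apply: h2 => // D F mD mF.
have mND : measurable (-%R @^-1` D : set R) by rewrite -[_ @^-1` _]setTI; exact: oppr_measurable.
have mNF : measurable (-%R @^-1` F : set R) by rewrite -[_ @^-1` _]setTI; exact: oppr_measurable.
transitivity (P (scenery_lin a B @^-1` (-%R @^-1` D)) * P (eta i @^-1` (-%R @^-1` F))).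
  exact: (independent_off2 indY iB).
by rewrite symi// symY//; congr (P _ * _); apply/seteqP; split => w /=; rewrite opprK.
Qed.

(** By symmetry the sum over the other sites is nonnegative with probability at least 1/2, and it is
    independent of [eta z]. *)
Lemma scenery_lin_ge0 (a : I -> R) (B : seq I) (z : I) (v : R) : uniq B -> z \notin B ->
  (2^-1)%:E * P [set w | (v < eta z w)%R] <=
    P [set w | (v < eta z w)%R /\ (0 <= scenery_lin a B w)%R].
Proof.
move=> uB zB; have [indY symY] := scenery_lin_symmetric a uB.
pose C : set R := `[0%R, +oo[%classic.
pose D : set R := `]v, +oo[%classic.
have mC : measurable C by exact: measurable_itv.
have mD : measurable D by exact: measurable_itv.
have -> : [set w | (v < eta z w)%R /\ (0 <= scenery_lin a B w)%R] =
    scenery_lin a B @^-1` C `&` eta z @^-1` D.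
  apply/seteqP; split => w /=; rewrite /C /D /= !in_itv /= !andbT; by case.
have -> : [set w | (v < eta z w)%R] = eta z @^-1` D.
  by apply/seteqP; split => w; rewrite /D /= in_itv/= andbT.
rewrite (independent_off2 indY zB)//; apply: lee_wpmul2r => //.
have [mY _] := indY.
have mYC : measurable (scenery_lin a B @^-1` C) by rewrite -[_ @^-1` _]setTI; exact: mY.
have mYN : measurable ((fun w => - scenery_lin a B w)%R @^-1` C).
  by rewrite -[_ @^-1` _]setTI; apply: (measurableT_comp _ mY).
have : 1 <= P (scenery_lin a B @^-1` C) + P ((fun w => - scenery_lin a B w)%R @^-1` C).
  rewrite -(probability_setT P).
  apply: le_trans (measureU2 _ mYC mYN); apply: le_measure; rewrite ?inE//.
    exact: measurableU.
  move=> w _; rewrite /C /=; have [h|h] := leP 0%R (scenery_lin a B w).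
    by left; rewrite /= in_itv /= h.
  by right; rewrite /= in_itv /= oppr_ge0 ltW.
rewrite -symY//.
case: (P (scenery_lin a B @^-1` C)) => [r||]//; last by move=> _; exact: leey.
by rewrite -EFinD !lee_fin; lra.
Qed.

End scenery_sums.

(** * Bounds for fixed parameters *)

Section product_bounds.
Context (R : realType) (dW dE : measure_display) (W : measurableType dW)
  (E : measurableType dE) (P0 : probability W R) (P1 : probability E R).
Local Open Scope ereal_scope.

Lemma product_measure_ge (A : set (W * E)) (C : set W) (b : R) : measurable A ->
  measurable C -> (0 <= b)%R ->
  (forall w, C w -> b%:E <= P1 [set e | A (w, e)]) ->
  b%:E * P0 C <= (P0 \x P1) A.
Proof.
move=> mA mC b0 bC; rewrite /product_measure1.
rewrite -[C in P0 C]setIT -integral_indic// -ge0_integralZl//; last first.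
  exact/measurable_EFinP/measurable_indic.
apply: ge0_le_integral => //.
- by move=> w _; rewrite mule_ge0// lee_fin.
- by apply: emeasurable_funM => //; exact/measurable_EFinP/measurable_indic.
- exact: measurable_fun_xsection.
move=> w _ /=; have -> : xsection A w = [set e | A (w, e)].
  by apply/seteqP; split => e /=; rewrite /xsection /= inE.
rewrite indicE; case: (boolP (w \in C)) => [/set_mem /bC|_]; first by rewrite mule1.
by rewrite mule0.
Qed.

Lemma product_measure_le (A : set (W * E)) (b : R) : measurable A ->
  (forall w, P1 [set e | A (w, e)] <= b%:E) -> (P0 \x P1) A <= b%:E.
Proof.
move=> mA Ab; rewrite /product_measure1.
rewrite -[leRHS](integral_prob_cst P0).
apply: ge0_le_integral => //; first exact: measurable_fun_xsection.
move=> w _ /=; apply: le_trans (Ab w); rewrite le_eqVlt; apply/orP; left; apply/eqP.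
by congr (P1 _); apply/seteqP; split => e /=; rewrite /xsection /= inE.
Qed.

(** The walk is integrated first, for a fixed scenery, and the bad sceneries [D] are paid for
    separately. *)
Lemma product_measure_le_swap (A : set (W * E)) (D : set E) (b : R) : measurable A ->
  measurable D -> (0 <= b)%R ->
  (forall e, ~ D e -> P0 [set w | A (w, e)] <= b%:E) ->
  (P0 \x P1) A <= P1 D + b%:E.
Proof.
move=> mA mD b0 Ab.
have -> : (P0 \x P1) A = \int[P1]_e P0 (ysection A e).
  have -> : (P0 \x P1) A = (P0 \x^ P1) A.
    by apply: product_measure_unique => // B C mB mC; exact: product_measure2E.
  by [].
rewrite -[b%:E](integral_prob_cst P1) -[D in P1 D]setIT -integral_indic//.
have mI : measurable_fun setT (fun e => (\1_D e)%:E : \bar R).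
  exact/measurable_EFinP/measurable_indic.
rewrite -ge0_integralD//.
apply: ge0_le_integral => //.
- exact: measurable_fun_ysection.
- exact: emeasurable_funD.
move=> e _ /=; have -> : ysection A e = [set w | A (w, e)].
  by apply/seteqP; split => w /=; rewrite /ysection /= inE.
rewrite indicE; case: (boolP (e \in D)) => [eD|/negP eD]; last first.
  by rewrite add0e; apply: Ab => De; apply: eD; exact/mem_set.
apply: (@le_trans _ _ 1); last by rewrite leeDl// lee_fin.
apply: probability_le1.
have := measurable_ysection e mA; congr (measurable _).
by apply/seteqP; split => w /=; rewrite /ysection /= inE.
Qed.

End product_bounds.

Section path_sums.
Context (R : realType) (T : eqType).

Lemma sum_count (s : seq T) (F : T -> R) :
  \sum_(x <- s) F x = \sum_(x <- undup s) (count_mem x s)%:R * F x.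
Proof.
rewrite -big_undup_iterop_count; apply: eq_bigr => x _.
by rewrite Monoid.iteropE iter_addr_0 mulr_natl.
Qed.

Lemma sum_count_size (s : seq T) : \sum_(x <- undup s) (count_mem x s)%:R = (size s)%:R :> R.
Proof.
transitivity (\sum_(x <- undup s) (count_mem x s)%:R * 1 : R).
  by apply: eq_bigr => x _; rewrite mulr1.
by rewrite -(sum_count s (fun=> 1)) big_const_seq count_predT iter_addr_0.
Qed.

End path_sums.

(** * Lower bound at fixed n *)

Section lower_bound.
Context (R : realType) (d : nat) (dW : measure_display) (W : measurableType dW)
  (P0 : probability W R) (xi : nat -> {RV P0 >-> zlattice d}).
Hypotheses (iid_xi : iid xi).
Local Open Scope ereal_scope.

Lemma walk_repeat_cycle (s : seq (zlattice d)) (mu : R) (N : nat) :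
  (0 <= mu)%R -> (forall a, a \in s -> mu%:E <= P0 (xi 0%N @^-1` [set a])) ->
  (0 < size s)%N ->
  exists C : set W, [/\ measurable C, (mu ^+ (N * size s))%:E <= P0 C &
    forall w, C w -> forall j, (j < N * size s)%N -> xi j w = nth 0%R s (j %% size s)].
Proof.
move=> mu0 mus s0; set m := size s.
pose B (j : nat) : set (zlattice d) := [set nth 0%R s (j %% m)].
pose J : {fset nat} := [fset j in iota 0 (N * m)]%fset.
exists (\bigcap_(j in [set` J]) (xi j @^-1` B j)); split.
- exact: measurable_fset_bigcap.
- rewrite iid_xi.1//.
  have -> : (mu ^+ (N * m))%:E = \prod_(j <- J) mu%:E.
    rewrite prodEFin big_const_seq count_predT.
    have -> : size J = (N * m)%N.
      by rewrite -[LHS]/(#|` J|)%fset card_fseq undup_id ?iota_uniq// size_iota.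
    by rewrite -Monoid.iteropE.
  suff /andP[] : 0 <= \prod_(j <- J) mu%:E <= \prod_(j <- J) P0 (xi j @^-1` B j) by [].
  elim/big_ind2 : _ => [|x1 x2 y1 y2 /andP[x10 x12] /andP[y10 y12]|j _].
  - by rewrite lee01 lexx.
  - by rewrite mule_ge0// lee_pmul.
  rewrite lee_fin mu0/=; have -> : P0 (xi j @^-1` B j) = P0 (xi 0%N @^-1` B j).
    by have := iid_xi.2 j 0%N (B j); apply.
  by apply: mus; rewrite mem_nth// ltn_mod.
- move=> w Cw j jN; have := Cw j; apply; rewrite /= !inE mem_iota add0n.
  by rewrite jN.
Qed.

End lower_bound.

Section lower_bound_finite.
Context (R : realType) (d : nat) (dW dE : measure_display) (W : measurableType dW)
  (E : measurableType dE) (P0 : probability W R) (Peta : probability E R)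
  (xi : nat -> {RV P0 >-> zlattice d}) (eta : zlattice d -> {RV Peta >-> R}).
Hypotheses (iid_xi : iid xi) (iid_eta : iid eta) (sym_eta : symmetric_law (eta 0)).

Definition path_sum (s : seq (zlattice d)) (e : E) : R := \sum_(x <- s) eta x e.

Lemma scenery_sumE n we : scenery_sum xi eta n we = path_sum (walk_path xi n we.1) we.2.
Proof.
rewrite /path_sum /walk_path big_map -[iota 0 n.+1]/(index_iota 0 n.+1).
by rewrite big_mkord.
Qed.

Lemma measurable_path_sum s : measurable_fun setT (path_sum s).
Proof. by apply: measurable_sum => x. Qed.

Lemma measurable_scenery_sum_ge n (t : R) :
  measurable [set we | t <= scenery_sum xi eta n we].
Proof.
rewrite (_ : [set _ | _] = [set we | t <= path_sum (walk_path xi n we.1) we.2]).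
  apply: (measurable_walk_path_prod iid_xi n (Q := fun s => [set e | t <= path_sum s e])).
  by move=> s; exact: (measurable_superlevel t (measurable_path_sum s)).
by apply/seteqP; split => we /=; rewrite scenery_sumE.
Qed.

Lemma count_cycle_returns (s : seq (zlattice d)) (N n : nat) w : (0 < size s)%N ->
  \sum_(a <- s) a = 0 ->
  (forall j, (j < N * size s)%N -> xi j w = nth 0 s (j %% size s)) ->
  (N * size s <= n)%N -> (N <= count_mem 0%R (walk_path xi n w))%N.
Proof.
move=> s0 sum0 xis Nn; set m := size s in s0 xis Nn *.
have walk0 i : (i <= N)%N -> walk xi (i * m) w = 0.
  elim: i => [|i IH] iN; first by rewrite mul0n /walk big_ord0.
  have -> : walk xi (i.+1 * m) w =
      walk xi (i * m) w + \sum_(0 <= j < m) xi (i * m + j)%N w.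
    rewrite /walk -(big_mkord predT (fun j => xi j w)) -(big_mkord predT (fun j => xi j w)).
    have -> : (i.+1 * m = i * m + m)%N by rewrite mulSn addnC.
    rewrite (@big_cat_nat _ _ _ (i * m)) ?leq_addr//=; congr (_ + _).
    rewrite -{1}[(i * m)%N]add0n big_addn addKn.
    by apply: eq_bigr => j _; rewrite addnC.
  rewrite (IH (ltnW iN)) add0r.
  transitivity (\sum_(a <- s) a); last exact: sum0.
  rewrite (big_nth (0 : zlattice d)).
  apply: eq_big_nat => j /andP[_ jm].
  rewrite xis; first by rewrite modnMDl modn_small.
  apply: (@leq_trans (i.+1 * m)); first by rewrite mulSn addnC ltn_add2r.
  by rewrite leq_mul2r iN orbT.
rewrite count_map -size_filter.
(* The times i m with i < N are N distinct visits to the origin. *)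
rewrite -[X in (X <= _)%N](size_iota 0) -(size_map (fun i => (i * m)%N)).
apply: uniq_leq_size.
  rewrite map_inj_uniq ?iota_uniq// => i j /eqP.
  by rewrite eqn_mul2r gtn_eqF// => /eqP.
move=> k /mapP[i]; rewrite mem_iota add0n => /andP[_ iN] ->.
have iN' := ltnW iN.
rewrite mem_filter mem_iota /= walk0// eqxx add0n ltnS andTb.
by rewrite (leq_trans _ Nn)// leq_mul2r iN' orbT.
Qed.

Lemma scenery_lower_finite (s : seq (zlattice d)) (mu : R) (N n : nat) (t v : R) :
  0 <= mu -> (forall a, a \in s -> (mu%:E <= P0 (xi 0%N @^-1` [set a]))%E) ->
  (0 < size s)%N -> \sum_(a <- s) a = 0 -> (N * size s <= n)%N -> (0 < N)%N ->
  0 <= v -> t <= N%:R * v ->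
  ((2^-1)%:E * Peta [set e | (v < eta 0 e)%R] * (mu ^+ (N * size s))%:E <=
    (P0 \x Peta) [set we | (t <= scenery_sum xi eta n we)%R])%E.
Proof.
move=> mu0 mus s0 sum0 Nn N0 v0 tNv.
have [C [mC PC Cxi]] := walk_repeat_cycle iid_xi N mu0 mus s0.
have mS : measurable [set e | v < eta 0 e].
  have -> : [set e | v < eta 0 e] = eta 0 @^-1` `]v, +oo[.
    by apply/seteqP; split => w /=; rewrite in_itv/= andbT.
  exact: measurable_funPTI.
pose b := 2^-1 * fine (Peta [set e | v < eta 0 e]).
have b0 : 0 <= b by rewrite mulr_ge0 ?invr_ge0// fine_ge0.
have bE : ((2^-1)%:E * Peta [set e | (v < eta 0 e)%R] = b%:E)%E.
  by rewrite EFinM fineK// fin_num_measure.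
rewrite bE; apply: le_trans (lee_wpmul2l _ PC) _; first by rewrite lee_fin.
apply: product_measure_ge => //; first exact: measurable_scenery_sum_ge.
move=> w Cw; rewrite -bE.
pose p := walk_path xi n w.
have cnt : (N <= count_mem 0%R p)%N by exact: (count_cycle_returns s0 sum0 (Cxi w Cw) Nn).
(* The visited sites other than the origin, to be weighted by their local times. *)
pose B := rem 0 (undup p).
have uB : uniq B by rewrite rem_uniq ?undup_uniq.
have zB : 0 \notin B by rewrite mem_rem_uniq ?undup_uniq// !inE eqxx.
pose a x : R := (count_mem x p)%:R.
apply: le_trans (scenery_lin_ge0 iid_eta sym_eta a v uB zB) _.
have [_ symY] := scenery_lin_symmetric iid_eta sym_eta a uB.
have [[mY _] _] := scenery_lin_symmetric iid_eta sym_eta a uB.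
apply: le_measure; rewrite ?inE.
- have -> : [set w0 | v < eta 0 w0 /\ 0 <= scenery_lin eta a B w0] =
      [set e | v < eta 0 e] `&` [set e | 0 <= scenery_lin eta a B e] by [].
  by apply: measurableI => //; exact: measurable_superlevel.
- have -> : [set e | [set we | t <= scenery_sum xi eta n we] (w, e)] =
      [set e | t <= path_sum p e].
    by apply/seteqP; split => e /=; rewrite scenery_sumE.
  exact: (measurable_superlevel t (measurable_path_sum p)).
move=> e /= [ve Y0]; rewrite scenery_sumE /= -/p.
have p0 : 0 \in undup p by rewrite mem_undup -has_pred1 has_count (leq_trans N0 cnt).
have -> : path_sum p e = a 0 * eta 0 e + scenery_lin eta a B e.
  by rewrite /path_sum sum_count (big_rem _ p0).
apply: (le_trans tNv); rewrite -[leLHS]addr0; apply: lerD => //.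
apply: ler_pM => //; [by rewrite ler_nat|exact: ltW].
Qed.

End lower_bound_finite.

(** * Upper bound at fixed n *)

Section upper_bound_finite.
Context (R : realType) (d : nat) (dW dE : measure_display) (W : measurableType dW)
  (E : measurableType dE) (P0 : probability W R) (Peta : probability E R)
  (xi : nat -> {RV P0 >-> zlattice d}) (eta : zlattice d -> {RV Peta >-> R}).
Hypotheses (iid_xi : iid xi) (iid_eta : iid eta) (sym_eta : symmetric_law (eta 0)).

Definition big_part (B : seq (zlattice d)) (K : R) (e : E) (x : zlattice d) : R :=
  if (x \in B) && (K < eta x e) then eta x e else 0.

Definition low_count (s : seq (zlattice d)) (L : R) (x : zlattice d) : R :=
  if (count_mem x s)%:R <= L then (count_mem x s)%:R else 0.

(** It is summed along the path, not over distinct sites, and then gives the time spent at sites of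
    high local time. *)
Definition high_site (s : seq (zlattice d)) (L : R) (x : zlattice d) : R :=
  if L < (count_mem x s)%:R then 1 else 0.

Lemma path_sum_split (s B : seq (zlattice d)) (K L t : R) (e : E) : 0 <= K ->
  all [in B] s -> t <= path_sum eta s e ->
  [\/ t / 3 <= \sum_(x <- s) big_part B K e x,
      t / 3 <= \sum_(x <- undup s) low_count s L x * trunc_val K (eta x e) |
      t / 3 <= K * \sum_(x <- s) high_site s L x].
Proof.
move=> K0 /allP sB ts.
(* Values below -K are replaced by 0, which can only raise the sum. *)
have h1 : path_sum eta s e <=
    \sum_(x <- s) big_part B K e x + \sum_(x <- s) trunc_val K (eta x e).
  rewrite -big_split /path_sum big_seq [leRHS]big_seq; apply: ler_sum => x xs.
  rewrite /big_part (sB x xs : x \in B) /= /trunc_val.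
  case: ifPn => [Kx|]; first by rewrite lerDl; case: ifP => // _; lra.
  rewrite -leNgt => xK; rewrite add0r; case: ifPn => // nx.
  by move: nx; rewrite ler_norml xK andbT -ltNge; lra.
have h2 : \sum_(x <- s) trunc_val K (eta x e) <=
    \sum_(x <- undup s) low_count s L x * trunc_val K (eta x e) +
    K * \sum_(x <- s) high_site s L x.
  rewrite sum_count (sum_count s (high_site s L)) mulr_sumr -big_split.
  apply: ler_sum => x _; rewrite /low_count /high_site.
  have tK : trunc_val K (eta x e) <= K.
    by rewrite /trunc_val; case: ifP => //; rewrite ler_norml => /andP[].
  case: (leP (count_mem x s)%:R L) => _; first by rewrite /= !mulr0 addr0.
  by rewrite /= mul0r add0r mulr1 mulrC ler_wpM2r.
have [c1|c1] := leP (t / 3) (\sum_(x <- s) big_part B K e x); first by constructor 1.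
have [c2|c2] := leP (t / 3) (\sum_(x <- undup s) low_count s L x * trunc_val K (eta x e)).
  by constructor 2.
by constructor 3; lra.
Qed.

Lemma low_count_sqr_sum (s : seq (zlattice d)) (L : R) : 0 <= L ->
  \sum_(x <- undup s) low_count s L x ^+ 2 <= L * (size s)%:R.
Proof.
move=> L0; rewrite -(sum_count_size R s) mulr_sumr; apply: ler_sum => x _.
rewrite /low_count; case: ifPn => [cL|_]; first by rewrite expr2 ler_wpM2r.
by rewrite expr0n mulr_ge0.
Qed.

(** More than V sites of local time above L would need more than V L visits. Candidate lists are
    functions into the indices of B, |B|^V in number; repetitions and irrelevant sites are
    harmless. *)
Lemma high_site_cover (s B : seq (zlattice d)) (L : R) (V : nat) : 0 < L ->
  all [in B] s -> (0 < size B)%N -> (size s)%:R <= V%:R * L ->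
  exists f : {ffun 'I_V -> 'I_(size B)}, forall x, x \in s -> L < (count_mem x s)%:R ->
    x \in [seq nth 0 B (f i) | i <- enum 'I_V].
Proof.
move=> L0 /allP sB B0 sV.
pose H := [seq x <- undup s | L < (count_mem x s)%:R].
have HV : (size H <= V)%N.
  rewrite -(ler_nat R) -(ler_pM2r L0); apply: le_trans sV.
  rewrite -(sum_count_size R s) size_filter -sum1_count natr_sum mulr_suml big_mkcond.
  apply: ler_sum => x _; case: ifP => // /ltW.
  by rewrite mul1r.
have HB x : x \in H -> (index x B < size B)%N.
  by rewrite mem_filter mem_undup index_mem => /andP[_ /sB].
pose g (i : nat) : 'I_(size B) := if insub (index (nth 0 H i) B) is Some j then j else Ordinal B0.
exists [ffun i : 'I_V => g i] => x xs Lx.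
have xH : x \in H by rewrite mem_filter Lx mem_undup.
have iV : (index x H < V)%N by apply: leq_trans HV; rewrite index_mem.
apply/mapP; exists (Ordinal iV); first by rewrite mem_enum.
rewrite ffunE /g /= nth_index//; case: insubP => [j _ ->|].
  by rewrite nth_index//; exact: sB.
by rewrite HB.
Qed.

Lemma walk_path_sum (f : zlattice d -> R) n w :
  \sum_(x <- walk_path xi n w) f x = \sum_(k < n.+1) f (walk xi k w).
Proof.
rewrite /walk_path big_map -[iota 0 n.+1]/(index_iota 0 n.+1).
by rewrite big_mkord.
Qed.

Lemma measurable_walk_functional (f : zlattice d -> R) n :
  measurable_fun setT (fun w => \sum_(k < n) f (walk xi k w)).
Proof.
apply: measurable_sum => k.
exact: (measurableT_comp (measurable_fun_zlattice f) (measurable_walk iid_xi k)).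
Qed.

Local Open Scope ereal_scope.

(** For one candidate list, the time spent there is the functional of an indicator of l^b mass at
    most V; the union bound over lists adds the factor |B|^V. *)
Lemma high_site_tail (b c : R) : (0 < b)%R ->
  (forall n (f : zlattice d -> R) (B : seq (zlattice d)) (F t : R),
    uniq B -> (forall z, 0 <= f z)%R -> (forall z, z \notin B -> f z = 0%R) ->
    (0 < F)%R -> (\sum_(z <- B) f z `^ b <= F)%R -> (0 <= t)%R ->
    P0 [set w | (t <= \sum_(k < n) f (walk xi k w))%R] <=
      (2 * expR (- (c * t / F `^ b^-1)))%:E) ->
  forall n (B : seq (zlattice d)) (L t : R) (V : nat), (0 < L)%R -> (0 < size B)%N ->
  (0 < V)%N -> (n.+1%:R <= V%:R * L)%R -> (0 <= t)%R ->
  P0 [set w | all [in B] (walk_path xi n w) /\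
     (t <= \sum_(x <- walk_path xi n w) high_site (walk_path xi n w) L x)%R] <=
  ((size B)%:R ^+ V * (2 * expR (- (c * t / V%:R `^ b^-1))))%:E.
Proof.
move=> b0 tail n B L t V L0 B0 V0 nV t0.
pose D (f : {ffun 'I_V -> 'I_(size B)}) : seq (zlattice d) :=
  undup [seq nth 0%R B (f i) | i <- enum 'I_V].
pose ind f (x : zlattice d) : R := if x \in D f then 1%R else 0%R.
pose A f := [set w | (t <= \sum_(k < n.+1) ind f (walk xi k w))%R].
apply: (@le_trans _ _ (\sum_f P0 (A f))).
  apply: union_bound => [f||w [sB tw]].
  - exact: (measurable_superlevel t (measurable_walk_functional (ind f) n.+1)).
  - exact: (measurable_walk_path iid_xi n (fun s => all [in B] s /\
      (t <= \sum_(x <- s) high_site s L x)%R)).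
  have [|f Hf] := @high_site_cover _ _ _ V L0 sB B0; first by rewrite size_walk_path.
  exists f; rewrite /A /= -walk_path_sum; apply: (le_trans tw).
  rewrite big_seq [leRHS]big_seq; apply: ler_sum => x xs.
  rewrite /high_site /ind; case: ifPn => [Lx|_]; last by case: ifP.
  by rewrite mem_undup Hf.
apply: (@le_trans _ _ (\sum_(f : {ffun 'I_V -> 'I_(size B)})
    (2 * expR (- (c * t / V%:R `^ b^-1)))%:E)).
  apply: lee_sum => f _; apply: (tail n.+1 (ind f) (D f)) => //.
  - exact: undup_uniq.
  - by move=> z; rewrite /ind; case: ifP.
  - by move=> z zD; rewrite /ind (negbTE zD).
  - by rewrite ltr0n.
  rewrite big_seq (eq_bigr (fun=> 1%R)) => [|z zD]; last by rewrite /ind zD powR1.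
  rewrite -big_seq big_const_seq count_predT iter_addr_0 ler_nat.
  by apply: leq_trans (size_undup _) _; rewrite size_map size_enum_ord.
by rewrite sumEFin lee_fin sumr_const card_ffun !card_ord -[leLHS]mulr_natl natrX.
Qed.

(** The order of integration varies: for large values and for sites of high local time the scenery
    is fixed and the walk supplies the bound, while for truncated values at the other sites the walk
    is fixed and the scenery does. *)
Lemma scenery_upper_finite (alpha b ca cb ce L : R) : (1 <= alpha)%R -> (0 < b)%R ->
  (forall n (f : zlattice d -> R) (B : seq (zlattice d)) (F t : R),
    uniq B -> (forall z, 0 <= f z)%R -> (forall z, z \notin B -> f z = 0%R) ->
    (0 < F)%R -> (\sum_(z <- B) f z `^ alpha <= F)%R -> (0 <= t)%R ->
    P0 [set w | (t <= \sum_(k < n) f (walk xi k w))%R] <=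
      (2 * expR (- (ca * t / F `^ alpha^-1)))%:E) ->
  (forall n (f : zlattice d -> R) (B : seq (zlattice d)) (F t : R),
    uniq B -> (forall z, 0 <= f z)%R -> (forall z, z \notin B -> f z = 0%R) ->
    (0 < F)%R -> (\sum_(z <- B) f z `^ b <= F)%R -> (0 <= t)%R ->
    P0 [set w | (t <= \sum_(k < n) f (walk xi k w))%R] <=
      (2 * expR (- (cb * t / F `^ b^-1)))%:E) ->
  (forall (K u : R) (B : seq (zlattice d)), (0 <= K)%R -> uniq B ->
    Peta [set w | (u <= \sum_(z <- B) big_power alpha K (eta z w))%R] <=
    (expR (- (ce / 4 * u) + (size B)%:R * (L * expR (- (ce / 4 * K `^ alpha)))))%:E) ->
  forall n (B : seq (zlattice d)) (p0 K L0 t u theta : R) (V : nat),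
  uniq B -> (0 < size B)%N ->
  P0 [set w | ~~ all [in B] (walk_path xi n w)] <= p0%:E ->
  (0 < K)%R -> (0 < L0)%R -> (0 <= t)%R -> (0 < u)%R -> (0 <= theta)%R ->
  (0 < V)%N -> (n.+1%:R <= V%:R * L0)%R ->
  (P0 \x Peta) [set we | (t <= scenery_sum xi eta n we)%R] <=
  (p0 + (expR (- (ce / 4 * u) + (size B)%:R * (L * expR (- (ce / 4 * K `^ alpha)))) +
      2 * expR (- (ca * (t / 3) / u `^ alpha^-1))) +
    expR (- (theta * (t / 3)) + 2 * (theta * K) ^+ 2 * (L0 * n.+1%:R)) +
    (size B)%:R ^+ V * (2 * expR (- (cb * (t / 3 / K) / V%:R `^ b^-1))))%:E.
Proof.
move=> alpha1 b0 tail_a tail_b tail_e n B p0 K L0 t u theta V uB B0 exitB K0 L00 t0 u0 theta0 V0 nV.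
have K0' := ltW K0.
have t30 : (0 <= t / 3)%R by rewrite divr_ge0.
pose A0 := [set we : W * E | ~~ all [in B] (walk_path xi n we.1)].
pose A1 := [set we : W * E | (t / 3 <= \sum_(x <- walk_path xi n we.1) big_part B K we.2 x)%R].
pose A2 := [set we : W * E | (t / 3 <= \sum_(x <- undup (walk_path xi n we.1))
  low_count (walk_path xi n we.1) L0 x * trunc_val K (eta x we.2))%R].
pose A3 := [set we : W * E | all [in B] (walk_path xi n we.1) /\
  (t / 3 / K <= \sum_(x <- walk_path xi n we.1) high_site (walk_path xi n we.1) L0 x)%R].
have mbig x : measurable_fun setT (fun e => big_part B K e x).
  rewrite /big_part; case: (x \in B) => /=; last exact: measurable_cst.
  apply: measurable_fun_ifT => //; exact: measurable_fun_ltr.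
have mA0 : measurable A0.
  apply: (measurable_walk_path_prod iid_xi n (Q := fun s => [set e : E | ~~ all [in B] s])) => s.
  by case: (~~ _); [rewrite (_ : [set _ | _] = setT)//|rewrite (_ : [set _ | _] = set0)//];
    apply/seteqP; split.
have mA1 : measurable A1.
  apply: (measurable_walk_path_prod iid_xi n
    (Q := fun s => [set e | (t / 3 <= \sum_(x <- s) big_part B K e x)%R])) => s.
  apply: measurable_superlevel; exact: measurable_sum.
have mtr := measurable_trunc_val K.
have mlow s : measurable_fun setT
    (fun e => \sum_(x <- undup s) low_count s L0 x * trunc_val K (eta x e))%R.
  by apply: measurable_sum => x; apply: measurable_funM => //; exact: measurableT_comp.
have mA2 : measurable A2.
  apply: (measurable_walk_path_prod iid_xi n
    (Q := fun s => [set e | (t / 3 <= \sum_(x <- undup s) low_count s L0 x * trunc_val K (eta x e))%R])) => s.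
  exact: measurable_superlevel.
have mA3 : measurable A3.
  apply: (measurable_walk_path_prod iid_xi n
    (Q := fun s => [set e : E | all [in B] s /\ (t / 3 / K <= \sum_(x <- s) high_site s L0 x)%R])) => s.
  case: (pselect (all [in B] s /\ (t / 3 / K <= \sum_(x <- s) high_site s L0 x)%R)) => h.
    by rewrite (_ : [set _ | _] = setT)//; apply/seteqP; split.
  by rewrite (_ : [set _ | _] = set0)//; apply/seteqP; split.
have mX : measurable [set we | (t <= scenery_sum xi eta n we)%R].
  exact: measurable_scenery_sum_ge.
have sub : [set we | (t <= scenery_sum xi eta n we)%R] `<=` A0 `|` A1 `|` A2 `|` A3.
  move=> we /=; rewrite scenery_sumE => tX.
  have [sB|sB] := boolP (all [in B] (walk_path xi n we.1)); last by left; left; left.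
  have [h|h|h] := path_sum_split L0 K0' sB tX.
  - by left; left; right.
  - by left; right.
  - by right; split => //; rewrite ler_pdivrMr// [leRHS]mulrC.
pose mu := (P0 \x Peta).
rewrite -/mu.
have b0' : mu A0 <= p0%:E.
  have p00 : (0 <= p0)%R by rewrite -lee_fin; apply: le_trans exitB.
  apply: le_trans (@product_measure_le_swap _ _ _ _ _ P0 Peta _ _ _ mA0 measurable0 p00 _) _; last by rewrite measure0 add0e.
  by move=> e _; exact: exitB.
have b3 : mu A3 <= ((size B)%:R ^+ V * (2 * expR (- (cb * (t / 3 / K) / V%:R `^ b^-1))))%:E.
  have t3K : (0 <= t / 3 / K)%R by rewrite divr_ge0.
  apply: le_trans (@product_measure_le_swap _ _ _ _ _ P0 Peta _ _ _ mA3 measurable0 _ _) _; last by rewrite measure0 add0e.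
    by rewrite mulr_ge0 ?exprn_ge0// mulr_ge0// expR_ge0.
  by move=> e _; exact: (high_site_tail b0 tail_b).
have b2 : mu A2 <= (expR (- (theta * (t / 3)) + 2 * (theta * K) ^+ 2 * (L0 * n.+1%:R)))%:E.
  apply: product_measure_le => // w.
  pose p := walk_path xi n w.
  apply: le_trans (trunc_sum_tail iid_eta sym_eta K (t / 3)%R (low_count p L0) (undup_uniq p) theta0) _.
  rewrite lee_fin ler_expR lerD2l ler_wpM2l ?mulr_ge0 ?sqr_ge0//.
  by apply: le_trans (low_count_sqr_sum _ (ltW L00)) _; rewrite size_walk_path.
have b1 : mu A1 <= (expR (- (ce / 4 * u) + (size B)%:R * (L * expR (- (ce / 4 * K `^ alpha)))) +
      2 * expR (- (ca * (t / 3) / u `^ alpha^-1)))%:E.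
  pose D := [set e | (u <= \sum_(z <- B) big_power alpha K (eta z e))%R].
  have mD : measurable D.
    apply: measurable_superlevel; apply: measurable_sum => z.
    exact: (measurableT_comp (measurable_big_power alpha K)).
  have e0 : (0 <= 2 * expR (- (ca * (t / 3) / u `^ alpha^-1)))%R by rewrite mulr_ge0// expR_ge0.
  apply: le_trans (@product_measure_le_swap _ _ _ _ _ P0 Peta _ _ _ mA1 mD e0 _) _; last first.
    by rewrite EFinD leeD2r//; exact: tail_e.
  move=> e De.
  rewrite (_ : [set w | A1 (w, e)] =
      [set w | (t / 3 <= \sum_(k < n.+1) big_part B K e (walk xi k w))%R]); last first.
    by apply/seteqP; split => w; rewrite /A1 /= walk_path_sum.
  apply: (tail_a n.+1 (big_part B K e) B u) => //.
  - by move=> z; rewrite /big_part; case: ifP => // /andP[_ Kz]; rewrite ltW// (lt_trans K0).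
  - by move=> z zB; rewrite /big_part (negbTE zB).
  have /negP := De; rewrite /D /= -ltNge => h; apply: (le_trans _ (ltW h)).
  rewrite big_seq [leRHS]big_seq; apply: ler_sum => z zB.
  rewrite /big_part /big_power zB /=; case: ifP => // _.
  by rewrite powR0// gt_eqF// (lt_le_trans _ alpha1).
rewrite 3!EFinD.
apply: (@le_trans _ _ (mu (A0 `|` A1 `|` A2 `|` A3))).
  by apply: le_measure; rewrite ?inE//; do 3?apply: measurableU => //.
apply: le_trans (measureU2 _ _ mA3) _; first by do 2?apply: measurableU => //.
apply: leeD => //.
apply: le_trans (measureU2 _ _ mA2) _; first by apply: measurableU.
apply: leeD => //.
apply: le_trans (measureU2 _ mA0 mA1) _.
exact: leeD.
Qed.

End upper_bound_finite.

(** * Choice of the parameters *)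

Section asymptotics.
Context (R : realType).

Lemma powRD_gt0 (x a b : R) : 0 < x -> x `^ (a + b) = x `^ a * x `^ b.
Proof. by move=> x0; rewrite powRD//; apply/implyP => _; rewrite gt_eqF. Qed.

Lemma powRM_gt0 (x y a : R) : 0 < x -> 0 < y -> (x * y) `^ a = x `^ a * y `^ a.
Proof. by move=> x0 y0; rewrite powRM// ltW. Qed.

Lemma near_powR_le (C a b : R) : a < b ->
  \forall n \near \oo, C * n%:R `^ a <= n%:R `^ b.
Proof.
move=> ab; have ba : 0 < b - a by rewrite subr_gt0.
pose M := Num.max C 1 `^ (b - a)^-1.
exists (Num.truncn M).+1 => // n /= Mn.
have Mn' : M <= n%:R.
  by apply: ltW; apply: lt_le_trans (truncnS_gt M) _; rewrite ler_nat.
have n0 : 0 < n%:R :> R by rewrite ltr0n; apply: leq_trans Mn.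
have -> : n%:R `^ b = n%:R `^ (b - a) * n%:R `^ a :> R.
  by rewrite -powRD_gt0 ?subrK.
rewrite ler_wpM2r ?powR_ge0//; apply: (@le_trans _ _ (Num.max C 1)).
  by rewrite le_max lexx.
have C0 : 0 <= Num.max C 1 by rewrite le_max ler01 orbT.
have -> : Num.max C 1 = M `^ (b - a).
  by rewrite /M -powRrM mulVf ?gt_eqF// powRr1.
by apply: ge0_ler_powR; rewrite ?nnegrE ?powR_ge0// ltW.
Qed.

Lemma near_const_le (C b : R) : 0 < b -> \forall n \near \oo, C <= n%:R `^ b.
Proof.
move=> b0; have := near_powR_le C b0; apply: filterS => n.
by rewrite powRr0 mulr1.
Qed.

Lemma ln_le_powR (x a : R) : 0 < x -> 0 < a -> ln x <= x `^ a / a.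
Proof.
move=> x0 a0; rewrite ler_pdivlMr// mulrC.
apply: (@le_trans _ _ (1 + a * ln x)); first by rewrite lerDr.
by rewrite /powR gt_eqF//; exact: expR_ge1Dx.
Qed.

(** Puts the polynomial size, through 2 n^2 + 1 <= e^3 n^2, in the form exp(O(n^a)) with a as small
    as desired, to be compared with the other exponents. *)
Lemma box_size_le (n d k : nat) (a : R) : (0 < n)%N -> 0 < a ->
  (k <= (2 * (n * n)).+1 ^ d)%N ->
  k%:R <= expR (d%:R * (3 + 2 / a) * n%:R `^ a).
Proof.
move=> n0 a0 kd; have x0 : 0 < n%:R :> R by rewrite ltr0n.
have x1 : 1 <= n%:R :> R by rewrite ler1n.
apply: (@le_trans _ _ ((expR (3 + 2 * ln n%:R)) ^+ d)).
  apply: (@le_trans _ _ ((2 * (n * n)).+1 ^ d)%:R); first by rewrite ler_nat.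
  rewrite natrX; apply: lerXn2r; rewrite ?nnegrE ?expR_ge0//.
  have -> : expR (3 + 2 * ln n%:R) = expR 3 * (n%:R ^+ 2) :> R.
    by rewrite expRD (expRM_natl 2) lnK ?posrE.
  apply: (@le_trans _ _ (3 * n%:R ^+ 2)).
    by rewrite -natrX -natrM ler_nat; nia.
  by rewrite ler_wpM2r ?sqr_ge0//; apply: le_trans (expR_ge1Dx _); lra.
rewrite -expRM_natr ler_expR mulrC -mulrA ler_wpM2l//.
have h1 := ln_le_powR x0 a0.
have h2 := ler_powR x1 (ltW a0); rewrite powRr0 in h2.
have -> : (3 + 2 / a) * n%:R `^ a = 3 * n%:R `^ a + 2 * (n%:R `^ a / a) :> R by ring.
by lra.
Qed.

Lemma exit_term_le (C x s h : R) : 0 < C -> 1 <= x -> 2^-1 <= h ->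
  (C + 2) * x `^ h + s <= x -> C * x * expR (- x) <= expR (- s).
Proof.
move=> C0 x1 h12 hx.
have x0 : 0 < x by exact: lt_le_trans x1.
have xh1 : 1 <= x `^ h.
  have h0 : 0 <= h by lra.
  by have := ler_powR x1 h0; rewrite powRr0.
have half0 : 0 < 2^-1 :> R by rewrite invr_gt0.
have lnx := ln_le_powR x0 half0.
have xh : x `^ 2^-1 <= x `^ h by rewrite ler_powR.
have lnC : ln C <= C.
  apply: le_trans (ln_le_powR C0 ltr01) _; by rewrite divr1 powRr1 // ltW.
have -> : C * x * expR (- x) = expR (ln C + ln x - x).
  by rewrite !expRD !lnK ?posrE.
rewrite ler_expR; move: lnx; rewrite invrK => lnx.
have : C <= C * x `^ h by rewrite ler_peMr// ltW.
by lra.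
Qed.

(** [theta] minimizes -theta t/3 + 2 theta^2 D with D = K^2 L0 n1, and the minimum is -t^2 / (72 D).
    Since D <= 2 x^(2 - g - dl), it is of order at least x^(g + dl) in size, and the spare x^dl
    outweighs the constants in y. *)
Lemma gaussian_term_le (x y K L0 g dl n1 : R) : 0 < y -> 1 <= x -> 0 < n1 -> n1 <= 2 * x ->
  K = x `^ dl -> L0 = x `^ (1 - g - 3 * dl) ->
  144 * y `^ g / y ^+ 2 <= x `^ dl ->
  forall t theta, t = x * y -> theta = t / (12 * (K ^+ 2 * (L0 * n1))) ->
  - (theta * (t / 3)) + 2 * (theta * K) ^+ 2 * (L0 * n1) <= - t `^ g.
Proof.
move=> y0 x1 n10 n1x KE LE hx t theta tE thetaE.
have x0 : 0 < x by exact: lt_le_trans x1.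
have K0 : 0 < K by rewrite KE powR_gt0.
have L00 : 0 < L0 by rewrite LE powR_gt0.
pose D := K ^+ 2 * (L0 * n1).
have D0 : 0 < D by rewrite !mulr_gt0// exprn_gt0.
have -> : - (theta * (t / 3)) + 2 * (theta * K) ^+ 2 * (L0 * n1) = - (t ^+ 2 / (72 * D)).
  by rewrite thetaE /D; field; rewrite !gt_eqF.
rewrite lerN2 ler_pdivlMr ?mulr_gt0//.
rewrite tE powRM_gt0// exprMn.
have Dx : D <= 2 * x ^+ 2 * (x `^ g)^-1 * (x `^ dl)^-1.
  apply: (@le_trans _ _ (K ^+ 2 * (L0 * (2 * x)))).
    by rewrite ler_pM2l ?exprn_gt0// ler_pM2l.
  rewrite KE LE -powR_mulrn ?powR_ge0// -powRrM.
  have -> : x `^ (1 - g - 3 * dl) = x * (x `^ g)^-1 * (x `^ (dl * 2))^-1 * (x `^ dl)^-1.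
    rewrite -{2}(powRr1 (ltW x0)) -!powRN -!powRD_gt0//; congr (_ `^ _); lra.
  by rewrite le_eqVlt; apply/orP; left; apply/eqP; field; rewrite !gt_eqF ?powR_gt0.
have g0 : 0 < x `^ g by rewrite powR_gt0.
have d0 : 0 < x `^ dl by rewrite powR_gt0.
apply: (@le_trans _ _ (x `^ g * y `^ g * (72 * (2 * x ^+ 2 * (x `^ g)^-1 * (x `^ dl)^-1)))).
  by rewrite ler_pM2l ?mulr_gt0 ?powR_gt0// ler_pM2l.
have -> : x `^ g * y `^ g * (72 * (2 * x ^+ 2 * (x `^ g)^-1 * (x `^ dl)^-1)) =
  x ^+ 2 * (144 * y `^ g / x `^ dl) by field; rewrite !gt_eqF.
rewrite ler_pM2l ?exprn_gt0// ler_pdivrMr//.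
by move: hx; rewrite ler_pdivrMr ?exprn_gt0// [in leRHS]mulrC.
Qed.

(** The union costs exponent g + 4 dl, and the gain has exponent 1 - g/b - 4 dl >= g + 6 dl; the
    difference 2 dl outweighs the constants. The 9 combines the 3 of t/3 with the 3 in the bound on
    V. *)
Lemma cover_term_le (x y K g dl b M cb V S : R) (Vn : nat) : 0 < y -> 1 <= x -> 1 <= b ->
  0 < dl -> 0 <= g -> 0 < cb -> 0 <= M -> V = Vn%:R -> 0 < V ->
  K = x `^ dl -> V <= 3 * x `^ (g + 3 * dl) -> g / b + g + 10 * dl <= 1 ->
  0 <= S -> S <= expR (M * x `^ dl) ->
  (3 * M + y `^ g) * 9 / (cb * y) <= x `^ (2 * dl) ->
  forall t, t = x * y ->
  S ^+ Vn * (2 * expR (- (cb * (t / 3 / K) / V `^ b^-1))) <= 2 * expR (- t `^ g).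
Proof.
move=> y0 x1 b1 dl0 g0 cb0 M0 VE V0 KE Vx gb S0 SM hx t tE.
have x0 : 0 < x by exact: lt_le_trans x1.
have t0 : 0 < t by rewrite tE mulr_gt0.
have b0 : 0 < b by exact: lt_le_trans b1.
have p0 a : 0 < x `^ a by rewrite powR_gt0.
have SV : S ^+ Vn <= expR (3 * M * x `^ (g + 4 * dl)).
  apply: (@le_trans _ _ (expR (M * x `^ dl) ^+ Vn)).
    by apply: lerXn2r; rewrite ?nnegrE ?expR_ge0.
  rewrite -expRM_natr ler_expR -VE.
  have -> : 3 * M * x `^ (g + 4 * dl) = M * x `^ dl * (3 * x `^ (g + 3 * dl)).
    have -> : g + 4 * dl = dl + (g + 3 * dl) by lra.
    by rewrite powRD_gt0//; ring.
  by rewrite ler_wpM2l// mulr_ge0// ltW.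
have Vb : V `^ b^-1 <= 3 * x `^ (g / b + 3 * dl).
  apply: (@le_trans _ _ ((3 * x `^ (g + 3 * dl)) `^ b^-1)).
    apply: ge0_ler_powR; rewrite ?nnegrE ?invr_ge0//; try exact: ltW.
    by rewrite mulr_ge0// powR_ge0.
  rewrite powRM_gt0// -powRrM; apply: ler_pM; rewrite ?powR_ge0//.
    rewrite -[leRHS]powRr1// ler_powR//; last by rewrite invf_le1.
    by rewrite ler1n.
  rewrite ler_powR// mulrDl lerD2l ler_pdivrMr// ler_peMr//.
  by rewrite mulr_ge0// ltW.
have Vb0 : 0 < V `^ b^-1 by rewrite powR_gt0.
have main : 3 * M * x `^ (g + 4 * dl) + t `^ g <= cb * (t / 3 / K) / V `^ b^-1.
  apply: (@le_trans _ _ (cb * y / 9 * x `^ (g + 6 * dl))); last first.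
    apply: (@le_trans _ _ (cb * (t / 3 / K) / (3 * x `^ (g / b + 3 * dl)))).
      have -> : cb * (t / 3 / K) / (3 * x `^ (g / b + 3 * dl)) =
          cb * y / 9 * x `^ (1 - dl - (g / b + 3 * dl)).
        rewrite tE KE; have -> : x `^ (1 - dl - (g / b + 3 * dl)) =
           x * (x `^ dl)^-1 * (x `^ (g / b + 3 * dl))^-1.
          by rewrite -{2}(powRr1 (ltW x0)) -!powRN -!powRD_gt0.
        by field; rewrite !gt_eqF.
      have cy0 : 0 <= cb * y / 9 by rewrite divr_ge0// mulr_ge0// ltW.
      by rewrite ler_wpM2l// ler_powR//; lra.
    have cc0 : 0 < cb * (t / 3 / K) by rewrite mulr_gt0// !divr_gt0// KE.
    by rewrite ler_pM2l// lef_pV2 ?posrE ?mulr_gt0.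
  apply: (@le_trans _ _ ((3 * M + y `^ g) * x `^ (g + 4 * dl))).
    rewrite [leRHS]mulrDl lerD2l tE powRM_gt0// mulrC ler_wpM2l ?powR_ge0//.
    by rewrite ler_powR//; lra.
  have -> : g + 6 * dl = 2 * dl + (g + 4 * dl) by lra.
  rewrite (powRD_gt0 (2 * dl) (g + 4 * dl) x0) mulrA ler_wpM2r ?powR_ge0//.
  move: hx; rewrite ler_pdivrMr ?mulr_gt0// => hx.
  by lra.
apply: (@le_trans _ _ (expR (3 * M * x `^ (g + 4 * dl)) * (2 * expR (- (cb * (t / 3 / K) / V `^ b^-1))))).
  by rewrite ler_wpM2r// mulr_ge0// expR_ge0.
by rewrite mulrCA -expRD ler_pM2l// ler_expR; lra.
Qed.

(** K^alpha >= K = x^dl outgrows the exponent of order x^(dl/2) of the box size. *)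
Lemma large_sites_term_le (c L alpha x dl M S K : R) : 0 < c -> 0 < L -> 1 <= alpha ->
  1 <= x -> 0 < dl -> 0 <= S -> S <= expR (M * x `^ (dl / 2)) -> K = x `^ dl ->
  (M + L) * 4 / c * x `^ (dl / 2) <= x `^ dl ->
  S * (L * expR (- (c / 4 * K `^ alpha))) <= 1.
Proof.
move=> c0 L0 alpha1 x1 dl0 S0 SM KE hx.
have x0 : 0 < x by exact: lt_le_trans x1.
have ge1 a : 0 < a -> 1 <= x `^ a.
  by move=> a0; rewrite -[leLHS](powRr0 x) ler_powR// ltW.
have K1 : 1 <= K by rewrite KE ge1.
apply: (@le_trans _ _ (expR (M * x `^ (dl / 2)) * (expR L * expR (- (c / 4 * K))))).
  apply: ler_pM => //; first by rewrite mulr_ge0 ?expR_ge0// ltW.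
  apply: ler_pM; rewrite ?expR_ge0// ?(ltW L0)//.
    by apply: le_trans (expR_ge1Dx _); rewrite lerDr.
  rewrite ler_expR lerN2 ler_pM2l ?divr_gt0// -[leLHS]powRr1; last exact: le_trans K1.
  exact: ler_powR.
rewrite -!expRD -[leRHS]expR0 ler_expR.
have hM : (M + L) * x `^ (dl / 2) <= c / 4 * K.
  have -> : (M + L) * x `^ (dl / 2) = c / 4 * ((M + L) * 4 / c * x `^ (dl / 2)).
    by field; rewrite gt_eqF.
  by rewrite KE ler_pM2l// divr_gt0.
have hL : L <= L * x `^ (dl / 2) by rewrite ler_peMr ?ge1 ?divr_gt0// ltW.
by lra.
Qed.

(** The five coefficients 1, e, 2, 1, 2 add up to 6 + e, which is absorbed by giving up half of the
    exponent. *)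
Lemma sum_exp_terms_le (cs T a1 a2 a3 a4 a5 : R) : 0 < cs ->
  (5 + expR 1) / (cs / 2) <= T -> a1 <= expR (- (cs * T)) ->
  a2 <= expR 1 * expR (- (cs * T)) -> a3 <= expR (- (cs * T)) ->
  a4 <= expR (- (cs * T)) -> a5 <= 2 * expR (- (cs * T)) ->
  a1 + (a2 + 2 * a3) + a4 + a5 <= expR (- (cs / 2 * T)).
Proof.
move=> cs0 hT h1 h2 h3 h4 h5.
apply: (@le_trans _ _ ((6 + expR 1) * expR (- (cs * T)))).
  by rewrite mulrDl; lra.
have -> : expR (- (cs * T)) = expR (- (cs / 2 * T)) * expR (- (cs / 2 * T)).
  by rewrite -expRD; congr expR; field.
rewrite mulrA ler_piMl ?expR_ge0// expRN ler_pdivrMr ?expR_gt0// mul1r.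
apply: le_trans (expR_ge1Dx _).
by move: hT; rewrite ler_pdivrMr ?divr_gt0//; lra.
Qed.

End asymptotics.

(** * The two bounds for large n *)

Section asymptotic_bounds.
Context (R : realType) (d : nat) (dW dE : measure_display) (W : measurableType dW)
  (E : measurableType dE) (P0 : probability W R) (Peta : probability E R)
  (xi : nat -> {RV P0 >-> zlattice d}) (eta : zlattice d -> {RV Peta >-> R}).
Hypotheses (d0 : (0 < d)%N) (iid_xi : iid xi) (gX : genuinely_dimensional (xi 0%N))
  (cX : centered (xi 0%N)) (eX : exponential_moments (xi 0%N))
  (iid_eta : iid eta) (sym_eta : symmetric_law (eta 0)).
Variables (alpha c : R).
Hypotheses (alpha1 : 1 <= alpha) (c0 : 0 < c)
  (tail_eta : asymptotic (fun t => fine (Peta [set e | t < eta 0 e]))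
                         (fun t => expR (- (c * t `^ alpha)))).

Local Notation g := (alpha / (alpha + 1)).

Lemma scenery_lower : exists2 c1 : R, 0 < c1 & forall y : R, 0 < y ->
  \forall n \near \oo, ((expR (- (c1 * (n%:R * y) `^ g)))%:E
    <= (P0 \x Peta) [set we | (n%:R * y <= scenery_sum xi eta n we)%R])%E.
Proof.
have alpha0 : 0 < alpha by exact: lt_le_trans alpha1.
have a10 : 0 < alpha + 1 by rewrite addr_gt0.
pose mass a := P0 (xi 0%N @^-1` [set a]).
have mass_fin a : mass a \is a fin_num by rewrite fin_num_measure//; exact: measurable_funPTI.
have [s [s0 sS sum0]] := @zero_cycle R d (fun a => 0 < mass a)%E (support_neg cX eX gX) d0.
have [mu /andP[mu0 mu1] muP] := seq_positive_lower_bound mass_fin sS.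
have [t0 t00 tails] := tail_two_sided tail_eta.
set m := size s.
(* Cost in the exponent of one run through the cycle, each increment having mass at least [mu]. *)
pose kappa : R := m%:R * - ln mu.
have kappa0 : 0 <= kappa by rewrite mulr_ge0// oppr_ge0 ln_le0.
have muX N : mu ^+ (N * m) = expR (- (kappa * N%:R)).
  by rewrite -{1}(lnK mu0) -expRM_natr natrM /kappa; congr expR; ring.
have c1_gt0 : 0 < 2 * kappa + c + 3.
  by have := c0; have := kappa0; lra.
(* 2 kappa because N <= 2 t^g, c for the height at the origin, and 3 because t^g >= 1 and e^(-3) <=
   1/4 pays for two factors 1/2. *)
exists (2 * kappa + c + 3) => //.
move=> y y0.
have g0 : 0 < g by rewrite divr_gt0.
have g1 : g < 1 by rewrite ltr_pdivrMr// mul1r ltrDl.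
have h0 : 0 < (alpha + 1)^-1 by rewrite invr_gt0.
near=> n.
have n0 : (0 < n)%N by near: n; exact: nbhs_infty_gt.
have x0 : 0 < n%:R :> R by rewrite ltr0n.
have ge_n (C : R) : (C <= n%:R)%R = (C <= n%:R `^ 1) by rewrite powRr1// ltW.
have t1 : 1 <= n%:R * y.
  rewrite -ler_pdivrMr// mul1r ge_n; near: n; exact: near_const_le.
set t := n%:R * y.
have tpos : 0 < t by exact: lt_le_trans t1.
pose v := t `^ (alpha + 1)^-1.
have tg1 : 1 <= t `^ g by rewrite -[leLHS](powRr0 t) ler_powR// ltW.
have va : v `^ alpha = t `^ g by rewrite -powRrM mulrC.
have tgv : t `^ g * v = t.
  rewrite -powRD_gt0// -[RHS]powRr1 ?ltW//; congr (_ `^ _).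
  by field; rewrite gt_eqF.
have vt0 : t0 <= v.
  rewrite /v powRM_gt0// -ler_pdivrMr ?powR_gt0//; near: n; exact: near_const_le.
(* Rounded up, so that N v >= t. *)
pose N := (Num.truncn (t `^ g)).+1.
have Nt : t `^ g <= N%:R by apply/ltW/truncnS_gt.
have N2t : N%:R <= 2 * t `^ g.
  have : (Num.truncn (t `^ g))%:R <= t `^ g by rewrite truncn_le powR_ge0.
  by rewrite /N -natr1; lra.
have Nn : (N * m <= n)%N.
  rewrite -(ler_nat R) natrM; apply: (@le_trans _ _ (2 * t `^ g * m%:R)).
    by rewrite ler_wpM2r.
  have -> : 2 * t `^ g * m%:R = 2 * y `^ g * m%:R * n%:R `^ g.
    by rewrite /t powRM_gt0//; ring.
  by rewrite -[leRHS](powRr1 (ltW x0)); near: n; exact: near_powR_le.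
have tNv : t <= N%:R * v by rewrite -{1}tgv ler_wpM2r ?powR_ge0.
apply: (le_trans _ (scenery_lower_finite iid_xi iid_eta sym_eta (ltW mu0) muP s0 sum0 Nn
  (ltn0Sn _) (powR_ge0 _ _) tNv)).
have /andP[tl _] := tails v vt0.
apply: (@le_trans _ _ ((2^-1)%:E * (2^-1 * expR (- (c * v `^ alpha)))%:E *
    (mu ^+ (N * m))%:E)%E); last first.
  apply: lee_wpmul2r; first by rewrite lee_fin exprn_ge0// ltW.
  by apply: lee_wpmul2l; rewrite ?lee_fin ?invr_ge0.
rewrite -!EFinM lee_fin muX va.
have e3 : expR (- 3) <= 2^-1 * 2^-1 :> R.
  rewrite expRN -invfM lef_pV2 ?posrE ?expR_gt0//.
  by apply: le_trans (expR_ge1Dx _); lra.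
apply: (@le_trans _ _ (expR (- 3) * expR (- (c * t `^ g)) * expR (- (kappa * N%:R)))).
  rewrite -!expRD ler_expR.
  have : kappa * N%:R <= kappa * (2 * t `^ g) by rewrite ler_wpM2l.
  by lra.
by rewrite mulrA !ler_wpM2r ?expR_ge0.
Unshelve. all: by end_near.
Qed.

Lemma scenery_upper : alpha < d%:R / 2 -> exists2 c2 : R, 0 < c2 & forall y : R, 0 < y ->
  \forall n \near \oo, ((P0 \x Peta) [set we | (n%:R * y <= scenery_sum xi eta n we)%R]
    <= (expR (- (c2 * (n%:R * y) `^ g)))%:E)%E.
Proof.
move=> alphad.
have alpha0 : 0 < alpha by exact: lt_le_trans alpha1.
have a10 : 0 < alpha + 1 by rewrite addr_gt0.
pose b := (alpha + d%:R / 2) / 2.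
have [alphab bd] : alpha < b /\ b < d%:R / 2 by rewrite /b; split; lra.
have b1 : 1 <= b by apply: le_trans alpha1 (ltW alphab).
have b0 : 0 < b by exact: lt_trans alphab.
have [ca ca0 tail_a] := walk_power_tail iid_xi cX eX gX d0 alpha1 alphad.
have [cb cb0 tail_b] := walk_power_tail iid_xi cX eX gX d0 b1 bd.
have [L Lp tail_e] := big_power_sum_tail iid_eta alpha1 c0 tail_eta.
have [C C0 exit_box] := walk_box_exit iid_xi eX.
have g0 : 0 < g by rewrite divr_gt0.
have g1 : g < 1 by rewrite ltr_pdivrMr// mul1r ltrDl.
pose sigma := 1 - g / b - g.
have sigma0 : 0 < sigma.
  have -> : sigma = g / alpha - g / b by rewrite /sigma; field; rewrite !gt_eqF.
  by rewrite subr_gt0 ltr_pM2l// ltf_pV2.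
(* Ten parts: [cover_term_le] spends 4 on the union and 4 on the gain, and keeps 2 against the
   constants. *)
pose dl := sigma / 10.
have dl0 : 0 < dl by rewrite divr_gt0.
have gb : g / b + g + 10 * dl <= 1 by rewrite /dl /sigma; lra.
(* At least 1/2 for [exit_term_le], at least g to dominate t^g, and below 1 so that x^h is
   negligible against the exponent x of the exit probability. *)
pose h := Num.max g 2^-1.
have gh : g <= h by rewrite le_max lexx.
have h12 : 2^-1 <= h by rewrite le_max lexx orbT.
have h1 : h < 1 by rewrite gt_max g1 /= invf_lt1// ltr1n.
(* The box size is measured at exponent dl/2 so that it is negligible against K = x^dl. *)
pose M : R := d%:R * (3 + 2 / (dl / 2)).
have ME : M = d%:R * (3 + 2 / (dl / 2)) by [].
have M0 : 0 <= M by rewrite mulr_ge0// addr_ge0// divr_ge0// divr_ge0// ltW.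
pose cs := Num.min (c / 4) (Num.min (ca / 3) 1).
have cs0 : 0 < cs by rewrite !lt_min !divr_gt0 ?ltr01.
have [cs1 cs2 cs3] : [/\ cs <= c / 4, cs <= ca / 3 & cs <= 1].
  by split; rewrite !ge_min lexx ?orbT.
clearbody sigma dl h M cs.
exists (cs / 2); first by rewrite divr_gt0.
move=> y y0.
have yg0 : 0 < y `^ g by rewrite powR_gt0.
near=> n.
have n0 : (0 < n)%N by near: n; exact: nbhs_infty_gt.
set x : R := n%:R.
have x1 : 1 <= x by rewrite ler1n.
have x0 : 0 < x by exact: lt_le_trans x1.
have n12 : n.+1%:R <= 2 * x by rewrite -natr1 -/x; lra.
set t := x * y.
have t0 : 0 < t by rewrite mulr_gt0.
have tgE : t `^ g = x `^ g * y `^ g by rewrite powRM_gt0.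
pose K := x `^ dl.
have K1 : 1 <= K by rewrite -[leLHS](powRr0 x) ler_powR// ltW.
have K0 : 0 < K by exact: lt_le_trans K1.
pose L0 := x `^ (1 - g - 3 * dl).
have L00 : 0 < L0 by rewrite powR_gt0.
pose V := (Num.truncn (n.+1%:R / L0)).+1.
have nV : n.+1%:R <= V%:R * L0 by rewrite -ler_pdivrMr//; apply/ltW/truncnS_gt.
have Vx : V%:R <= 3 * x `^ (g + 3 * dl).
  have h1' : (Num.truncn (n.+1%:R / L0))%:R <= n.+1%:R / L0.
    by rewrite truncn_le divr_ge0// ltW.
  have h2 : n.+1%:R / L0 <= 2 * x `^ (g + 3 * dl).
    rewrite ler_pdivrMr// -mulrA -powRD_gt0//.
    have -> : g + 3 * dl + (1 - g - 3 * dl) = 1 by ring.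
    by rewrite powRr1// ltW.
  have h3 : 1 <= x `^ (g + 3 * dl).
    have p0 : 0 <= g + 3 * dl by lra.
    by rewrite -[leLHS](powRr0 x) ler_powR.
  by rewrite /V -natr1; lra.
have [B [uB sB BP]] := lattice_box d (n * n).
have B0 : (0 < size B)%N.
  have : 0 \in B by apply: BP => i; rewrite mxE.
  by case: (B).
have dl20 : 0 < dl / 2 by rewrite divr_gt0.
have sBM2 : (size B)%:R <= expR (M * x `^ (dl / 2)).
  by rewrite ME; exact: box_size_le.
have dl2 : x `^ (dl / 2) <= x `^ dl by rewrite ler_powR//; lra.
have sBM : (size B)%:R <= expR (M * x `^ dl).
  by apply: le_trans sBM2 _; rewrite ler_expR ler_wpM2l.
pose theta := t / (12 * (K ^+ 2 * (L0 * n.+1%:R))).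
have theta0 : 0 <= theta.
  by rewrite divr_ge0 ?ltW// !mulr_gt0// exprn_gt0.
have u0 : 0 < t `^ g by rewrite powR_gt0.
(* With u = t^g the large values cost exp(-c t^g / 4) to the scenery, and [walkB] below shows that
   the walk pays an exponent of the same order. *)
apply: le_trans (scenery_upper_finite iid_xi iid_eta sym_eta alpha1 b0 tail_a tail_b tail_e
  uB B0 (exit_box n B BP) K0 L00 (ltW t0) u0 theta0 (ltn0Sn _) nV) _.
rewrite lee_fin -/x -/V.
have exitB : C * x * expR (- x) <= expR (- t `^ g).
  apply: (exit_term_le C0 x1 h12).
  apply: (@le_trans _ _ ((C + 2 + y `^ g) * x `^ h)).
    have : x `^ g * y `^ g <= y `^ g * x `^ h.
      by rewrite mulrC ler_pM2l//; exact: ler_powR.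
    by rewrite tgE; lra.
  rewrite -[leRHS](powRr1 (ltW x0)) /x; near: n; exact: near_powR_le.
have gaussB : expR (- (theta * (t / 3)) + 2 * (theta * K) ^+ 2 * (L0 * n.+1%:R)) <=
    expR (- t `^ g).
  rewrite ler_expR; apply: (@gaussian_term_le _ x y K L0 g dl n.+1%:R) => //.
  rewrite /x; near: n; exact: near_const_le.
have coverB : (size B)%:R ^+ V * (2 * expR (- (cb * (t / 3 / K) / V%:R `^ b^-1))) <=
    2 * expR (- t `^ g).
  apply: (@cover_term_le _ x y K g dl b M cb V%:R (size B)%:R V) => //; first exact: ltW.
  by rewrite /x; near: n; apply: near_const_le; rewrite mulr_gt0.
have bigB : expR (- (c / 4 * t `^ g) + (size B)%:R * (L * expR (- (c / 4 * K `^ alpha)))) <=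
    expR (1 - c / 4 * t `^ g).
  rewrite ler_expR addrC lerD2r.
  apply: (large_sites_term_le c0 Lp alpha1 x1 dl0 _ sBM2) => //.
  by rewrite /x; near: n; apply: near_powR_le; rewrite ltr_pdivrMr// ltr_pMr// ltr1n.
have walkB : ca * (t / 3) / (t `^ g) `^ alpha^-1 = ca / 3 * t `^ g.
  have -> : (t `^ g) `^ alpha^-1 = t `^ (1 - g).
    by rewrite -powRrM; congr (_ `^ _); field; rewrite !gt_eqF.
  have tE : t = t `^ g * t `^ (1 - g).
    by rewrite -powRD_gt0// addrC subrK powRr1// ltW.
  by rewrite {1}tE; field; rewrite gt_eqF// powR_gt0.
rewrite walkB.
have le_e k : cs <= k -> expR (- (k * t `^ g)) <= expR (- (cs * t `^ g)).
  by move=> csk; rewrite ler_expR lerN2 ler_wpM2r ?powR_ge0.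
have e1 : expR (- t `^ g) <= expR (- (cs * t `^ g)).
  by have := le_e 1 cs3; rewrite mul1r.
apply: (sum_exp_terms_le cs0).
- rewrite tgE -ler_pdivrMr// /x; near: n; exact: near_const_le.
- exact: le_trans exitB e1.
- by apply: (le_trans bigB); rewrite expRD ler_pM2l ?expR_gt0// le_e.
- exact: le_e.
- exact: le_trans gaussB e1.
- by apply: (le_trans coverB); rewrite ler_pM2l.
Unshelve. all: by end_near.
Qed.

End asymptotic_bounds.

Theorem proposition1p1 (R : realType) (d : nat) (alpha : R)
    (dW : measure_display) (W : measurableType dW) (P0 : probability W R)
    (xi : nat -> {RV P0 >-> zlattice d})
    (dE : measure_display) (E : measurableType dE) (Peta : probability E R)
    (eta : zlattice d -> {RV Peta >-> R}) :
  (1 <= d)%N ->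
  1 <= alpha -> alpha < d%:R / 2 ->
  iid xi ->
  genuinely_dimensional (xi 0%N) ->
  centered (xi 0%N) ->
  exponential_moments (xi 0%N) ->
  iid eta ->
  symmetric_law (eta 0) ->
  (exists f : R -> R,
    [/\ has_density (eta 0) f,
        forall x : R, f (- x) = f x &
        forall x y : R, 0 <= x -> x <= y -> f y <= f x]) ->
  (exists2 c_alpha : R, 0 < c_alpha &
    asymptotic (fun t => fine (Peta [set e | t < eta 0 e]))
               (fun t => expR (- (c_alpha * t `^ alpha)))) ->
  exists c1 c2 : R, [/\ 0 < c1, 0 < c2 &
    forall y : R, 0 < y -> \forall n \near \oo,
      ((expR (- (c1 * (n%:R * y) `^ (alpha / (alpha + 1)))))%:E
         <= (P0 \x Peta)%E [set we | (n%:R * y <= scenery_sum xi eta n we)%R]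
         <= (expR (- (c2 * (n%:R * y) `^ (alpha / (alpha + 1)))))%:E)%E].
Proof.
move=> d1 alpha1 alphad iid_xi gX cX eX iid_eta sym_eta _ [c c0 tail_eta].
have [c1 c10 lower] := scenery_lower d1 iid_xi gX cX eX iid_eta sym_eta alpha1 c0 tail_eta.
have [c2 c20 upper] :=
  scenery_upper d1 iid_xi gX cX eX iid_eta sym_eta alpha1 c0 tail_eta alphad.
exists c1, c2; split=> // y y0.
near=> n; apply/andP; split; first by near: n; exact: lower.
by near: n; exact: upper.
Unshelve. all: by end_near.
Qed.
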